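(* Let $r\in\mathbb N$. There is a constant $c=c(r)>0$, depending only on $r$, such that if $f\in C^r[-1,1]$ is convex, then there is a number $\mathcal N=\mathcal N(f,r)$, depending on $f$ and $r$, such that for every $n\in\mathbb N$ with $n\ge\mathcal N$ there is a convex function $S\in S(T_n,r+2)$ (that is, a continuous convex piecewise polynomial of order $r+2$ with knots at the Chebyshev partition $T_n$) satisfying $$|f(x)-S(x)|\le c(r)\left(\frac{\varphi(x)}{n}\right)^r\omega_2\left(f^{(r)},\frac{\varphi(x)}{n}\right),\qquad x\in[-1,1],$$ and, moreover, for all $x\in[-1,-1+n^{-2}]\cup[1-n^{-2},1]$, $$|f(x)-S(x)|\le c(r)\,\varphi^{2r}(x)\,\omega_2\left(f^{(r)},\frac{\varphi(x)}{n}\right)$$ and $$|f(x)-S(x)|\le c(r)\,\varphi^{2r}(x)\,\omega_1\left(f^{(r)},\varphi^2(x)\right).$$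
   Context: $C^r[-1,1]$ is the space of $r$ times continuously differentiable functions on $[-1,1]$, and $\varphi(x)=\sqrt{1-x^2}$. For $k\in\mathbb N$ and a continuous $g$ on $[-1,1]$, set $\Delta_u^k(g,x):=\sum_{i=0}^k(-1)^i\binom{k}{i}g(x+(k/2-i)u)$ if $x\pm(k/2)u\in[-1,1]$ and $\Delta_u^k(g,x):=0$ otherwise; the $k$th modulus of smoothness is $\omega_k(g,t):=\sup_{0<u\le t}\sup_{x\in[-1,1]}|\Delta_u^k(g,x)|$ (with $\omega_k(g,0)=0$). The Chebyshev partition is $T_n=\{t_j\}_{j=0}^n$, $t_j=-\cos(j\pi/n)$, $0\le j\le n$. For a partition $X=\{x_j\}_{j=0}^n$, $-1=x_0<x_1<\dots<x_n=1$, and $m\in\mathbb N$, $S(X,m)$ denotes the set of continuous functions on $[-1,1]$ which on each interval $[x_{j-1},x_j]$, $1\le j\le n$, coincide with an algebraic polynomial of degree $\le m-1$. *)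

(* Defs.v *)
From mathcomp Require Import all_boot all_order all_algebra.
From mathcomp Require Import all_classical all_reals all_analysis.

Set Implicit Arguments.
Unset Strict Implicit.
Unset Printing Implicit Defensive.

Import Order.TTheory GRing.Theory Num.Theory.
Import numFieldNormedType.Exports.

Local Open Scope classical_set_scope.
Local Open Scope ring_scope.

Section Defs.
Variable R : realType.
Implicit Types (D : set R) (f g S X : R -> R).

(* Differentiation relative to D: the difference quotient is taken along y in D
   only, so that it is one-sided at the endpoints when D is a closed interval,
   and values of g outside D are irrelevant to derivatives at points of D. *)
Definition diff_quot g (x y : R) : R := (g y - g x) / (y - x).

Definition derivable_in D g (x : R) : Prop :=
  cvg (diff_quot g x y @[y --> within D x^']).

Definition derive_in D g (x : R) : R :=
  lim (diff_quot g x y @[y --> within D x^']).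

Definition deriven_in D (k : nat) g : R -> R := iter k (derive_in D) g.

Definition Cr_in D (r : nat) g : Prop :=
  (forall i, (i < r)%N -> forall x, D x -> derivable_in D (deriven_in D i g) x)
  /\ {within D, continuous (deriven_in D r g)}.

Definition phi (x : R) : R := Num.sqrt (1 - x ^+ 2).

Definition findiff (k : nat) g (u x : R) : R :=
  if (x - k%:R / 2 * u \in `[-1, 1]) && (x + k%:R / 2 * u \in `[-1, 1])
  then \sum_(i < k.+1) (-1) ^+ i * 'C(k, i)%:R * g (x + (k%:R / 2 - i%:R) * u)
  else 0.

(* [sup] is real-valued: this is the intended supremum when g is bounded on
   [-1, 1], in particular when g is continuous there. *)
Definition modulus (k : nat) g (t : R) : R :=
  sup [set z | exists u x : R,
         [/\ 0 < u <= t, x \in `[-1, 1] & z = `|findiff k g u x|] ].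

Lemma modulus0 k g : modulus k g 0 = 0.
Proof.
rewrite /modulus (_ : mkset _ = set0) ?sup0 // -subset0 => z /=.
by move=> [u [x [/andP[u0 /(lt_le_trans u0)]]]]; rewrite ltxx.
Qed.

Definition chebyshev_knot (n j : nat) : R := - cos (j%:R * pi / n%:R).

(* The partition is x_0 < x_1 < ... < x_n, given by x : nat -> R, of which only
   the values at indices at most n matter. *)
Definition piecewise_poly (n : nat) (x : nat -> R) (m : nat) S : Prop :=
  {within `[-1, 1], continuous S} /\
  forall j, (j < n)%N ->
    exists2 p : {poly R}, (size p <= m)%N &
      forall y, y \in `[x j, x j.+1] -> S y = p.[y].

End Defs.

(* Main.v *)
Require Import Defs.
From mathcomp Require Import all_boot all_order all_algebra.
From mathcomp Require Import all_classical all_reals all_analysis.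
From mathcomp Require Import ring lra zify.

Set Implicit Arguments.
Unset Strict Implicit.
Unset Printing Implicit Defensive.

Import Order.TTheory GRing.Theory Num.Theory.
Import numFieldNormedType.Exports.

Local Open Scope classical_set_scope.
Local Open Scope ring_scope.


(** Write [W] for the second modulus of smoothness of [f^(r)].  On an interval of
    length [h], with local coordinate [t] in [[0, h]], let [hermite] be the polynomial
    of degree at most [r + 1] which has the derivatives of [f] up to order [r] at
    [t = 0] and whose [r]-th derivative is the chord of [f^(r)].  By Whitney's
    inequality ([whitney]) the deviation of [f^(r)] from its chord is at most [W h],
    and integrating [r] times ([chain_bound]) shows that [hermite] approximates [f] to
    within [h^r * W h], and its derivatives accordingly.  Each piece of the spline is a
    small perturbation of this polynomial.

    Gluing convex pieces gives a convex function as soon as values agree and slopes do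
    not decrease at the knots ([glue_pieces]).  On an inner interval one therefore
    interpolates [f] at both knots with slopes turned inwards ([middle_piece]): either
    the chord is good enough, or [hermite], after a small quadratic correction, is moved
    slightly towards its chord ([damped_convex_poly]).  The latter works since the slope
    of a convex polynomial of bounded degree cannot increase mainly near one end
    ([convex_poly_mass_left]).

    At an end point the estimate has to improve as [t] tends to [0], so the piece must
    keep contact of order [r] there, and the value at the inner knot cannot be matched
    as well.  Instead a multiple of [t^(r+1)] is subtracted such that value and slope at
    the inner knot do not exceed those of [f] ([endpoint_piece]).  This stays convex on
    short intervals: the first derivative of order at least [2] which does not vanish at
    the end point is positive and dominates, and if there is none the polynomial is
    affine plus a monomial.  This is the first place where [n] has to be large in terms
    of [f].

    The end pieces leave defects of size [O(h^r * W h)] with [h] of order [n^-2], that is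
    [O(n^-2)].  They are removed by lowering the inner pieces by a piecewise linear
    function with one concave kink at an inner knot ([assemble]).  To keep convexity,
    the slope of the spline must have a jump at this knot that absorbs the kink.  If
    the derivative of [f] is not constant, then by the pigeonhole principle some interval
    away from the end points carries an increase of it of at least [c(f) / n]
    ([heavy_interval]), which exceeds the kink for large [n]; this is the second place
    where [n] depends on [f].  If the derivative is constant, [f] is itself a spline.

    For the final estimates, inner intervals have length [O(phi x / n)] ([phi_gap]).
    Near the end points the local error involves [W h] with [h] of order [n^-2], whereas
    [W (phi x / n)] is required, with [phi x] of order [sqrt t].  A dyadic argument bounds
    the deviation of [f^(r)] from its chord at [t] by a multiple of [W s] for every [s]
    with [t * h <= s^2] ([chord_pointwise2]), and [W h] is only multiplied by [t / h],
    which makes up for the quadratic growth of [W] ([growth2_scaled]).  With [s] a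
    multiple of [phi x / n] this gives the estimates with [W], and a simpler argument
    with the first modulus gives the last one ([end_estimate_phi]). *)

(** * Differentiable functions on a closed interval *)

Section IntervalCalculus.
Variable R : realType.
Implicit Types (a b c e t x y u v : R) (g : R -> R).

(** Continuity and differentiability are taken relative to [[a, b]], hence
    one-sided at [a] and [b].  The second is linearised: it contains no quotient,
    so it can be added, scaled and composed with affine maps directly. *)
Definition cont_on a b g := forall x, a <= x <= b -> forall e, 0 < e ->
  exists2 d : R, 0 < d & forall y, a <= y <= b -> `|y - x| < d -> `|g y - g x| < e.

Definition der_on a b g (dg : R -> R) := forall x, a <= x <= b -> forall e, 0 < e ->
  exists2 d : R, 0 < d & forall y, a <= y <= b -> `|y - x| < d ->
    `|g y - g x - dg x * (y - x)| <= e * `|y - x|.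

(** [H i] plays the role of the [i]-th derivative of [H 0].  Carrying the whole
    family makes the derivatives stable under restriction, affine changes of
    variable and subtraction of polynomials. *)
Definition chain a b (r : nat) (H : nat -> R -> R) :=
  (forall i, (i < r)%N -> der_on a b (H i) (H i.+1)) /\ cont_on a b (H r).

Lemma cont_onP a b g : cont_on a b g <-> {within `[a, b], continuous g}.
Proof.
split=> [cg|cg x xab e e0].
  apply/subspace_continuousP => x /=; rewrite in_itv /= => xab.
  apply/cvgrPdist_lt => e e0; have [d d0 hd] := cg x xab e e0.
  rewrite near_withinE; apply/nbhs_ballP; exists d => // y /=; rewrite /ball /= => xyd.
  by rewrite in_itv /= => yab; rewrite distrC; apply: hd; rewrite // distrC.
move/subspace_continuousP: cg => /(_ x); rewrite /= in_itv /= => /(_ xab).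
move/cvgrPdist_lt/(_ e e0); rewrite near_withinE => /nbhs_ballP[d d0 hd].
exists d => // y yab yx; rewrite distrC; apply: hd => /=; last by rewrite in_itv.
by rewrite /ball /= distrC.
Qed.

Lemma der_on_cont a b g dg : der_on a b g dg -> cont_on a b g.
Proof.
move=> dgg x xab e e0; have [d d0 hd] := dgg x xab 1 ltr01.
have k0 : 0 < 1 + `|dg x| by rewrite ltr_wpDr.
exists (Num.min d (e / (1 + `|dg x|))); first by rewrite lt_min d0 divr_gt0.
move=> y yab; rewrite lt_min => /andP[yd ye].
have := hd y yab yd; rewrite mul1r => h1.
have -> : g y - g x = (g y - g x - dg x * (y - x)) + dg x * (y - x) by ring.
apply: le_lt_trans (ler_normD _ _) _; rewrite normrM.
apply: (@le_lt_trans _ _ ((1 + `|dg x|) * `|y - x|)); last by rewrite -ltr_pdivlMl // mulrC.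
by rewrite mulrDl mul1r lerD2r.
Qed.

Lemma der_on_sub a b u v g dg : a <= u -> v <= b -> der_on a b g dg -> der_on u v g dg.
Proof.
move=> au vb dgg x /andP[ux xv] e e0.
have [|d d0 hd] := dgg x _ e e0; first by rewrite (le_trans au ux) (le_trans xv vb).
by exists d => // y /andP[uy yv]; apply: hd; rewrite (le_trans au uy) (le_trans yv vb).
Qed.

Lemma cont_on_sub a b u v g : a <= u -> v <= b -> cont_on a b g -> cont_on u v g.
Proof.
move=> au vb dgg x /andP[ux xv] e e0.
have [|d d0 hd] := dgg x _ e e0; first by rewrite (le_trans au ux) (le_trans xv vb).
by exists d => // y /andP[uy yv]; apply: hd; rewrite (le_trans au uy) (le_trans yv vb).
Qed.

Lemma chain_sub a b u v r H : a <= u -> v <= b -> chain a b r H -> chain u v r H.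
Proof.
by move=> au vb [h1 h2]; split=> [i ir|]; [apply: der_on_sub (h1 i ir)|apply: cont_on_sub h2].
Qed.

Lemma chain_shift a b r k H : chain a b (k + r) H -> chain a b r (fun i => H (k + i)%N).
Proof. by move=> [h1 h2]; split=> // i ir; rewrite addnS; apply: h1; rewrite ltn_add2l. Qed.

Lemma chain_cont a b r H i : chain a b r H -> (i <= r)%N -> cont_on a b (H i).
Proof.
move=> [h1 h2]; rewrite leq_eqVlt => /predU1P[->//|ir].
exact: der_on_cont (h1 i ir).
Qed.

Lemma der_on_affine a b a' b' x0 s g dg : (forall t, a' <= t <= b' -> a <= x0 + s * t <= b) ->
  der_on a b g dg -> der_on a' b' (fun t => g (x0 + s * t)) (fun t => s * dg (x0 + s * t)).
Proof.
move=> sub dgg x /sub xab e e0.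
have k0 : 0 < 1 + `|s| by rewrite ltr_wpDr.
have [d d0 hd] := dgg _ xab (e / (1 + `|s|)) (divr_gt0 e0 k0).
exists (d / (1 + `|s|)); first exact: divr_gt0.
move=> y yab yx.
have E : x0 + s * y - (x0 + s * x) = s * (y - x) by ring.
have := hd _ (sub y yab); rewrite E normrM => h.
apply: (@le_trans _ _ (e / (1 + `|s|) * (`|s| * `|y - x|))).
  have -> : s * dg (x0 + s * x) * (y - x) = dg (x0 + s * x) * (s * (y - x)) by ring.
  apply: h.
  apply: (@le_lt_trans _ _ ((1 + `|s|) * `|y - x|)); last by rewrite mulrC -ltr_pdivlMr.
  by rewrite ler_wpM2r // lerDr.
rewrite mulrA ler_wpM2r // -mulrA ger_pMr // ler_pdivrMl // mulr1 lerDr //.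
Qed.

Lemma cont_on_affine a b a' b' x0 s g : (forall t, a' <= t <= b' -> a <= x0 + s * t <= b) ->
  cont_on a b g -> cont_on a' b' (fun t => g (x0 + s * t)).
Proof.
move=> sub cg x /sub xab e e0.
have k0 : 0 < 1 + `|s| by rewrite ltr_wpDr.
have [d d0 hd] := cg _ xab e e0.
exists (d / (1 + `|s|)); first exact: divr_gt0.
move=> y yab yx; apply: hd; first exact: sub.
have -> : x0 + s * y - (x0 + s * x) = s * (y - x) by ring.
rewrite normrM.
apply: (@le_lt_trans _ _ ((1 + `|s|) * `|y - x|)); last by rewrite mulrC -ltr_pdivlMr.
by rewrite ler_wpM2r // lerDr.
Qed.

Lemma der_onZ a b c g dg : der_on a b g dg -> der_on a b (fun x => c * g x) (fun x => c * dg x).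
Proof.
move=> dgg x xab e e0.
have k0 : 0 < 1 + `|c| by rewrite ltr_wpDr.
have [d d0 hd] := dgg _ xab (e / (1 + `|c|)) (divr_gt0 e0 k0).
exists d => // y yab yx.
have -> : c * g y - c * g x - c * dg x * (y - x) = c * (g y - g x - dg x * (y - x)) by ring.
rewrite normrM; apply: (le_trans (ler_wpM2l (normr_ge0 c) (hd y yab yx))).
rewrite mulrA ler_wpM2r // mulrC -mulrA ger_pMr // ler_pdivrMl // mulr1 lerDr //.
Qed.

Lemma der_onB a b g dg k dk : der_on a b g dg -> der_on a b k dk ->
  der_on a b (fun x => g x - k x) (fun x => dg x - dk x).
Proof.
move=> hg hk x xab e e0; have e2 : 0 < e / 2 by rewrite divr_gt0.
have [d1 d10 h1] := hg _ xab _ e2; have [d2 d20 h2] := hk _ xab _ e2.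
exists (Num.min d1 d2) => [|y yab]; first by rewrite lt_min d10.
rewrite lt_min => /andP[/(h1 _ yab) k1 /(h2 _ yab) k2].
have -> : g y - k y - (g x - k x) - (dg x - dk x) * (y - x) =
  (g y - g x - dg x * (y - x)) - (k y - k x - dk x * (y - x)) by ring.
by apply: le_trans (ler_normB _ _) _; move: k1 k2; set z := `|y - x|; lra.
Qed.

Lemma cont_onZ a b c g : cont_on a b g -> cont_on a b (fun x => c * g x).
Proof.
move=> dgg x xab e e0.
have k0 : 0 < 1 + `|c| by rewrite ltr_wpDr.
have [d d0 hd] := dgg _ xab (e / (1 + `|c|)) (divr_gt0 e0 k0).
exists d => // y yab yx; rewrite -mulrBr normrM.
apply: (le_lt_trans (ler_wpM2l (normr_ge0 c) (ltW (hd y yab yx)))).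
by rewrite mulrC -mulrA gtr_pMr // ltr_pdivrMl // mulr1 ltrDr.
Qed.

Lemma cont_onB a b g k : cont_on a b g -> cont_on a b k -> cont_on a b (fun x => g x - k x).
Proof.
move=> hg hk x xab e e0; have e2 : 0 < e / 2 by rewrite divr_gt0.
have [d1 d10 h1] := hg _ xab _ e2; have [d2 d20 h2] := hk _ xab _ e2.
exists (Num.min d1 d2) => [|y yab]; first by rewrite lt_min d10.
rewrite lt_min => /andP[/(h1 _ yab) k1 /(h2 _ yab) k2].
have -> : g y - k y - (g x - k x) = (g y - g x) - (k y - k x) by ring.
by apply: le_lt_trans (ler_normB _ _) _; lra.
Qed.

Lemma der_on_is_derive a b g dg x : der_on a b g dg -> a < x < b -> is_derive x 1 g (dg x).
Proof.
move=> dgg /andP[ax xb].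
suff cv : (fun h : R => h^-1 *: (g (h *: (1 : R) + x) - g x)) @ 0^' --> dg x.
  by apply: DeriveDef; [apply: cvgP cv|apply: (cvg_lim _ cv)].
apply/cvgrPdist_le => e e0; have [|d d0 hd] := dgg x _ e e0; first by rewrite !ltW.
near=> h.
have h0 : h != 0 by near: h; apply: nbhs_dnbhs_neq.
have hlt : `|h| < Num.min d (Num.min (x - a) (b - x)).
  near: h; apply: (@dnbhs0_lt _ R^o).
  by rewrite !lt_min d0 !subr_gt0 ax xb.
move: hlt; rewrite !lt_min => /and3P[hd1 ha hb].
have E : h *: (1 : R) + x - x = h by rewrite addrK /GRing.scale /= mulr1.
have hab : a <= h *: (1 : R) + x <= b.
  rewrite /GRing.scale /= mulr1; move: ha hb; rewrite !ltr_norml => /andP[? ?] /andP[? ?].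
  by apply/andP; split; lra.
have := hd _ hab; rewrite E => /(_ hd1) hh.
have -> : dg x - h^-1 *: (g (h *: (1 : R) + x) - g x) =
   - (h^-1 * (g (h *: (1 : R) + x) - g x - dg x * h)).
  by rewrite /GRing.scale /=; field.
by rewrite normrN normrM normfV ler_pdivrMl ?normr_gt0 // [X in _ <= X]mulrC.
Unshelve. all: by end_near. Qed.

Lemma mean_value a b g dg u v : der_on a b g dg -> a <= u -> u < v -> v <= b ->
  exists2 c, u < c < v & g v - g u = dg c * (v - u).
Proof.
move=> dgg au uv vb; have h := der_on_sub au vb dgg.
have [||c cuv E] := @MVT R g dg u v uv.
- by move=> x; rewrite in_itv /=; apply: der_on_is_derive.
- exact/cont_onP/(der_on_cont h).
by exists c => //; move: cuv; rewrite in_itv.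
Qed.

Lemma der_on_poly a b (p : {poly R}) : der_on a b (horner p) (horner p^`()).
Proof.
elim/poly_ind: p => [|p c IH] x xab e e0.
  by exists 1 => // y _ _; rewrite deriv0 !horner0 mul0r !subr0 normr0 mulr_ge0 // ltW.
have k0 : 0 < 1 + `|x| by rewrite ltr_wpDr.
pose e' := e / 2 / (1 + `|x|).
have e'0 : 0 < e' by rewrite !divr_gt0.
have [d1 d10 h1] := IH x xab e' e'0.
have e2 : 0 < e / 2 by rewrite divr_gt0.
have [d2 d20 h2] := der_on_cont IH xab e2.
exists (Num.min d1 d2) => [|y yab]; first by rewrite lt_min d10.
rewrite lt_min => /andP[/(h1 _ yab) k1 /(h2 _ yab) k2].
rewrite derivD derivC addr0 derivM derivX mulr1 !hornerE.
have -> : p.[y] * y + c - (p.[x] * x + c) - (p^`().[x] * x + p.[x]) * (y - x) =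
  x * (p.[y] - p.[x] - p^`().[x] * (y - x)) + (p.[y] - p.[x]) * (y - x) by ring.
apply: le_trans (ler_normD _ _) _; rewrite !normrM.
have -> : e * `|y - x| = e / 2 * `|y - x| + e / 2 * `|y - x| by field.
apply: lerD; last by rewrite ler_wpM2r // ltW.
apply: le_trans (ler_wpM2l (normr_ge0 x) k1) _.
by rewrite mulrA ler_wpM2r // /e' mulrCA ger_pMr // ler_pdivrMr // mul1r lerDr.
Qed.

Lemma poly_chain a b r (p : {poly R}) : chain a b r (fun i => horner p^`(i)).
Proof.
by split=> [i _|]; rewrite ?derivnS; [|apply: (der_on_cont (@der_on_poly a b _))]; apply: der_on_poly.
Qed.

Lemma chainB a b r H K : chain a b r H -> chain a b r K -> chain a b r (fun i x => H i x - K i x).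
Proof.
by move=> [h1 h2] [k1 k2]; split=> [i ir|]; [apply: der_onB; auto|apply: cont_onB].
Qed.

Lemma chainN a b r H : chain a b r H -> chain a b r (fun i x => -1 * H i x).
Proof. by move=> [h1 h2]; split=> [i ir|]; [apply: der_onZ; auto|apply: cont_onZ]. Qed.

(** The factor [s ^+ i] is that of the chain rule.  With [s = -1] it turns the
    right end point into the left one, which is treated once and for all. *)
Lemma chain_affine a b a' b' x0 s r H : (forall t, a' <= t <= b' -> a <= x0 + s * t <= b) ->
  chain a b r H -> chain a' b' r (fun i t => s ^+ i * H i (x0 + s * t)).
Proof.
move=> sub [h1 h2]; split=> [i ir|]; last by apply: cont_onZ; apply: cont_on_affine h2.
have := der_onZ (s ^+ i) (der_on_affine sub (h1 i ir)).
by under [X in der_on _ _ _ X -> _]funext => t do rewrite mulrA -exprSr.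
Qed.

(** Integrate the bound on the last function [m] times from the common zero, by the
    mean value theorem at each step; the factorial of Taylor's formula is lost,
    which only affects constants. *)
Lemma chain_bound b m H M : 0 <= b -> chain 0 b m H -> (forall i, (i < m)%N -> H i 0 = 0) ->
  (forall t, 0 <= t <= b -> `|H m t| <= M) -> forall t, 0 <= t <= b -> `|H 0%N t| <= M * t ^+ m.
Proof.
move=> b0; elim: m H => [|m IH] H cH H0 HM t tb; first by rewrite expr0 mulr1 HM.
have cH' : chain 0 b m (fun i => H i.+1) by apply: (@chain_shift _ _ _ 1).
have IH' := IH _ cH' (fun i im => H0 i.+1 im) HM.
case/andP: tb => t0 tb; move: t0; rewrite le_eqVlt => /predU1P[<-|t0].
  by rewrite H0 // normr0 expr0n mulr0.
have [c /andP[c0 ct] E] := mean_value (cH.1 0%N isT) (lexx 0) t0 tb.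
rewrite -[H 0%N t]subr0 -(H0 0%N isT) E subr0 normrM (gtr0_norm t0) exprSr mulrA.
rewrite ler_wpM2r ?(ltW t0) //; apply: (le_trans (IH' c _)).
  by rewrite (ltW c0) (le_trans (ltW ct)).
apply: ler_wpM2l; first by apply: le_trans (HM 0 _) => //; rewrite lexx.
by rewrite lerXn2r ?nnegrE ?ltW.
Qed.

Lemma chain_pos b m H : chain 0 b m H -> (forall i, (i < m)%N -> H i 0 = 0) ->
  (forall t, 0 <= t <= b -> 0 < H m t) -> forall t, 0 < t <= b -> 0 < H 0%N t.
Proof.
elim: m H => [|m IH] H cH H0 HM t /andP[t0 tb]; first by rewrite HM // ltW.
have cH' : chain 0 b m (fun i => H i.+1) by apply: (@chain_shift _ _ _ 1).
have IH' := IH _ cH' (fun i im => H0 i.+1 im) HM.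
have [c /andP[c0 ct] E] := mean_value (cH.1 0%N isT) (lexx 0) t0 tb.
move: E; rewrite (H0 0%N isT) !subr0 => ->; apply: mulr_gt0 => //; apply: IH'.
by rewrite c0 (le_trans (ltW ct)).
Qed.

Lemma chain_nneg b m H : chain 0 b m H -> (forall i, (i < m)%N -> H i 0 = 0) ->
  (forall t, 0 <= t <= b -> 0 <= H m t) -> forall t, 0 <= t <= b -> 0 <= H 0%N t.
Proof.
elim: m H => [|m IH] H cH H0 HM t; first exact: HM.
move=> /andP[]; rewrite le_eqVlt => /predU1P[<- _|t0 tb]; first by rewrite H0.
have cH' : chain 0 b m (fun i => H i.+1) by apply: (@chain_shift _ _ _ 1).
have IH' := IH _ cH' (fun i im => H0 i.+1 im) HM.
have [c /andP[c0 ct] E] := mean_value (cH.1 0%N isT) (lexx 0) t0 tb.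
move: E; rewrite (H0 0%N isT) !subr0 => ->; apply: mulr_ge0; last exact: ltW.
by apply: IH'; rewrite (ltW c0) (le_trans (ltW ct)).
Qed.

Lemma der_mono a b g dg : der_on a b g dg -> (forall x, a <= x <= b -> 0 <= dg x) ->
  forall x y, a <= x -> x <= y -> y <= b -> g x <= g y.
Proof.
move=> dgg pos x y ax; rewrite le_eqVlt => /predU1P[->//|xy] yb.
have [c /andP[xc cy] E] := mean_value dgg ax xy yb.
rewrite -subr_ge0 E mulr_ge0 ?subr_ge0 ?(ltW xy) // pos //.
by rewrite (le_trans ax (ltW xc)) (le_trans (ltW cy) yb).
Qed.

Lemma mono_tangent a b g dg : der_on a b g dg ->
  (forall x y, a <= x -> x <= y -> y <= b -> dg x <= dg y) ->
  forall x y, a <= x <= b -> a <= y <= b -> g x + dg x * (y - x) <= g y.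
Proof.
move=> dgg mono x y /andP[ax xb] /andP[ay yb].
have [xy|yx|->] := ltgtP x y; last by rewrite subrr mulr0 addr0.
  have [c /andP[xc cy] E] := mean_value dgg ax xy yb.
  rewrite -lerBrDl E ler_wpM2r ?subr_ge0 ?(ltW xy) // mono ?(ltW xc) //.
  exact: le_trans (ltW cy) yb.
have [c /andP[xc cy] E] := mean_value dgg ay yx xb.
have h : dg c * (x - y) <= dg x * (x - y).
  rewrite ler_wpM2r ?subr_ge0 ?(ltW yx) // mono // ?(ltW cy) //.
  exact: (le_trans ay (ltW xc)).
rewrite -E in h; lra.
Qed.

(** Convexity places the graph below the segment from [x] to [y], and near [x] the
    graph is the tangent up to [e * s]; divide by the step [s]. *)
Lemma tangent_of_convex a b g dg : der_on a b g dg ->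
  (forall x y s, a <= x <= b -> a <= y <= b -> 0 <= s <= 1 ->
     g (x + s * (y - x)) <= g x + s * (g y - g x)) ->
  forall x y, a <= x <= b -> a <= y <= b -> g x + dg x * (y - x) <= g y.
Proof.
move=> dgg cvx x y xab yab.
have [->|yx] := eqVneq y x; first by rewrite subrr mulr0 addr0.
apply/ler_addgt0Pr => e e0.
have n0 : 0 < `|y - x| by rewrite normr_gt0 subr_eq0.
have [d d0 hd] := dgg x xab (e / `|y - x|) (divr_gt0 e0 n0).
pose s := Num.min 1 (d / 2 / `|y - x|).
have s0 : 0 < s by rewrite lt_min ltr01 !divr_gt0.
have s1 : s <= 1 by rewrite ge_min lexx.
have sd : s * `|y - x| < d.
  apply: (@le_lt_trans _ _ (d / 2)); last by lra.
  by rewrite -ler_pdivlMr // ge_min lexx orbT.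
have zab : a <= x + s * (y - x) <= b.
  case/andP: xab => *; case/andP: yab => *; apply/andP; split; nra.
have E : x + s * (y - x) - x = s * (y - x) by ring.
have := hd _ zab; rewrite E normrM (gtr0_norm s0) => /(_ sd).
have -> : e / `|y - x| * (s * `|y - x|) = e * s by field; rewrite gt_eqF.
rewrite ler_norml => /andP[h1 _].
have h2 := cvx x y s xab yab (introT andP (conj (ltW s0) s1)).
have h3 : 0 <= s * (g y + e - (g x + dg x * (y - x))) by lra.
by rewrite -subr_ge0 -(pmulr_rge0 _ s0).
Qed.

Lemma mono_of_tangent a b g dg :
  (forall x y, a <= x <= b -> a <= y <= b -> g x + dg x * (y - x) <= g y) ->
  forall x y, a <= x -> x <= y -> y <= b -> dg x <= dg y.
Proof.
move=> tg x y ax; rewrite le_eqVlt => /predU1P[->//|xy] yb.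
have xab : a <= x <= b by rewrite ax (le_trans (ltW xy)).
have yab : a <= y <= b by rewrite yb (le_trans ax (ltW xy)).
have h1 := tg x y xab yab; have h2 := tg y x yab xab.
have h3 : 0 <= (dg y - dg x) * (y - x) by lra.
by rewrite -subr_ge0 -(pmulr_lge0 _ (_ : 0 < y - x)) // subr_gt0.
Qed.

(** At [b] the quotient has to be taken to the left, elsewhere to the right; the
    inequality [(g y - g x) * (y - x) >= 0] covers both. *)
Lemma der_ge0 a b g dg : a < b -> der_on a b g dg ->
  (forall x y, a <= x -> x <= y -> y <= b -> g x <= g y) -> forall x, a <= x <= b -> 0 <= dg x.
Proof.
move=> ab dgg mono x xab.
rewrite leNgt; apply/negP => neg.
have [|d d0 hd] := dgg x xab (- dg x / 2); first by lra.
case/andP: (xab) => ax xb.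
suff [y yab [yx yd mxy]] : exists2 y, a <= y <= b & [/\ y != x, `|y - x| < d & 0 <= (g y - g x) * (y - x)].
  have := hd y yab yd; have n0 : 0 < `|y - x| by rewrite normr_gt0 subr_eq0.
  have sq : (y - x) * (y - x) = `|y - x| * `|y - x| by rewrite -!expr2 real_normK // num_real.
  move=> h; have h2 : `|g y - g x - dg x * (y - x)| * `|y - x| <= (- dg x / 2) * (`|y - x| * `|y - x|).
    by rewrite mulrA ler_wpM2r.
  rewrite -normrM in h2; have h3 := le_trans (ler_norm _) h2.
  have : (g y - g x - dg x * (y - x)) * (y - x) = (g y - g x) * (y - x) - dg x * (`|y - x| * `|y - x|).
    by rewrite -sq; ring.
  have : 0 < - dg x * (`|y - x| * `|y - x|) by rewrite mulr_gt0 ?mulr_gt0 ?oppr_gt0.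
  by lra.
have [xlt|] := ltP x b.
  pose y := x + Num.min (d / 2) (b - x).
  have m0 : 0 < Num.min (d / 2) (b - x) by rewrite lt_min subr_gt0 xlt divr_gt0.
  have m1 : Num.min (d / 2) (b - x) <= d / 2 by rewrite ge_min lexx.
  have m2 : Num.min (d / 2) (b - x) <= b - x by rewrite ge_min lexx orbT.
  exists y; first by apply/andP; split; rewrite /y; lra.
  have E : y - x = Num.min (d / 2) (b - x) by rewrite /y; ring.
  split; first by rewrite -subr_eq0 E gt_eqF.
    by rewrite E gtr0_norm //; lra.
  by rewrite E mulr_ge0 ?subr_ge0 ?mono // /y; lra.
move=> bx; have xe : x = b by lra.
pose y := x - Num.min (d / 2) (x - a).
have m0 : 0 < Num.min (d / 2) (x - a) by rewrite lt_min subr_gt0 xe ab divr_gt0.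
have m1 : Num.min (d / 2) (x - a) <= d / 2 by rewrite ge_min lexx.
have m2 : Num.min (d / 2) (x - a) <= x - a by rewrite ge_min lexx orbT.
exists y; first by apply/andP; split; rewrite /y; lra.
have E : y - x = - Num.min (d / 2) (x - a) by rewrite /y; ring.
split; first by rewrite -subr_eq0 E oppr_eq0 gt_eqF.
  by rewrite E normrN gtr0_norm //; lra.
rewrite E nmulr_lge0 ?oppr_lt0 // subr_le0 mono // /y; lra.
Qed.

Lemma poly_tangent a b (p : {poly R}) : (forall x, a <= x <= b -> 0 <= p^`(2).[x]) ->
  forall x y, a <= x <= b -> a <= y <= b -> p.[x] + p^`().[x] * (y - x) <= p.[y].
Proof.
move=> pos; apply: (mono_tangent (@der_on_poly a b p)).
apply: (der_mono (@der_on_poly a b _)) => x xab; exact: pos.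
Qed.

End IntervalCalculus.

(** * Local approximation by polynomials *)

Section LocalApproximation.
Variable R : realType.
Implicit Types (a b c d e h s t x y u v M : R) (g : R -> R) (p q P : {poly R}) (H : nat -> R -> R).

Lemma size_poly_diff p d m : (size p <= m.+1)%N -> (size (p \Po ('X + d%:P) - p)%R <= m)%N.
Proof.
elim/poly_ind: p m => [|p c IH] m; first by rewrite comp_poly0 subr0 size_poly0.
rewrite size_MXaddC comp_poly_MXaddC.
case: ifP => [/andP[/eqP-> /eqP->] _|_].
  by rewrite comp_poly0 !mul0r subrr size_poly0.
rewrite ltnS => sp.
have -> : (p \Po ('X + d%:P)) * ('X + d%:P) + c%:P - (p * 'X + c%:P) =
  (p \Po ('X + d%:P) - p) * 'X + d *: (p \Po ('X + d%:P)).
  by rewrite -mul_polyC; ring.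
have sc : (size (p \Po ('X + d%:P)) <= m)%N by rewrite size_comp_poly2 // size_XaddC.
apply: leq_trans (size_polyD _ _) _; rewrite geq_max; apply/andP; split; last first.
  exact: leq_trans (size_scale_leq _ _) sc.
case: m sp sc => [|m] sp sc.
  move: sp; rewrite leqn0 size_poly_eq0 => /eqP->.
  by rewrite comp_poly0 subr0 mul0r size_poly0.
have := IH m sp; set q := (_ - p) => sq.
have [->|q0] := eqVneq q 0; first by rewrite mul0r size_poly0.
by rewrite size_mulX.
Qed.

(** A finite difference of order [m] annihilates [p], so [p.[x]] is a combination
    of the other values with binomial coefficients, whose sum is [2 ^+ m - 1]. *)
Lemma poly_extrapolation m p x d M : (size p <= m)%N ->
  (forall k, (0 < k <= m)%N -> `|p.[x + k%:R * d]| <= M) -> `|p.[x]| <= (2 ^+ m - 1) * M.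
Proof.
elim: m p M => [|m IH] p M.
  by rewrite leqn0 size_poly_eq0 => /eqP-> _; rewrite horner0 normr0 expr0 subrr mul0r.
move=> sp hM; pose q := p \Po ('X + d%:P) - p.
have qE y : q.[y] = p.[y + d] - p.[y] by rewrite hornerD hornerN horner_comp !hornerE.
have M1 : `|p.[x + d]| <= M by have := hM 1%N isT; rewrite mul1r.
have hq k : (0 < k <= m)%N -> `|q.[x + k%:R * d]| <= 2 * M.
  move=> /andP[k0 km]; rewrite qE; apply: le_trans (ler_normB _ _) _.
  have m1 : `|p.[x + k%:R * d]| <= M by apply: hM; rewrite k0 leqW.
  have := hM k.+1 km.
  by rewrite -natr1 mulrDl mul1r addrA => m2; rewrite (_ : 2 * M = M + M) ?lerD //; ring.
have := IH q _ (size_poly_diff d sp) hq; rewrite qE => h1.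
have h2 : `|p.[x]| <= `|p.[x + d]| + `|p.[x + d] - p.[x]|.
  by rewrite -{1}(subKr p.[x + d] p.[x]) ler_normB.
rewrite exprS; lra.
Qed.

(** The increase of the slope of a convex polynomial cannot be concentrated near
    [h].  Extrapolating from the nodes [h - k * (h / m.+1)] to [h], the whole
    increase is at most [2 ^+ m.+1] times the increase up to the first node
    [h - h / m.+1], and the latter acts over a length [h / m.+1], which lifts the
    graph above its tangent at [0]. *)
Lemma convex_poly_mass_left P m h : (size P <= m.+2)%N -> 0 < h ->
  (forall t, 0 <= t <= h -> 0 <= P^`(2).[t]) ->
  h * (P^`().[h] - P^`().[0]) <= m.+1%:R * 2 ^+ m.+1 * (P.[h] - P.[0] - h * P^`().[0]).
Proof.
move=> sP h0 pos.
have tg := poly_tangent pos.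
have mono : forall x y, 0 <= x -> x <= y -> y <= h -> P^`().[x] <= P^`().[y].
  by apply: (der_mono (@der_on_poly R 0 h _)) => x xab; apply: pos.
pose k0 : R := m.+1%:R; have k00 : 0 < k0 by rewrite ltr0n.
have k1 : 1 <= k0 by rewrite ler1n.
have [z zE] : exists z, z = h / k0 by exists (h / k0).
pose x1 := h - z.
have hk : 0 < z by rewrite zE divr_gt0.
have hkh : z <= h by rewrite zE ler_pdivrMr // ler_peMr // ltW.
have x1h : 0 <= x1 <= h by rewrite /x1; apply/andP; split; lra.
pose D := P^`() - (P^`().[0])%:P.
have DE y : D.[y] = P^`().[y] - P^`().[0] by rewrite /D !hornerE.
have sD : (size D <= m.+1)%N.
  apply: leq_trans (size_polyD _ _) _; rewrite geq_max size_polyN.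
  rewrite (leq_trans (size_polyC_leq1 _)) // andbT.
  have [->|P0] := eqVneq P 0; first by rewrite deriv0 size_poly0.
  by rewrite -ltnS (leq_trans (lt_size_deriv P0)).
have := @poly_extrapolation m.+1 D h (- z) D.[x1] sD.
have -> : D.[h] = P^`().[h] - P^`().[0] by [].
move=> ext.
have {}ext : `|P^`().[h] - P^`().[0]| <= (2 ^+ m.+1 - 1) * D.[x1].
  apply: ext => k /andP[kp km].
  have kR : 1 <= k%:R :> R by rewrite ler1n.
  have kR2 : k%:R <= k0 by rewrite ler_nat.
  have hh : k0 * z = h by rewrite zE; field; rewrite gt_eqF.
  have y1 : k%:R * - z <= - z by rewrite mulrN lerN2 ler_peMl // ltW.
  have y2 : - h <= k%:R * - z by rewrite mulrN lerN2 -[X in _ <= X]hh ler_wpM2r // ltW.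
  rewrite DE ger0_norm ?subr_ge0 ?mono //; last 2 first.
  - by lra.
  - by lra.
  by rewrite DE lerD2r mono /x1 //; lra.
have D1 : 0 <= D.[x1] by rewrite DE subr_ge0 mono //; case/andP: x1h.
have h1 : P^`().[h] - P^`().[0] <= 2 ^+ m.+1 * D.[x1].
  apply: le_trans (ler_norm _) (le_trans ext _).
  by rewrite ler_wpM2r // gerBl.
have t1 := tg 0 x1; have t2 := tg x1 h.
rewrite !lexx !(ltW h0) x1h in t1 t2.
have {}t1 := t1 isT isT; have {}t2 := t2 isT isT.
have key : z * D.[x1] <= P.[h] - P.[0] - h * P^`().[0].
  have E : h - x1 = z by rewrite /x1; ring.
  rewrite E in t2; rewrite DE; move: t1 t2; rewrite /x1; lra.
apply: le_trans (ler_wpM2l (ltW h0) h1) _.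
have -> : h * (2 ^+ m.+1 * D.[x1]) = k0 * 2 ^+ m.+1 * (z * D.[x1]).
  by rewrite zE; field; rewrite gt_eqF.
by rewrite ler_wpM2l // mulr_ge0 ?exprn_ge0 // ltW.
Qed.

Lemma convex_poly_mass_right P m h : (size P <= m.+2)%N -> 0 < h ->
  (forall t, 0 <= t <= h -> 0 <= P^`(2).[t]) ->
  h * (P^`().[h] - P^`().[0]) <= m.+1%:R * 2 ^+ m.+1 * (h * P^`().[h] - (P.[h] - P.[0])).
Proof.
move=> sP h0 pos; pose Q := P \Po (h%:P - 'X).
have dQ : Q^`() = - (P^`() \Po (h%:P - 'X)).
  by rewrite deriv_comp derivB derivC derivX sub0r mulrN mulr1.
have ddQ : Q^`(2) = P^`(2) \Po (h%:P - 'X).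
  by rewrite derivSn derivn1 dQ derivN deriv_comp derivB derivC derivX sub0r mulrN mulr1 opprK -derivn1 -derivSn.
have QE y : Q.[y] = P.[h - y] by rewrite horner_comp !hornerE.
have dQE y : Q^`().[y] = - P^`().[h - y] by rewrite dQ hornerN horner_comp !hornerE.
have := @convex_poly_mass_left Q m h.
rewrite !QE !dQE subrr subr0 => hl.
have E1 : h * (P^`().[h] - P^`().[0]) = h * (- P^`().[0] - - P^`().[h]) by ring.
have E2 : h * P^`().[h] - (P.[h] - P.[0]) = P.[0] - P.[h] - h * - P^`().[h] by ring.
rewrite E1 E2; apply: hl => //.
  by rewrite size_comp_poly2 // -opprB size_polyN size_XsubC.
by move=> t /andP[t0 th]; rewrite ddQ horner_comp !hornerE pos // subr_ge0 th gerBl.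
Qed.

Definition chord g h t := g 0 + (g h - g 0) / h * t.

Lemma chord_cont g h : cont_on 0 h (chord g h).
Proof.
have -> : chord g h = horner ((g 0)%:P + ((g h - g 0) / h) *: 'X).
  by apply/funext => z; rewrite !hornerE.
exact: der_on_cont (@der_on_poly R 0 h _).
Qed.

(** The coefficient [a] of the top monomial is left free; all derivatives up to
    order [r] at [0] are those of [H]. *)
Definition taylor (r : nat) H a : {poly R} :=
  \poly_(i < r.+2) (if i == r.+1 then a else H i 0 / i`!%:R).

Lemma size_taylor r H a : (size (taylor r H a) <= r.+2)%N.
Proof. exact: size_poly. Qed.

Lemma taylor_deriv0 r H a i : (i <= r)%N -> (taylor r H a)^`(i).[0] = H i 0.
Proof.
move=> ir; rewrite horner_coef0 coef_derivn addn0 ffactnn coef_poly ltnS leqW //.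
by rewrite (ltn_eqF (_ : i < r.+1)%N) // -[LHS]mulr_natr divfK // pnatr_eq0 -lt0n fact_gt0.
Qed.

Lemma taylor_derivr r H a t : (taylor r H a)^`(r).[t] = H r 0 + a * r.+1`!%:R * t.
Proof.
rewrite (@horner_coef_wide _ 2); last first.
  apply/leq_sizeP => j j2; rewrite coef_derivn coef_poly ltnNge.
  by rewrite (_ : (r.+2 <= r + j)%N) ?mul0rn // -addn2 leq_add2l.
rewrite big_ord_recl big_ord1 /= expr0 mulr1 expr1 !coef_derivn addn0 ffactnn.
rewrite !coef_poly ltnS leqnSn (ltn_eqF (_ : r < r.+1)%N) // addn1 ltnSn eqxx.
rewrite -[_ / _ *+ _]mulr_natr divfK ?pnatr_eq0 -?lt0n ?fact_gt0 //.
by have := ffact_fact (leqnSn r); rewrite subSnn (_ : 1`! = 1)%N // muln1 => <-; rewrite mulr_natr.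
Qed.

Lemma taylor_derivS r H a t : (taylor r H a)^`(r.+1).[t] = a * r.+1`!%:R.
Proof.
rewrite (@horner_coef_wide _ 1); last first.
  apply/leq_sizeP => j j2; rewrite coef_derivn coef_poly ltnNge.
  by rewrite (_ : (r.+2 <= r.+1 + j)%N) ?mul0rn // -addn1 leq_add2l.
rewrite big_ord1 coef_derivn addn0 ffactnn expr0 mulr1.
by rewrite coef_poly ltnSn eqxx mulr_natr.
Qed.

Lemma taylorB r H a b : taylor r H a = taylor r H b - (b - a) *: 'X^(r.+1).
Proof.
apply/polyP => i; rewrite coefB coefZ coefXn !coef_poly.
have [->|i1] := eqVneq i r.+1; first by rewrite ltnSn mulr1 subKr.
by rewrite mulr0 subr0.
Qed.

(** The choice of the top coefficient for which the [r]-th derivative is the chord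
    of [H r] on [[0, h]]. *)
Definition hermite r H h := taylor r H ((H r h - H r 0) / h / r.+1`!%:R).

Lemma hermite_derivr r H h t : (hermite r H h)^`(r).[t] = chord (H r) h t.
Proof.
by rewrite taylor_derivr divfK // pnatr_eq0 -lt0n fact_gt0.
Qed.

Lemma hermite_approx r H h t M : chain 0 h r H -> 0 <= t <= h ->
  (forall x, 0 <= x <= t -> `|H r x - chord (H r) h x| <= M) ->
  forall i, (i <= r)%N -> `|H i t - (hermite r H h)^`(i).[t]| <= M * t ^+ (r - i).
Proof.
move=> cH /andP[t0 th] hM i ir.
pose K j x := H (i + j)%N x - (hermite r H h)^`(i + j).[x].
have cK : chain 0 t (r - i) K.
  apply: (@chain_shift R 0 t (r - i) i (fun j x => H j x - (hermite r H h)^`(j).[x])).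
  rewrite subnKC //; apply: chainB; last exact: poly_chain.
  by apply: chain_sub cH.
have := chain_bound t0 cK _ _ (t := t); rewrite /K addn0; apply.
- by move=> j jr; rewrite taylor_deriv0 ?subrr //; lia.
- by move=> x xt; rewrite subnKC // hermite_derivr hM.
- by rewrite t0 lexx.
Qed.

(** Whitney's inequality for second differences.  The deviation [e] from the chord
    vanishes at both ends.  Around a point [c] where [`|e|] is maximal, take the
    largest symmetric step [u]: one of the points [c - u] and [c + u] is an end
    point, so the second difference there is at least [2 * `|e c| - `|e c|]. *)
Lemma whitney g h M : 0 < h -> cont_on 0 h g ->
  (forall x u, 0 < u -> 0 <= x - u -> x + u <= h -> `|g (x + u) - 2 * g x + g (x - u)| <= M) ->
  forall t, 0 <= t <= h -> `|g t - chord g h t| <= M.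
Proof.
move=> h0 cg sd.
pose e t := g t - chord g h t.
have e0 : e 0 = 0 by rewrite /e /chord mulr0 addr0 subrr.
have eh : e h = 0 by rewrite /e /chord; field; rewrite gt_eqF.
have ee x u : 0 < u -> 0 <= x - u -> x + u <= h -> `|e (x + u) - 2 * e x + e (x - u)| <= M.
  move=> u0 x0 xh; have := sd x u u0 x0 xh; congr (`|_| <= _).
  by rewrite /e /chord; field; rewrite gt_eqF.
have ce : cont_on 0 h (fun t => `|e t|).
  have c1 : cont_on 0 h e.
    exact: cont_onB cg (@chord_cont g h).
  move=> x xh d d0; have [dd dd0 hd] := c1 x xh d d0; exists dd => // y yh yx.
  by apply: le_lt_trans (ler_dist_dist _ _) _; apply: hd.
have [c cab cmax] := EVT_max (ltW h0) ((cont_onP _ _ _).1 ce).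
have {}cmax t : 0 <= t <= h -> `|e t| <= `|e c| by move=> tt; apply: cmax; rewrite in_itv.
move: cab; rewrite in_itv /= => /andP[c0 ch].
suff ecM : `|e c| <= M by move=> t /cmax /le_trans; apply.
have M0 : 0 <= M.
  have := ee (h / 2) (h / 2) _ _ _; rewrite subrr -splitr lexx => h1.
  by apply: le_trans (normr_ge0 _) (h1 _ _ _); rewrite ?divr_gt0.
have [E|cn0] := eqVneq c 0; first by rewrite E e0 normr0.
have [E|cnh] := eqVneq c h; first by rewrite E eh normr0.
have c0' : 0 < c by rewrite lt_neqAle eq_sym cn0.
have ch' : c < h by rewrite lt_neqAle cnh.
have [u [u0 uc ucm ends]] : exists u, [/\ 0 < u, 0 <= c - u, c + u <= h & e (c - u) = 0 \/ e (c + u) = 0].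
  have [cc|cc] := leP c (h - c).
    exists c; split=> //; [by rewrite subrr|by lra|by left; rewrite subrr].
  exists (h - c); split; [by lra|by lra|by lra|by right; rewrite addrC subrK].
have := ee c u u0 uc ucm.
have m1 : `|e (c + u)| <= `|e c| by apply: cmax; apply/andP; split => //; lra.
have m2 : `|e (c - u)| <= `|e c| by apply: cmax; apply/andP; split => //; lra.
have tri (A B C : R) : `|2 * B| <= `|A - 2 * B + C| + `|A| + `|C|.
  have E : 2 * B = - (A - 2 * B + C) + A + C by ring.
  rewrite {1}E.
  by apply: le_trans (ler_normD _ _) _; rewrite lerD2r (le_trans (ler_normD _ _)) // normrN.
have := tri (e (c + u)) (e c) (e (c - u)).
rewrite normrM (_ : `|2| = 2 :> R); last by rewrite ger0_norm.
case: ends => ->; rewrite normr0; lra.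
Qed.

(** Here [W] stands for the second modulus of smoothness of [g]. *)
Section Dyadic.
Variables (g : R -> R) (h : R) (W : R -> R).
Hypothesis h0 : 0 < h.
Hypothesis cg : cont_on 0 h g.
Hypothesis W2 : forall s, 0 < s -> W (2 * s) <= 4 * W s.
Hypothesis Wmono : forall s t, 0 < s -> s <= t -> W s <= W t.
Hypothesis W0 : forall s, 0 < s -> 0 <= W s.
Hypothesis Wg : forall x u, 0 < u -> 0 <= x - u -> x + u <= h ->
  `|g (x + u) - 2 * g x + g (x - u)| <= W u.

Lemma growth2 s t : 0 < s -> s <= t -> W t <= 4 * (t / s) ^+ 2 * W s.
Proof.
move=> s0 st.
have [k] : exists k, t <= 2 ^+ k * s.
  exists (Num.truncn (t / s)).+1; rewrite -ler_pdivrMr //.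
  apply: le_trans (ltW (truncnS_gt _)) _.
  by rewrite -natrX ler_nat ltnW // ltn_expl.
elim: k t st => [|k IH] t st.
  rewrite expr0 mul1r => ts; have -> : t = s by lra.
  by rewrite divff ?gt_eqF // expr1n mulr1 ler_peMl ?W0 // ler1n.
rewrite exprS => tk; have [t2|t2] := leP t (2 * s).
  apply: le_trans (Wmono (lt_le_trans s0 st) t2) _; apply: le_trans (W2 s0) _.
  rewrite ler_wpM2r ?W0 // ler_pMr // expr2.
  have : 1 <= t / s by rewrite ler_pdivlMr // mul1r.
  by move=> ?; nra.
have st2 : s <= t / 2 by lra.
have := IH (t / 2) st2; rewrite ler_pdivrMr // (_ : 2 ^+ k * s * 2 = 2 * 2 ^+ k * s); last by ring.
move=> /(_ tk) h1; have := W2 (lt_le_trans s0 st2).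
rewrite (_ : 2 * (t / 2) = t); last by field.
move=> /le_trans; apply; apply: le_trans (ler_wpM2l _ h1) _ => //.
rewrite le_eqVlt; apply/orP; left; apply/eqP; field; rewrite gt_eqF //.
Qed.

(** The growth factor [(h / s) ^+ 2] of [W] is compensated by [t / h], because
    [t * h <= s ^+ 2]. *)
Lemma growth2_scaled t s : 0 < t -> t <= h -> 0 < s -> t * h <= s ^+ 2 -> t / h * W h <= 4 * W s.
Proof.
move=> t0 th s0 ths.
have th1 : t / h <= 1 by rewrite ler_pdivrMr // mul1r.
have th2 : 0 <= t / h by rewrite divr_ge0 // ltW.
have [sh|hs] := leP s h; last first.
  apply: (@le_trans _ _ (W h)); first by rewrite ler_piMl ?W0.
  apply: le_trans (Wmono h0 (ltW hs)) _; by rewrite ler_peMl ?W0 // ler1n.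
apply: le_trans (ler_wpM2l th2 (growth2 s0 sh)) _.
have -> : t / h * (4 * (h / s) ^+ 2 * W s) = (t * h / s ^+ 2) * (4 * W s).
  by field; rewrite !gt_eqF.
by rewrite ler_piMl ?mulr_ge0 ?W0 // ler_pdivrMr ?mul1r ?exprn_gt0.
Qed.

Let e t := g t - chord g h t.
Let e0 : e 0 = 0. Proof. by rewrite /e /chord mulr0 addr0 subrr. Qed.
Let eh : e h = 0. Proof. by rewrite /e /chord; field; rewrite gt_eqF. Qed.
Let ee x u : 0 < u -> 0 <= x - u -> x + u <= h -> `|e (x + u) - 2 * e x + e (x - u)| <= W u.
Proof.
move=> u0 x0 xh; have := Wg u0 x0 xh; congr (`|_| <= _).
by rewrite /e /chord; field; rewrite gt_eqF.
Qed.

(** Halving the argument: since [e 0 = 0], the second difference at [s] with step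
    [s] is [e (2 * s) - 2 * e s], so [`|e s|] is at most half of
    [W s + `|e (2 * s)|].  The bound for [e (2 * s)] involves
    [W (2 * s) <= 4 * W s], so the constants satisfy [c' = 2 * c + 1 / 2]. *)
Lemma chord_dyadic k s : 2 ^+ k * s = h -> `|e s| <= (2 ^+ k - 1) / 2 * W s.
Proof.
elim: k s => [|k IH] s; first by rewrite expr0 mul1r subrr !mul0r => ->; rewrite eh normr0.
rewrite exprS => E; have s0 : 0 < s.
  by have := h0; rewrite -E pmulr_rgt0 // mulr_gt0 // exprn_gt0.
have := IH (2 * s); rewrite mulrCA mulrA => /(_ E) h1.
have k1 : 1 <= 2 ^+ k :> R by rewrite exprn_ege1 // ler1n.
have := @ee s s s0; rewrite subrr lexx => /(_ isT); rewrite e0 addr0.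
have E2 : s + s = 2 * s by ring.
rewrite E2 => h2; have {}h2 : `|e (2 * s) - 2 * e s| <= W s.
  by apply: h2; rewrite -E ler_wpM2r ?(ltW s0) // ler_peMr.
have h3 := W2 s0; have Ws := W0 s0.
have : 2 * `|e s| <= `|e (2 * s) - 2 * e s| + `|e (2 * s)|.
  have -> : 2 * `|e s| = `|2 * e s| by rewrite normrM ger0_norm.
  rewrite [X in _ <= X]addrC; apply: le_trans (ler_normB _ _).
  by rewrite opprB addrC subrK.
have : (2 ^+ k - 1) / 2 * W (2 * s) <= (2 ^+ k - 1) / 2 * (4 * W s).
  by rewrite ler_wpM2l // divr_ge0 // subr_ge0.
have : 0 <= 2 ^+ k * W s by rewrite mulr_ge0 // (le_trans ler01).
lra.
Qed.

(** The chord interpolates at [0], so the deviation at [t] is governed by the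
    modulus at the geometric mean of [t] and [h] rather than at [h].  Choose [k]
    with [4 ^+ k] comparable to [h / t]; then [s' := h / 2 ^+ k] is comparable to
    that geometric mean.  On [[0, s']] the chord of [e] has slope at most
    [2 ^+ k * W s' / s'] by [chord_dyadic], which contributes at most
    [t * 4 ^+ k / h * W s' <= W s'], and [whitney] bounds the deviation from that
    chord by [W s']. *)
Lemma chord_pointwise2 t s : 0 < t -> t <= h -> 0 < s -> t * h <= s ^+ 2 ->
  `|g t - chord g h t| <= 8 * W s.
Proof.
move=> t0 th s0 ths.
have th1 : 1 <= h / t by rewrite ler_pdivlMr // mul1r.
have ex : exists k, h / t < 4 ^+ k.
  exists (Num.truncn (h / t)).+1; apply: lt_le_trans (truncnS_gt _) _.
  by rewrite -natrX ler_nat ltnW // ltn_expl.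
have [[|k] kP kmin] := ex_minnP ex; first by move: kP; rewrite expr0 ltNge th1.
have kle : 4 ^+ k <= h / t.
  by rewrite leNgt; apply/negP => /kmin; rewrite ltnn.
have k2 : 0 < 2 ^+ k :> R by rewrite exprn_gt0.
have k4 : 4 ^+ k = 2 ^+ k * 2 ^+ k :> R by rewrite -exprMn -natrM.
have k1 : 1 <= 2 ^+ k :> R by rewrite exprn_ege1 // ler1n.
pose s' := h / 2 ^+ k; have s'0 : 0 < s' by rewrite divr_gt0.
have s'E : 2 ^+ k * s' = h by rewrite /s'; field; rewrite gt_eqF.
have s'h : s' <= h by rewrite -[X in _ <= X]s'E ler_peMl // ltW.
have t4 : 4 ^+ k * t <= h by rewrite -ler_pdivlMr.
have ts' : t <= s'.
  rewrite /s' ler_pdivlMr // mulrC; apply: le_trans t4; rewrite k4 -mulrA ler_peMl //.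
  by rewrite mulr_ge0 // ltW.
have ss : s' <= 2 * s.
  rewrite -(@ler_pXn2r _ 2) // ?nnegrE; last 2 first.
  - exact: ltW.
  - by rewrite mulr_ge0 // ltW.
  have -> : s' ^+ 2 = h / 4 ^+ k * h by rewrite k4 /s'; field; rewrite gt_eqF.
  have : h / 4 ^+ k <= 4 * t.
    rewrite ler_pdivrMr ?exprn_gt0 // (_ : 4 * t * 4 ^+ k = 4 ^+ k.+1 * t); last by rewrite exprS; ring.
    by rewrite -ler_pdivrMr // ltW.
  move=> h1; have := ler_wpM2r (ltW h0) h1; rewrite exprMn; lra.
have sde := @chord_dyadic k s' s'E.
have wh : `|e t - chord e s' t| <= W s'.
  apply: whitney; rewrite ?(ltW t0) //.
    by apply: (@cont_on_sub _ 0 h) => //; exact: cont_onB cg (@chord_cont g h).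
  move=> x u u0 xu xus; apply: le_trans (ee u0 xu (le_trans xus s'h)) _.
  by apply: Wmono => //; lra.
have Ws' := W0 s'0.
have ce : `|chord e s' t| <= W s' / 2.
  rewrite /chord e0 subr0 add0r !normrM normfV (gtr0_norm t0) (gtr0_norm s'0).
  apply: (@le_trans _ _ ((2 ^+ k / 2 * W s') / s' * t)).
    rewrite !ler_wpM2r ?invr_ge0 ?(ltW t0) ?(ltW s'0) //; apply: le_trans sde _.
    by rewrite ler_wpM2r // ler_wpM2r ?invr_ge0 // gerBl.
  have -> : 2 ^+ k / 2 * W s' / s' * t = (4 ^+ k * t / h) * (W s' / 2).
    by rewrite k4 /s'; field; rewrite !gt_eqF.
  by rewrite ler_piMl ?divr_ge0 // ler_pdivrMr // mul1r.
have : `|e t| <= `|e t - chord e s' t| + `|chord e s' t|.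
  by rewrite -{1}(subrK (chord e s' t) (e t)) ler_normD.
have := Wmono s'0 ss; have := W2 s0; have := W0 s0; rewrite -/(e t); lra.
Qed.

End Dyadic.

(** Here [V] stands for the first modulus of smoothness of [g]. *)
Section Linear.
Variables (g : R -> R) (h : R) (V : R -> R).
Hypothesis h0 : 0 < h.
Hypothesis V2 : forall s, 0 < s -> V (2 * s) <= 2 * V s.
Hypothesis Vmono : forall s t, 0 < s -> s <= t -> V s <= V t.
Hypothesis V0 : forall s, 0 < s -> 0 <= V s.
Hypothesis Vg : forall x u, 0 < u -> 0 <= x -> x + u <= h -> `|g (x + u) - g x| <= V u.

Lemma growth1 s t : 0 < s -> s <= t -> V t <= 2 * (t / s) * V s.
Proof.
move=> s0 st.
have [k] : exists k, t <= 2 ^+ k * s.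
  exists (Num.truncn (t / s)).+1; rewrite -ler_pdivrMr //.
  apply: le_trans (ltW (truncnS_gt _)) _.
  by rewrite -natrX ler_nat ltnW // ltn_expl.
elim: k t st => [|k IH] t st.
  rewrite expr0 mul1r => ts; have -> : t = s by lra.
  by rewrite divff ?gt_eqF // mulr1 ler_peMl ?V0 // ler1n.
rewrite exprS => tk; have [t2|t2] := leP t (2 * s).
  apply: le_trans (Vmono (lt_le_trans s0 st) t2) _; apply: le_trans (V2 s0) _.
  by rewrite ler_wpM2r ?V0 // ler_pMr // ler_pdivlMr // mul1r.
have st2 : s <= t / 2 by lra.
have := IH (t / 2) st2; rewrite ler_pdivrMr // (_ : 2 ^+ k * s * 2 = 2 * 2 ^+ k * s); last by ring.
move=> /(_ tk) h1; have := V2 (lt_le_trans s0 st2).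
rewrite (_ : 2 * (t / 2) = t); last by field.
move=> /le_trans; apply; apply: le_trans (ler_wpM2l _ h1) _ => //.
rewrite le_eqVlt; apply/orP; left; apply/eqP; field; rewrite gt_eqF //.
Qed.

Lemma chord_pointwise1 t : 0 < t -> t <= h -> `|g t - chord g h t| <= 3 * V t.
Proof.
move=> t0 th.
have -> : g t - chord g h t = (g (0 + t) - g 0) - t / h * (g (0 + h) - g 0).
  by rewrite !add0r /chord; ring.
apply: le_trans (ler_normB _ _) _.
have h1 := Vg t0 (lexx 0) (_ : 0 + t <= h); rewrite add0r in h1 *.
have h2 := Vg h0 (lexx 0) (_ : 0 + h <= h); rewrite add0r lexx in h2 *.
have th2 : 0 <= t / h by rewrite divr_ge0 // ltW.
have h3 : t / h * V h <= 2 * V t.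
  apply: le_trans (ler_wpM2l th2 (growth1 t0 th)) _.
  rewrite le_eqVlt; apply/orP; left; apply/eqP; field; rewrite !gt_eqF //.
rewrite normrM (ger0_norm th2).
have := ler_wpM2l th2 (h2 isT); have := h1 th; lra.
Qed.

End Linear.
End LocalApproximation.

(** * The piece at an end point *)

(** Hypotheses on real numbers are discarded first, since [lia] would try to
    interpret them. *)
Ltac nlia := repeat match goal with
  | H : ?T |- _ => lazymatch T with
    | nat => fail
    | is_true (leq _ _) => fail
    | is_true (andb (leq _ _) (leq _ _)) => fail
    | is_true (negb (@eq_op _ _ _)) => fail
    | _ => clear H end end; lia.

Section Pieces.
Variable R : realType.
Implicit Types (a b c d e h s t x y u v M mu : R) (g : R -> R) (p q P : {poly R}) (H : nat -> R -> R).

(** The least admissible [M] is needed: the size of the perturbation of [hermite]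
    is tied to the actual deviation, while the final estimate is made with other
    upper bounds. *)
Lemma chord_max g h : 0 <= h -> cont_on 0 h g -> exists2 M : R, 0 <= M &
  (forall x, 0 <= x <= h -> `|g x - chord g h x| <= M) /\
  (forall M', (forall x, 0 <= x <= h -> `|g x - chord g h x| <= M') -> M <= M').
Proof.
move=> h0 cg.
have ce : cont_on 0 h (fun t => `|g t - chord g h t|).
  move=> x xh d d0; have [dd dd0 hd] := cont_onB cg (@chord_cont R g h) xh d0.
  by exists dd => // y yh yx; apply: le_lt_trans (ler_dist_dist _ _) _; apply: hd.
have [c cab cmax] := EVT_max h0 ((cont_onP _ _ _).1 ce).
rewrite in_itv /= in cab.
exists `|g c - chord g h c| => //; split=> [x xh|M']; last exact.
by apply: cmax; rewrite in_itv.
Qed.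

(** Subtracting [k *: 'X^(r.+1)] with [k = M / h] lowers the value and the slope at
    [h] by at least the error of [hermite], so both fall below those of [H].  The
    perturbation costs [t ^+ r * (t / h * M)]. *)
Lemma endpoint_bounds r H h M k p : (0 < r)%N -> 0 < h -> chain 0 h r H ->
  (forall x, 0 <= x <= h -> `|H r x - chord (H r) h x| <= M) ->
  p = hermite r H h - k *: 'X^(r.+1) ->
  (`|k| <= M / h -> forall t (B : R), 0 <= t <= h ->
    (forall x, 0 <= x <= t -> `|H r x - chord (H r) h x| <= B) ->
    `|H 0%N t - p.[t]| <= t ^+ r * (B + t / h * M)) /\
  (k = M / h -> p.[h] <= H 0%N h /\ p^`().[h] <= H 1%N h).
Proof.
move=> r0 h0 cH hM ->; split=> [hk t B t0h hB|->].
  have [t0 th] := andP t0h.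
  have := hermite_approx cH t0h hB (leq0n r); rewrite subn0 derivn0 => h1.
  rewrite hornerD hornerN hornerZ hornerXn opprD opprK addrA.
  apply: le_trans (ler_normD _ _) _; rewrite mulrDr [t ^+ r * B]mulrC; apply: lerD => //.
  rewrite normrM (ger0_norm (exprn_ge0 _ t0)) exprSr.
  have -> : t ^+ r * (t / h * M) = (M / h) * (t ^+ r * t) by ring.
  by rewrite ler_wpM2r // mulr_ge0 ?exprn_ge0.
have hh : 0 <= h <= h by rewrite lexx ltW.
have := hermite_approx cH hh hM (leq0n r); rewrite subn0 derivn0 => h1.
have h2 := hermite_approx cH hh hM r0; rewrite derivn1 in h2.
have M0 : 0 <= M by apply: le_trans (normr_ge0 _) (hM 0 _); rewrite lexx ltW.
split.
  rewrite hornerD hornerN hornerZ hornerXn exprSr.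
  have -> : M / h * (h ^+ r * h) = M * h ^+ r by field; rewrite gt_eqF.
  by move: h1; rewrite ler_norml; lra.
rewrite derivD derivN derivZ derivXn hornerD hornerN hornerZ hornerMn hornerXn /=.
have E : M / h * (h ^+ r *+ r.+1) = M * h ^+ (r - 1) *+ r.+1.
  rewrite mulrnAr; congr (_ *+ _); have -> : h ^+ r = h ^+ (r - 1) * h by rewrite -exprSr subn1 prednK.
  by field; rewrite gt_eqF.
rewrite E mulrS.
have : 0 <= M * h ^+ (r - 1) *+ r by rewrite mulrn_wge0 // mulr_ge0 // exprn_ge0 // ltW.
by move: h2; rewrite ler_norml; lra.
Qed.

(** The value and the slope at the inner end [h] do not exceed those of the
    function; this is what gluing with a convex neighbour requires.  In the
    estimate, [B] bounds the deviation of [H r] from its chord only up to [t]: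
    this locality is what makes the error small near the end point. *)
Definition endpoint_spec r H h p :=
  [/\ (size p <= r.+2)%N, forall t, 0 <= t <= h -> 0 <= p^`(2).[t],
      p.[h] <= H 0%N h, p^`().[h] <= H 1%N h &
      forall t (B : R) M, 0 <= t <= h ->
        (forall x, 0 <= x <= h -> `|H r x - chord (H r) h x| <= M) ->
        (forall x, 0 <= x <= t -> `|H r x - chord (H r) h x| <= B) ->
        `|H 0%N t - p.[t]| <= t ^+ r * (B + t / h * M)].

(** As all derivatives of order [2, .., r] vanish at [0], [p] is affine plus
    [(a - k) *: 'X^(r.+1)], which is convex for [k <= a].  If this forces
    [k = a < M / h], then [p] is the tangent at [0], which lies below the convex
    function with a smaller slope; comparing it with [hermite] at [h] shows that
    [a >= - (M / h)]. *)
Lemma endpoint_flat r H h : (0 < r)%N -> 0 < h -> chain 0 h r H ->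
  (forall x y, 0 <= x -> x <= y -> y <= h -> H 1%N x <= H 1%N y) ->
  (forall j, (2 <= j <= r)%N -> H j 0 = 0) -> exists p, endpoint_spec r H h p.
Proof.
move=> r0 h0 cH mono flat.
have [M M0 [hM Mmin]] := chord_max (ltW h0) (chain_cont cH (leqnn r)).
pose a : R := (H r h - H r 0) / h / r.+1`!%:R.
pose k := Num.min a (M / h).
pose p := taylor r H (a - k).
have pE : p = hermite r H h - k *: 'X^(r.+1).
  by rewrite /p (taylorB _ _ _ a) subKr.
have [bd1 bd2] := endpoint_bounds r0 h0 cH hM pE.
have ka : 0 <= a - k by rewrite subr_ge0 ge_min lexx.
suff [kM e1 e2] : [/\ `|k| <= M / h, p.[h] <= H 0%N h & p^`().[h] <= H 1%N h].
  exists p; split => //; first exact: size_taylor.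
    have cp : chain 0 h (r - 1) (fun i => horner p^`(2 + i)).
      by apply: (@chain_shift _ 0 h (r - 1) 2 (fun i => horner p^`(i))); exact: poly_chain.
    apply: (chain_nneg cp) => [i ir|t th].
      by rewrite taylor_deriv0 ?flat //; nlia.
    have -> : (2 + (r - 1) = r.+1)%N by nlia.
    by rewrite taylor_derivS mulr_ge0.
  move=> t B M' th hM' hB; apply: le_trans (bd1 kM t B th hB) _.
  case/andP: (th) => t0 _; rewrite ler_wpM2l ?exprn_ge0 // lerD2l ler_wpM2l ?divr_ge0 ?(ltW h0) //.
  exact: Mmin.
have hh : 0 <= h <= h by rewrite lexx ltW.
have h00 : (0 : R) <= 0 <= h by apply/andP; split; [exact: lexx|exact: ltW].
have [aM|Ma] := leP (M / h) a.
  have kE : k = M / h by rewrite /k; apply/min_idPr.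
  have [e1 e2] := bd2 kE.
  by split => //; rewrite kE ger0_norm // divr_ge0 // ltW.
have kE : k = a by rewrite /k; apply/min_idPl/ltW.
have pE2 : p = (H 0%N 0)%:P + (H 1%N 0) *: 'X.
  rewrite /p kE subrr; apply/polyP => i; rewrite coef_poly coefD coefC coefZ coefX.
  case: i => [|[|i]] /=; first by rewrite fact0 divr1 mulr0 addr0.
    by rewrite (ltn_eqF (_ : 1 < r.+1)%N) // (_ : 1`! = 1)%N // divr1 mulr1 add0r.
  rewrite mulr0 addr0; case: ifP => // ir; case: eqP => // /eqP ine.
  by rewrite flat ?mul0r //; nlia.
have ph : p.[h] <= H 0%N h.
  rewrite pE2 !hornerE.
  by have := mono_tangent (cH.1 0%N r0) mono h00 hh; rewrite subr0.
split=> //; last first.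
  rewrite pE2 derivD derivC derivZ derivX add0r hornerZ hornerC mulr1.
  by apply: mono; rewrite // ?lexx // ltW.
rewrite ler_norml kE (ltW Ma) andbT.
have := hermite_approx cH hh hM (leq0n r); rewrite subn0 derivn0 => h1.
have : p.[h] = (hermite r H h).[h] - a * (h ^+ r * h).
  by rewrite pE kE hornerD hornerN hornerZ hornerXn exprSr.
move=> Eph; have : - (M * h ^+ r) <= a * (h ^+ r * h) by move: h1; rewrite ler_norml; lra.
have hr : 0 < h ^+ r by rewrite exprn_gt0.
rewrite lerNl (_ : - (a * (h ^+ r * h)) = - a * h * h ^+ r); last by ring.
by rewrite ler_pM2r // -ler_pdivlMr // lerNl.
Qed.

(** The first nonzero derivative [H j 0] is positive, since [H 2] is nonnegative.
    It dominates: [p^`(j)] differs from [H j] by [O(M)], and [M] tends to [0] with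
    [h].  As all derivatives of order [2, .., j - 1] of [p] vanish at [0], positivity
    of [p^`(j)] is inherited by [p^`(2)].  The threshold [h0] depends on [H]. *)
Lemma endpoint_nonflat r H j : (2 <= j <= r)%N -> chain 0 1 r H ->
  (forall x y, 0 <= x -> x <= y -> y <= 1 -> H 1%N x <= H 1%N y) ->
  (forall i, (2 <= i < j)%N -> H i 0 = 0) -> H j 0 != 0 ->
  exists2 h0 : R, 0 < h0 <= 1 & forall h, 0 < h <= h0 -> exists p, endpoint_spec r H h p.
Proof.
move=> /andP[j2 jr] cH mono flat Hj0.
have r0 : (0 < r)%N by nlia.
have H2 x : 0 <= x <= 1 -> 0 <= H 2%N x.
  by apply: (der_ge0 ltr01 (cH.1 1%N _) mono); nlia.
have z01 : (0 : R) <= (0 : R) <= (1 : R) by rewrite lexx ler01.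
have cHj := chain_cont cH jr; have cHr := chain_cont cH (leqnn r).
(* a negative value would make [H 2] negative just to the right of [0] *)
have s0 : 0 < H j 0.
  rewrite lt_neqAle eq_sym Hj0 leNgt; apply/negP => neg.
  have [d d0 hd] := cHj 0 z01 (- H j 0) (ltac:(rewrite oppr_gt0; exact: neg)).
  pose b := Num.min 1 (d / 2).
  have b0 : 0 < b by rewrite lt_min ltr01 divr_gt0.
  have b1 : b <= 1 by rewrite ge_min lexx.
  have bd : b < d by apply: (@le_lt_trans _ _ (d / 2)); [rewrite ge_min lexx orbT|lra].
  have cK : chain 0 b (j - 2) (fun i x => -1 * H (2 + i)%N x).
    apply: chainN; apply: (@chain_shift _ 0 b (j - 2) 2 H).
    have [c1 c2] := chain_sub (lexx 0) b1 cH; split=> [i ij|]; first by apply: c1; nlia.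
    by rewrite subnKC //; apply: cont_on_sub cHj.
  have := chain_pos cK _ _ (t := b); rewrite b0 lexx => /(_ _ _ isT) c.
  have : 0 < -1 * H (2 + 0)%N b.
    apply: c => [i ij|t /andP[t0 tb]]; first by rewrite flat ?mulr0 //; nlia.
    have -> : (2 + (j - 2) = j)%N by nlia.
    have := hd t _ _; rewrite t0 (le_trans tb b1) subr0 ger0_norm // => /(_ isT (le_lt_trans tb bd)).
    by rewrite ltr_norml => /andP[_]; rewrite mulN1r oppr_gt0; lra.
  by rewrite mulN1r oppr_gt0 ltNge H2 // (ltW b0).
(* [F] is the factor produced by the [j]-th derivative of ['X^(r.+1)] *)
pose F : R := (r.+1 ^_ j)%:R; have F0 : 0 <= F by rewrite ler0n.
pose eta := H j 0 / (8 * (1 + F)).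
have F1 : 0 < 8 * (1 + F) by rewrite mulr_gt0 // ltr_wpDr.
have eta0 : 0 < eta by rewrite divr_gt0.
have [|d1 d10 hd1] := cHj 0 z01 (H j 0 / 2); first by rewrite divr_gt0.
have [d2 d20 hd2] := cHr 0 z01 eta eta0.
pose d := Num.min d1 d2; have d0 : 0 < d by rewrite lt_min d10.
exists (Num.min 1 (d / 2)); first by rewrite lt_min ltr01 divr_gt0 // ge_min lexx.
move=> h /andP[h0]; rewrite le_min => /andP[h1 hd].
have hd1' : h < d1 by apply: (@lt_le_trans _ _ d); [lra|rewrite ge_min lexx].
have hd2' : h < d2 by apply: (@lt_le_trans _ _ d); [lra|rewrite ge_min lexx orbT].
have cHh := chain_sub (lexx 0) h1 cH.
have [M M0 [hM Mmin]] := chord_max (ltW h0) (chain_cont cHh (leqnn r)).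
have osc x : 0 <= x <= h -> `|H r x - H r 0| <= eta.
  move=> /andP[x0 xh]; apply/ltW/hd2; first by rewrite x0 (le_trans xh).
  by rewrite subr0 ger0_norm // (le_lt_trans xh).
have Meta : M <= 2 * eta.
  apply: Mmin => x xh; case/andP: (xh) => x0 xh'.
  have -> : H r x - chord (H r) h x = (H r x - H r 0) - x / h * (H r h - H r 0).
    by rewrite /chord; ring.
  apply: le_trans (ler_normB _ _) _; rewrite normrM.
  have xh1 : `|x / h| <= 1 by rewrite ger0_norm ?divr_ge0 ?(ltW h0) // ler_pdivrMr // mul1r.
  have o1 := osc x xh; have o2 : `|H r h - H r 0| <= eta by apply: osc; rewrite lexx ltW.
  have := ler_pM (normr_ge0 _) (normr_ge0 _) xh1 o2; lra.
pose a : R := (H r h - H r 0) / h / r.+1`!%:R.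
pose k := M / h; pose p := taylor r H (a - k).
have k0 : 0 <= k by rewrite divr_ge0 // ltW.
have pE : p = hermite r H h - k *: 'X^(r.+1).
  by rewrite /p (taylorB _ _ _ a) subKr.
have [bd1 bd2] := endpoint_bounds r0 h0 cHh hM pE.
have [e1 e2] := bd2 erefl.
have kM : `|k| <= M / h by rewrite ger0_norm.
exists p; split => //; [exact: size_taylor| |].
  have cp : chain 0 h (j - 2) (fun i => horner p^`(2 + i)).
    by apply: (@chain_shift _ 0 h (j - 2) 2 (fun i => horner p^`(i))); exact: poly_chain.
  apply: (chain_nneg cp) => [i ir|t th].
    by rewrite taylor_deriv0 ?flat //; nlia.
  have -> : (2 + (j - 2) = j)%N by nlia.
  case/andP: (th) => t0 th'.
  have t1 : t <= 1 by rewrite (le_trans th').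
  have := hermite_approx cHh th (fun x xt => hM x (ltac:(case/andP: xt => ? xt; by rewrite (le_trans xt th') andbT))) jr.
  have tr1 : t ^+ (r - j) <= 1 by rewrite exprn_ile1.
  have tr0 : 0 <= t ^+ (r - j) by rewrite exprn_ge0.
  rewrite pE derivnB derivnZ derivnXn hornerD hornerN hornerZ hornerMn hornerXn => ap.
  have Hjt : H j 0 / 2 < H j t.
    have := hd1 t; rewrite t0 t1 subr0 ger0_norm // => /(_ isT (le_lt_trans th' hd1')).
    by rewrite ltr_norml; lra.
  have kt : k * (t ^+ (r.+1 - j) *+ r.+1 ^_ j) <= M * F.
    rewrite -[_ *+ _]mulr_natr -/F mulrA ler_wpM2r //.
    rewrite subSn // exprSr /k.
    have -> : M / h * (t ^+ (r - j) * t) = M * (t ^+ (r - j) * (t / h)) by ring.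
    rewrite ler_piMr // mulr_ile1 ?divr_ge0 ?(ltW h0) //.
    by rewrite ler_pdivrMr // mul1r.
  have Mt : M * t ^+ (r - j) <= M by rewrite ler_piMr.
  have : (1 + F) * M <= H j 0 / 4.
    have -> : H j 0 / 4 = (1 + F) * (2 * eta) by rewrite /eta; field; rewrite gt_eqF // ltr_wpDr.
    by rewrite ler_wpM2l // addr_ge0.
  by move: ap; rewrite ler_norml; lra.
move=> t B M' th hM' hB; apply: le_trans (bd1 kM t B th hB) _.
case/andP: (th) => t0 _; rewrite ler_wpM2l ?exprn_ge0 // lerD2l ler_wpM2l ?divr_ge0 ?(ltW h0) //.
exact: Mmin.
Qed.

Lemma endpoint_piece r H : (0 < r)%N -> chain 0 1 r H ->
  (forall x y, 0 <= x -> x <= y -> y <= 1 -> H 1%N x <= H 1%N y) ->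
  exists2 h0 : R, 0 < h0 <= 1 & forall h, 0 < h <= h0 -> exists p, endpoint_spec r H h p.
Proof.
move=> r0 cH mono.
have [ex|nex] := pselect (exists j, (2 <= j <= r)%N && (H j 0 != 0)).
  have [j /andP[jr Hj] jmin] := ex_minnP ex.
  apply: (@endpoint_nonflat r H j) => // i /andP[i2 ij].
  apply/eqP/negPn/negP => Hi; have := jmin i; rewrite Hi i2 andbT /=.
  by case/andP: jr => _ jr; rewrite (ltnW (leq_trans ij jr)) leqNgt ij => /(_ isT).
exists 1; first by rewrite ltr01 lexx.
move=> h /andP[h0 h1]; apply: endpoint_flat => //.
- exact: chain_sub cH.
- by move=> x y x0 xy yh; apply: mono => //; apply: le_trans h1.
- by move=> j jr; apply/eqP/negPn/negP => Hj; apply: nex; exists j; rewrite jr.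
Qed.

End Pieces.

(** * The pieces on inner intervals *)

Section MiddlePiece.
Variable R : realType.
Implicit Types (a b c d e h s t x y u v E M mu : R) (g : R -> R) (p q P : {poly R}) (H : nat -> R -> R).

(** The constant of [convex_poly_mass_left] and [convex_poly_mass_right] for
    polynomials of degree at most [r.+1]. *)
Definition mass_const r : R := r.+1%:R * 2 ^+ r.+1.

Lemma mass_const_ge1 r : 1 <= mass_const r.
Proof. by rewrite /mass_const -natrX -natrM ler1n muln_gt0 expn_gt0. Qed.

(** Moving [P] towards its chord by a proportion [th] keeps it convex and turns
    the slopes at both ends inwards: each end slope moves by [th] times its gap
    to the mean slope, and the two mass lemmas bound this gap below by a fixed
    fraction of the increase of the slope, itself comparable to [s1 - s0].  So
    [th ~ (E + mu) / (s1 - s0)] suffices to absorb errors of size [E] and to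
    gain the margin [mu], while the function moves only by [O(h (E + mu))]. *)
Lemma damped_convex_poly r P h E mu v s0 s1 : (size P <= r.+2)%N -> 0 < h ->
  (forall t, 0 <= t <= h -> 0 <= P^`(2).[t]) -> 0 <= E -> 0 <= mu ->
  `|v - P.[h]| <= 3 / 2 * (h * E) -> `|s0 - P^`().[0]| <= E ->
  `|s1 - P^`().[h]| <= 2 * E -> 16 * mass_const r * (E + mu) < s1 - s0 ->
  exists p, [/\ (size p <= r.+2)%N, forall t, 0 <= t <= h -> 0 <= p^`(2).[t],
    p.[0] = P.[0] /\ p.[h] = v,
    s0 + mu <= p^`().[0] /\ p^`().[h] <= s1 - mu &
    forall t, 0 <= t <= h ->
      `|p.[t] - P.[t]| <= 3 / 2 * (h * E) + 4 * mass_const r * (4 * E + mu) * h].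
Proof.
move=> sP h0 ddP0 E0 mu0 ev e0 e1; set G := mass_const r; set B := s1 - s0 => GB.
have G1 : 1 <= G by apply: mass_const_ge1.
have mL : h * (P^`().[h] - P^`().[0]) <= G * (P.[h] - P.[0] - h * P^`().[0]).
  exact: convex_poly_mass_left.
have mR : h * (P^`().[h] - P^`().[0]) <= G * (h * P^`().[h] - (P.[h] - P.[0])).
  exact: convex_poly_mass_right.
have tgP := poly_tangent ddP0.
have G0 : 0 < G by rewrite (lt_le_trans ltr01).
clearbody G.
have GE : E <= G * E by rewrite ler_peMl.
have Gm : mu <= G * mu by rewrite ler_peMl.
have B16 : 16 * E + 16 * mu < B by lra.
have Bp : 0 < B by lra.
have [D DE] : exists D, D = P^`().[h] - P^`().[0] by exists (P^`().[h] - P^`().[0]).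
rewrite -DE in mL mR.
have [D1 D2] : B / 2 <= D /\ D <= 2 * B.
  rewrite DE; move: e0 e1 B16; rewrite !ler_norml /B => /andP[? ?] /andP[? ?] ?.
  by split; lra.
have [th thB] : exists th : R, th * B = 2 * G * (4 * E + mu).
  by exists (2 * G * (4 * E + mu) / B); rewrite divfK // gt_eqF.
have th0 : 0 <= th.
  have E4 : 0 <= 4 * E + mu by rewrite addr_ge0 // mulr_ge0.
  by rewrite -(pmulr_lge0 _ Bp) thB -mulrA mulr_ge0 // mulr_ge0 // ltW.
have th1 : th <= 1 by rewrite -(ler_pM2r Bp) thB; lra.
have thD : h * (G * (4 * E + mu)) <= th * (h * D).
  rewrite [leRHS]mulrCA ler_wpM2l ?(ltW h0) //.
  by have := ler_wpM2l th0 D1; rewrite mulrA thB; lra.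
have gainL : h * (4 * E + mu) <= th * (P.[h] - P.[0] - h * P^`().[0]).
  rewrite -(ler_pM2l G0) mulrCA [leRHS]mulrCA.
  by apply: le_trans thD (ler_wpM2l th0 mL).
have gainR : h * (4 * E + mu) <= th * (h * P^`().[h] - (P.[h] - P.[0])).
  rewrite -(ler_pM2l G0) mulrCA [leRHS]mulrCA.
  by apply: le_trans thD (ler_wpM2l th0 mR).
(* the slope of the affine part restores the values at both ends *)
have [n nh] : exists n : R, n * h = (v - P.[0]) - (1 - th) * (P.[h] - P.[0]).
  by exists (((v - P.[0]) - (1 - th) * (P.[h] - P.[0])) / h); rewrite divfK // gt_eqF.
pose p := (1 - th) *: P + ((th * P.[0])%:P + n *: 'X).
have pE t : p.[t] = (1 - th) * P.[t] + (th * P.[0] + n * t) by rewrite /p !hornerE.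
have dp : p^`() = (1 - th) *: P^`() + n%:P.
  by rewrite derivD derivZ (derivD (th * P.[0])%:P) derivC (derivZ n) derivX add0r alg_polyC.
have dpE t : p^`().[t] = (1 - th) * P^`().[t] + n by rewrite dp !hornerE.
have ddp t : p^`(2).[t] = (1 - th) * P^`(2).[t].
  by rewrite derivnS derivn1 dp derivD derivC addr0 derivZ hornerZ derivnS derivn1.
exists p; split.
- apply: leq_trans (size_polyD _ _) _; rewrite geq_max (leq_trans (size_scale_leq _ _)) //.
  apply: leq_trans (size_polyD _ _) _; rewrite geq_max (leq_trans (size_polyC_leq1 _)) //.
  by apply: leq_trans (size_scale_leq _ _) _; rewrite size_polyX.
- by move=> t tt; rewrite ddp mulr_ge0 ?ddP0 // subr_ge0.
- by split; rewrite pE ?nh; ring.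
- have hE : 0 <= h * E by rewrite mulr_ge0 // ltW.
  split; rewrite -(ler_pM2l h0) dpE [h * (_ + n)]mulrDr [h * n]mulrC nh.
    have k1 : h * (s0 - P^`().[0]) <= h * E.
      by rewrite ler_wpM2l ?(ltW h0) //; apply: le_trans (ler_norm _) e0.
    by move: hE ev k1 gainL; clear -h0; rewrite ler_norml => ? /andP[? ?]; lra.
  have k1 : h * (P^`().[h] - s1) <= h * (2 * E).
    by rewrite ler_wpM2l ?(ltW h0) //; apply: le_trans (ler_norm _) _; rewrite distrC.
  by move: hE ev k1 gainR; clear -h0; rewrite ler_norml => ? /andP[? ?]; lra.
move=> t tt; case/andP: (tt) => t0 tle; rewrite pE.
have th2 : 0 <= t / h by rewrite divr_ge0 // ltW.
have t1h : t / h <= 1 by rewrite ler_pdivrMr // mul1r.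
have nt : n * t = t / h * (n * h) by field; rewrite gt_eqF.
rewrite nt nh.
have -> : (1 - th) * P.[t] + (th * P.[0] + t / h * (v - P.[0] - (1 - th) * (P.[h] - P.[0]))) - P.[t] =
  t / h * (v - P.[h]) + th * (t / h * (P.[h] - P.[0]) - (P.[t] - P.[0])) by ring.
apply: le_trans (ler_normD _ _) _; rewrite (normrM (t / h)) (normrM th) (ger0_norm th0) (ger0_norm th2).
apply: lerD; first by apply: le_trans ev; rewrite ler_piMl.
set X := t / h * _ - (_ - _).
have Xb : `|X| <= h * D.
  have D0 : 0 <= D by apply: le_trans D1; rewrite divr_ge0 // ltW.
  apply: (@le_trans _ _ (t * D)); last by rewrite ler_wpM2r.
  have h00 : (0 : R) <= 0 <= h by apply/andP; split; [exact: lexx|exact: ltW].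
  have hhh : 0 <= h <= h by rewrite lexx ltW.
  have u1 := tgP 0 t h00 tt; have u2 := tgP h 0 hhh h00; have u3 := tgP 0 h h00 hhh.
  have u4 := tgP t 0 tt h00.
  have u5 : P^`().[t] <= P^`().[h] by apply: (mono_of_tangent tgP).
  have v1 : t / h * (P.[h] - P.[0]) <= t / h * (h * P^`().[h]).
    by rewrite ler_wpM2l //; move: u2; clear -h0; lra.
  have v2 : t / h * (h * P^`().[0]) <= t / h * (P.[h] - P.[0]).
    by rewrite ler_wpM2l //; move: u3; clear -h0; lra.
  have w (z : R) : t / h * (h * z) = t * z by field; rewrite gt_eqF.
  rewrite !w in v1 v2.
  have v3 : t * P^`().[t] <= t * P^`().[h] by rewrite ler_wpM2l.
  rewrite /X DE ler_norml; move: u1 u4 v1 v2 v3; clear -h0 => u1 u4 v1 v2 v3.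
  by apply/andP; split; lra.
apply: le_trans (ler_wpM2l th0 Xb) _.
apply: le_trans (ler_wpM2l th0 (ler_wpM2l (ltW h0) D2)) _.
have -> : th * (h * (2 * B)) = 2 * (th * B) * h by ring.
by rewrite thB le_eqVlt; apply/orP; left; apply/eqP; ring.
Qed.

(** The polynomial interpolates the function at both ends, with slopes turned
    inwards, so that neighbouring pieces glue to a convex function.  If the slope
    of the function increases enough, one of the two ends has room for a concave
    kink of size [mu]. *)
Definition middle_spec r H h M mu p :=
  [/\ (size p <= r.+2)%N, forall t, 0 <= t <= h -> 0 <= p^`(2).[t],
     p.[0] = H 0%N 0 /\ p.[h] = H 0%N h,
     [/\ H 1%N 0 <= p^`().[0], p^`().[h] <= H 1%N h &
      2 * mu <= H 1%N h - H 1%N 0 -> H 1%N 0 + mu <= p^`().[0] \/ p^`().[h] <= H 1%N h - mu] &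
     forall t, 0 <= t <= h ->
       `|H 0%N t - p.[t]| <= (3 + 32 * mass_const r) * (h * (M * h ^+ (r - 1) + mu))].

(** When the slope increases little, the chord is already close to the function,
    and at one of the two ends its slope is off by at least half the increase. *)
Lemma middle_piece_chord r H h M mu : (0 < r)%N -> 0 < h -> chain 0 h r H ->
  (forall x y, 0 <= x -> x <= y -> y <= h -> H 1%N x <= H 1%N y) -> 0 <= mu -> 0 <= M ->
  H 1%N h - H 1%N 0 <= 16 * mass_const r * (M * h ^+ (r - 1) + mu) ->
  exists p, middle_spec r H h M mu p.
Proof.
move=> r0 h0 cH mono mu0 M0; set E := M * h ^+ (r - 1) => mE.
have E0 : 0 <= E by rewrite mulr_ge0 // exprn_ge0 // ltW.
have h00 : (0 : R) <= 0 <= h by apply/andP; split; [exact: lexx|exact: ltW].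
have hhh : 0 <= h <= h by rewrite lexx ltW.
have tgH := mono_tangent (cH.1 0%N r0) mono.
have [m mD] : exists m, m = (H 0%N h - H 0%N 0) / h by exists ((H 0%N h - H 0%N 0) / h).
have mh : m * h = H 0%N h - H 0%N 0 by rewrite mD; field; rewrite gt_eqF.
have m1 : H 1%N 0 <= m.
  by rewrite -(ler_pM2r h0) mh; have := tgH 0 h h00 hhh; lra.
have m2 : m <= H 1%N h.
  by rewrite -(ler_pM2r h0) mh; have := tgH h 0 hhh h00; lra.
exists ((H 0%N 0)%:P + m *: 'X).
have dp : ((H 0%N 0)%:P + m *: 'X)^`() = m%:P.
  by rewrite derivD derivC derivZ derivX add0r -mul_polyC mulr1.
split.
- apply: leq_trans (size_polyD _ _) _; rewrite geq_max (leq_trans (size_polyC_leq1 _)) //.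
  by apply: leq_trans (size_scale_leq _ _) _; rewrite size_polyX.
- by move=> t _; rewrite derivnS derivn1 dp derivC horner0.
- by split; rewrite !hornerE //; lra.
- rewrite dp !hornerC; split=> // hmu.
  by have [?|?] := leP (H 1%N 0 + mu) m; [left|right; lra].
move=> t /andP[t0 th]; rewrite hornerD hornerC hornerZ hornerX -/E.
have th' : 0 <= t <= h by rewrite t0.
have k1 := tgH 0 t h00 th'; have k2 := tgH t 0 th' h00.
have k3 := mono t h t0 th (lexx h).
have B0 : H 1%N 0 <= H 1%N h by apply: le_trans m1 m2.
have lim : t * (H 1%N h - H 1%N 0) <= h * (16 * mass_const r * (E + mu)).
  by apply: ler_pM; rewrite ?subr_ge0.
have k4 : t * H 1%N 0 <= t * m by rewrite ler_wpM2l.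
have k5 : t * m <= t * H 1%N h by rewrite ler_wpM2l.
have k6 : t * H 1%N t <= t * H 1%N h by rewrite ler_wpM2l.
have slack : 0 <= (3 + 16 * mass_const r) * (h * (E + mu)).
  have G0 : 0 <= mass_const r by apply: le_trans ler01 (mass_const_ge1 r).
  by apply: mulr_ge0; [lra|rewrite mulr_ge0 ?(ltW h0) // addr_ge0].
rewrite ler_norml; move: k1 k2 lim k4 k5 k6 slack; set G := mass_const r.
by clear -h0 => *; apply/andP; split; lra.
Qed.

(** On an interval away from the ends only values have to be matched at the
    knots.  If the slope increases much, take the Hermite-type polynomial, add a
    small square to make it convex, and damp it. *)
Lemma middle_piece r H h M mu : (0 < r)%N -> 0 < h -> chain 0 h r H ->
  (forall x y, 0 <= x -> x <= y -> y <= h -> H 1%N x <= H 1%N y) -> 0 <= mu ->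
  (forall x, 0 <= x <= h -> `|H r x - chord (H r) h x| <= M) ->
  exists p, middle_spec r H h M mu p.
Proof.
move=> r0 h0 cH mono mu0 hM.
have M0 : 0 <= M by apply: le_trans (normr_ge0 _) (hM 0 _); rewrite lexx ltW.
have [mE|] := leP (H 1%N h - H 1%N 0) (16 * mass_const r * (M * h ^+ (r - 1) + mu)).
  exact: middle_piece_chord.
rewrite /middle_spec; have G1 := mass_const_ge1 r.
have [E EE] : exists E, E = M * h ^+ (r - 1) by exists (M * h ^+ (r - 1)).
rewrite -EE => mE.
have E0 : 0 <= E by rewrite EE mulr_ge0 // exprn_ge0 // ltW.
have h00 : (0 : R) <= 0 <= h by apply/andP; split; [exact: lexx|exact: ltW].
have hhh : 0 <= h <= h by rewrite lexx ltW.
have B0 : H 1%N 0 <= H 1%N h by apply: mono; rewrite // ltW.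
pose Q := hermite r H h.
have hMt t : 0 <= t <= h -> forall x, 0 <= x <= t -> `|H r x - chord (H r) h x| <= M.
  by move=> /andP[_ th] x /andP[x0 xt]; apply: hM; rewrite x0 (le_trans xt).
have ap0 t : 0 <= t <= h -> `|H 0%N t - Q.[t]| <= h * E.
  move=> th; have := hermite_approx cH th (hMt t th) (leq0n r).
  rewrite subn0 derivn0 => /le_trans; apply; rewrite EE mulrCA -exprS subn1 prednK //.
  by case/andP: th => t0 th; rewrite ler_wpM2l // lerXn2r ?nnegrE // ltW.
have ap1 t : 0 <= t <= h -> `|H 1%N t - Q^`().[t]| <= E.
  move=> th; have := hermite_approx cH th (hMt t th) r0.
  rewrite derivn1 => /le_trans; apply; rewrite EE.
  by case/andP: th => t0 th; rewrite ler_wpM2l // lerXn2r ?nnegrE // ltW.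
have ap2 t : 0 <= t <= h -> - (E / h) <= Q^`(2).[t].
  move=> th; case/andP: (th) => t0 th'.
  have [r1|r2] := leqP r 1.
    have r1E : r = 1%N by apply/eqP; rewrite eqn_leq r1.
    rewrite /Q r1E taylor_derivS divfK ?pnatr_eq0 //.
    apply: (@le_trans _ _ 0); first by rewrite oppr_le0 divr_ge0 // ltW.
    by rewrite divr_ge0 ?(ltW h0) // subr_ge0.
  have H2 : 0 <= H 2%N t by apply: (der_ge0 h0 (cH.1 1%N r2) mono).
  have := hermite_approx cH th (hMt t th) r2.
  have -> : E / h = M * h ^+ (r - 2).
    rewrite EE -(subnSK r2) exprSr; field; exact: lt0r_neq0.
  have : M * t ^+ (r - 2) <= M * h ^+ (r - 2).
    by rewrite ler_wpM2l // lerXn2r ?nnegrE // ltW.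
  rewrite ler_norml -/Q => k /andP[_ k2]; move: H2 k k2; clear -h0; lra.
pose P := Q + (E / h / 2) *: 'X^2.
have PE t : P.[t] = Q.[t] + E / h / 2 * t ^+ 2 by rewrite /P !hornerE.
have dP : P^`() = Q^`() + (E / h) *: 'X.
  by rewrite derivD derivZ derivXn expr1 -scalerMnr scalerMnl -[(E / h / 2) *+ 2]mulr_natr divfK.
have dPE t : P^`().[t] = Q^`().[t] + E / h * t by rewrite dP !hornerE.
have ddPE t : P^`(2).[t] = Q^`(2).[t] + E / h.
  by rewrite derivnS derivn1 dP derivD derivZ derivX hornerD hornerZ hornerC mulr1.
have ddP0 t : 0 <= t <= h -> 0 <= P^`(2).[t].
  by move=> /ap2 k; rewrite ddPE -[E / h]opprK subr_ge0.
have sP : (size P <= r.+2)%N.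
  apply: leq_trans (size_polyD _ _) _; rewrite geq_max size_taylor /=.
  by apply: leq_trans (size_scale_leq _ _) _; rewrite size_polyXn !ltnS.
have P00 : P.[0] = H 0%N 0.
  rewrite PE expr0n mulr0 addr0.
  by have := @taylor_deriv0 R r H ((H r h - H r 0) / h / r.+1`!%:R) 0 (leq0n r); rewrite derivn0.
have Pt t : 0 <= t <= h -> `|H 0%N t - P.[t]| <= 3 / 2 * (h * E).
  move=> th; have := ap0 t th; rewrite PE opprD addrA => k.
  apply: le_trans (ler_normB _ _) _.
  have k2 : `|E / h / 2 * t ^+ 2| <= h * E / 2.
    case/andP: th => t0 th; have kE : 0 <= E / h / 2 by rewrite !divr_ge0 // ltW.
    rewrite (ger0_norm (mulr_ge0 kE (exprn_ge0 2 t0))).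
    have -> : h * E / 2 = E / h / 2 * h ^+ 2 by field; exact: lt0r_neq0.
    by rewrite ler_wpM2l // lerXn2r ?nnegrE // ltW.
  by apply: le_trans (lerD k k2) _; rewrite le_eqVlt; apply/orP; left; apply/eqP; field.
have e0 : `|H 1%N 0 - P^`().[0]| <= E by rewrite dPE mulr0 addr0; apply: ap1.
have e1 : `|H 1%N h - P^`().[h]| <= 2 * E.
  rewrite dPE divfK ?gt_eqF // opprD addrA; apply: le_trans (ler_normB _ _) _.
  by rewrite (ger0_norm E0) mulr_natl mulr2n lerD2r ap1.
have [p [sp cp [p0 ph] [sL sR] est]] :=
  damped_convex_poly sP h0 ddP0 E0 mu0 (Pt h hhh) e0 e1 mE.
exists p; split=> //.
- by rewrite p0 ph.
- split; [|by apply: le_trans sR _; rewrite gerBl|by left].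
  by apply: le_trans sL; rewrite lerDl.
move=> t tt; have -> : H 0%N t - p.[t] = (H 0%N t - P.[t]) - (p.[t] - P.[t]) by ring.
apply: le_trans (ler_normB _ _) _; apply: le_trans (lerD (Pt t tt) (est t tt)) _.
have Gp : 0 <= mass_const r by apply: le_trans ler01 G1.
have k1 : 0 <= mass_const r * (h * mu) by rewrite mulr_ge0 ?mulr_ge0 ?(ltW h0).
have k2 : 0 <= mass_const r * (h * E) by rewrite mulr_ge0 ?mulr_ge0 ?(ltW h0).
have k3 : 0 <= h * mu by rewrite mulr_ge0 // ltW.
move: k1 k2 k3; set G := mass_const r; clear -h0; lra.
Qed.

End MiddlePiece.

(** * Moduli of smoothness *)

Section Modulus.
Variable R : realType.
Implicit Types (t u x y s : R) (g : R -> R).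

Lemma findiff2E g u x : -1 <= x - u -> x + u <= 1 -> 0 < u ->
  findiff 2 g u x = g (x + u) - 2 * g x + g (x - u).
Proof.
move=> h1 h2 u0; rewrite /findiff divff // mul1r !in_itv /=.
have -> : (-1 <= x - u <= 1) && (-1 <= x + u <= 1) by apply/andP; split; apply/andP; split; lra.
rewrite !big_ord_recr big_ord0 /= !bin0 (_ : 'C(2, 1) = 2)%N // binn.
have -> : x + (1 - 0%:R) * u = x + u by ring.
have -> : x + (1 - 1%:R) * u = x by ring.
have -> : x + (1 - 2%:R) * u = x - u by ring.
by ring.
Qed.

Lemma findiff1E g u x : -1 <= x - u / 2 -> x + u / 2 <= 1 -> 0 < u ->
  findiff 1 g u x = g (x + u / 2) - g (x - u / 2).
Proof.
move=> h1 h2 u0; rewrite /findiff !in_itv /=.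
have E : 1%:R / 2 * u = u / 2 by field.
rewrite E; have -> : (-1 <= x - u / 2 <= 1) && (-1 <= x + u / 2 <= 1).
  by apply/andP; split; apply/andP; split; lra.
rewrite !big_ord_recr big_ord0 /= bin0 binn.
have -> : x + (1%:R / 2 - 0%:R) * u = x + u / 2 by field.
have -> : x + (1%:R / 2 - 1%:R) * u = x - u / 2 by field.
by ring.
Qed.

Lemma cont_bounded a b g : a <= b -> cont_on a b g ->
  exists2 B : R, 0 <= B & forall x, a <= x <= b -> `|g x| <= B.
Proof.
move=> ab cg.
have ce : cont_on a b (fun t => `|g t|).
  move=> x xh d d0; have [dd dd0 hd] := cg x xh d d0.
  by exists dd => // y yh yx; apply: le_lt_trans (ler_dist_dist _ _) _; apply: hd.
have [c _ cmax] := EVT_max ab ((cont_onP _ _ _).1 ce).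
by exists `|g c| => // x xab; apply: cmax; rewrite in_itv.
Qed.

Lemma findiff_bounded k g B u x : 0 < u -> (forall x, -1 <= x <= 1 -> `|g x| <= B) -> 0 <= B ->
  `|findiff k g u x| <= (2 ^ k)%:R * B.
Proof.
move=> u0 hB B0; rewrite /findiff; case: ifP => [|_]; last by rewrite normr0 mulr_ge0.
rewrite !in_itv /= => /andP[/andP[l1 _] /andP[_ r1]].
apply: le_trans (ler_norm_sum _ _ _) _.
have -> : (2 ^ k)%:R * B = \sum_(i < k.+1) 'C(k, i)%:R * B.
  rewrite -mulr_suml -natr_sum; congr (_%:R * _).
  by rewrite -[in LHS](addn1 1) expnDn; apply: eq_bigr => i _; rewrite !exp1n !muln1.
apply: ler_sum => i _; rewrite !normrM normrX normrN1 expr1n mul1r (ger0_norm (ler0n _ _)).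
rewrite ler_wpM2l ?ler0n //; apply: hB.
have ik : i%:R <= k%:R :> R by rewrite ler_nat -ltnS.
have i0 : 0 <= i%:R :> R by rewrite ler0n.
have z1 : 0 <= i%:R * u by rewrite mulr_ge0 // ltW.
have z2 : i%:R * u <= k%:R * u by rewrite ler_wpM2r // ltW.
by apply/andP; split; lra.
Qed.

Section ModulusTheory.
Variable g : R -> R.
Hypothesis cg : cont_on (-1) 1 g.

Let mset k t := [set z | exists u x : R,
  [/\ 0 < u <= t, x \in `[-1, 1] & z = `|findiff k g u x|]].

Lemma modulus_ub k t : has_ubound (mset k t).
Proof.
have [|B B0 hB] := cont_bounded _ cg; first by lra.
exists ((2 ^ k)%:R * B) => z [u [x [/andP[u0 _] _ ->]]].
exact: findiff_bounded.
Qed.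

Lemma modulus_ge k t u x : 0 < u -> u <= t -> -1 <= x <= 1 -> `|findiff k g u x| <= modulus k g t.
Proof.
move=> u0 ut x1; apply: (ub_le_sup (modulus_ub k t)).
by exists u, x; rewrite u0 ut in_itv.
Qed.

Lemma modulus_le k t B : 0 < t ->
  (forall u x, 0 < u -> u <= t -> -1 <= x <= 1 -> `|findiff k g u x| <= B) -> modulus k g t <= B.
Proof.
move=> t0 hB; apply: ge_sup.
  exists `|findiff k g t 0|; exists t, 0; rewrite t0 lexx in_itv /=; split=> //.
  by apply/andP; split; lra.
by move=> z [u [x [/andP[u0 ut]]]]; rewrite in_itv /= => x1 ->; apply: hB.
Qed.

Lemma modulus_mono k s t : 0 < s -> s <= t -> modulus k g s <= modulus k g t.
Proof.
by move=> s0 st; apply: modulus_le => // u x u0 us x1; apply: modulus_ge; rewrite // (le_trans us).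
Qed.

Lemma modulus_ge0 k t : 0 <= t -> 0 <= modulus k g t.
Proof.
rewrite le_eqVlt => /predU1P[<-|t0]; first by rewrite modulus0.
apply: le_trans (normr_ge0 _) (@modulus_ge k t t 0 t0 (lexx _) _).
by apply/andP; split; lra.
Qed.

(** A second difference with step [2 * v] is the combination [1, 2, 1] of second
    differences with step [v]. *)
Lemma modulus2_double t : 0 < t -> modulus 2 g (2 * t) <= 4 * modulus 2 g t.
Proof.
move=> t0; have m0 := modulus_ge0 2 (ltW t0); apply: modulus_le; first by rewrite mulr_gt0.
move=> u x u0 ut x1; have [|nin] := boolP ((x - u \in `[-1, 1]) && (x + u \in `[-1, 1])); last first.
  by rewrite /findiff divff // mul1r (negbTE nin) normr0 mulr_ge0.
rewrite !in_itv /= => /andP[/andP[l1 l2] /andP[r1 r2]].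
rewrite findiff2E //.
pose v := u / 2; have v0 : 0 < v by rewrite divr_gt0.
have uv : u = v + v by rewrite /v; field.
have vt : v <= t by rewrite /v; lra.
rewrite uv in l1 l2 r1 r2 *.
have e1 : `|findiff 2 g v (x + v)| <= modulus 2 g t by apply: modulus_ge => //; apply/andP; split; lra.
have e2 : `|findiff 2 g v x| <= modulus 2 g t by apply: modulus_ge => //; apply/andP; split; lra.
have e3 : `|findiff 2 g v (x - v)| <= modulus 2 g t by apply: modulus_ge => //; apply/andP; split; lra.
rewrite findiff2E // in e1; [|lra|lra].
rewrite findiff2E // in e2; [|lra|lra].
rewrite findiff2E // in e3; [|lra|lra].
rewrite addrK in e1; rewrite subrK in e3.
rewrite addrA in e1 *; rewrite opprD addrA.
move: e1 e2 e3; set a := g (x + v + v); set b := g (x + v); set c := g x; set d := g (x - v); set e := g (x - v - v).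
rewrite !ler_norml => /andP[? ?] /andP[? ?] /andP[? ?]; apply/andP; split; lra.
Qed.

Lemma modulus1_double t : 0 < t -> modulus 1 g (2 * t) <= 2 * modulus 1 g t.
Proof.
move=> t0; have m0 := modulus_ge0 1 (ltW t0); apply: modulus_le; first by rewrite mulr_gt0.
move=> u x u0 ut x1; have [|nin] := boolP ((x - 1%:R / 2 * u \in `[-1, 1]) && (x + 1%:R / 2 * u \in `[-1, 1])); last first.
  by rewrite /findiff (negbTE nin) normr0 mulr_ge0.
rewrite !in_itv /= => /andP[/andP[l1 l2] /andP[r1 r2]].
pose v := u / 4; have v0 : 0 < v by rewrite divr_gt0.
have uv : u = 4 * v by rewrite /v; field.
have vt : 2 * v <= t by rewrite /v; lra.
rewrite uv in l1 l2 r1 r2 *.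
have e1 : `|findiff 1 g (2 * v) (x + v)| <= modulus 1 g t.
  by apply: modulus_ge => //; [rewrite mulr_gt0|apply/andP; split; lra].
have e3 : `|findiff 1 g (2 * v) (x - v)| <= modulus 1 g t.
  by apply: modulus_ge => //; [rewrite mulr_gt0|apply/andP; split; lra].
have E2 : 2 * v / 2 = v by field.
have E4 : 4 * v / 2 = v + v by field.
rewrite findiff1E ?E2 in e1; [|lra|lra|lra].
rewrite findiff1E ?E2 in e3; [|lra|lra|lra].
rewrite findiff1E ?E4; [|lra|lra|lra].
rewrite addrK in e1; rewrite subrK in e3.
rewrite addrA in e1 *; rewrite opprD addrA.
move: e1 e3; set a := g (x + v + v); set c := g x; set e := g (x - v - v).
rewrite !ler_norml => /andP[? ?] /andP[? ?]; apply/andP; split; lra.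
Qed.

End ModulusTheory.
End Modulus.

(** * Gluing convex pieces *)

Section Glue.
Variable R : realType.
Implicit Types (x y s : R) (t : nat -> R) (pp : nat -> {poly R}).

Lemma cont_on_ext (a b : R) (f g : R -> R) : (forall x, a <= x <= b -> f x = g x) ->
  cont_on a b g -> cont_on a b f.
Proof.
move=> E cg x xab e e0; have [d d0 hd] := cg x xab e e0.
by exists d => // y yab yx; rewrite !E //; apply: hd.
Qed.

Lemma cont_on_union (a b c : R) (f : R -> R) : a <= b -> b <= c ->
  cont_on a b f -> cont_on b c f -> cont_on a c f.
Proof.
move=> ab bc /cont_onP c1 /cont_onP c2; apply/cont_onP.
have -> : `[a, c]%classic = (`[a, b] `|` `[b, c])%classic :> set R.
  apply/seteqP; split=> x /=; rewrite !in_itv /=.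
    move=> /andP[ax xc]; have [xb|/ltW bx] := leP x b; first by left; rewrite ax.
    by right; rewrite bx.
  by case=> /andP[h1 h2]; rewrite ?h1 ?h2 ?(le_trans ab) ?(le_trans h2) ?andbT.
by apply: withinU_continuous => //; exact: itv_closed.
Qed.

(** Supporting lines can be carried across a knot one piece at a time, and they
    give convexity at once. *)
Definition has_subgradients (a b : R) (S : R -> R) := forall x, a <= x <= b ->
  exists s : R, forall y, a <= y <= b -> S x + s * (y - x) <= S y.

Lemma convex_of_subgradients (a b : R) S : has_subgradients a b S ->
  convex_function (`[a, b]%classic : set R) S.
Proof.
move=> sg k x y; rewrite !inE /= !in_itv /= => /andP[ax xb] /andP[ay yb].
have k0 : 0 <= k%:num by [].
have k1 : k%:num <= 1 by [].
pose l : R := k%:num; have l0 : 0 <= l := k0; have l1 : l <= 1 := k1.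
pose z : R := l * x + (1 - l) * y.
have zab : a <= z <= b by rewrite /z; apply/andP; split; nra.
have [s hs] := sg z zab.
have h1 := hs x; have h2 := hs y; rewrite ax xb in h1; rewrite ay yb in h2.
have {}h1 := ler_wpM2l l0 (h1 isT).
have l0' : 0 <= 1 - l by rewrite subr_ge0.
have {}h2 := ler_wpM2l l0' (h2 isT).
have E : l * (s * (x - z)) + (1 - l) * (s * (y - z)) = 0 by rewrite /z; ring.
change (S z <= l * S x + (1 - l) * S y); lra.
Qed.

Lemma increasing_le t n : (forall i, (i <= n)%N -> t i < t i.+1) ->
  forall i j, (i <= j)%N -> (j <= n.+1)%N -> t i <= t j.
Proof.
move=> tm i; elim=> [|j IH]; first by rewrite leqn0 => /eqP->.
rewrite leq_eqVlt => /predU1P[->//|ij] jn.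
by apply: le_trans (IH ij (ltnW jn)) (ltW (tm j jn)).
Qed.

(** Induction on the number of pieces.  The last conclusion, that the tangent of the
    last piece at the right end supports the whole function, is what lets the next
    piece inherit supporting lines over the part already glued. *)
Lemma glue_pieces t pp n :
  (forall i, (i <= n)%N -> t i < t i.+1) ->
  (forall i, (i <= n)%N -> forall y, t i <= y <= t i.+1 -> 0 <= (pp i)^`(2).[y]) ->
  (forall i, (i < n)%N -> (pp i).[t i.+1] = (pp i.+1).[t i.+1]) ->
  (forall i, (i < n)%N -> (pp i)^`().[t i.+1] <= (pp i.+1)^`().[t i.+1]) ->
  exists S : R -> R, [/\ forall i, (i <= n)%N -> forall y, t i <= y <= t i.+1 -> S y = (pp i).[y],
    cont_on (t 0%N) (t n.+1) S, has_subgradients (t 0%N) (t n.+1) S &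
    forall y, t 0%N <= y <= t n.+1 -> (pp n).[t n.+1] + (pp n)^`().[t n.+1] * (y - t n.+1) <= S y].
Proof.
elim: n => [|n IH] tm cvx val slo.
  have h := tm 0%N isT.
  have tg := poly_tangent (cvx 0%N isT).
  exists (horner (pp 0%N)); split.
  - by move=> i; rewrite leqn0 => /eqP->.
  - exact: der_on_cont (@der_on_poly R _ _ _).
  - by move=> x xab; exists (pp 0%N)^`().[x] => y; apply: tg.
  - by move=> y; apply: tg; rewrite lexx ltW.
have [||||S [Sv Sc Sg Se]] := IH.
- by move=> i ni; apply: tm; rewrite leqW.
- by move=> i ni; apply: cvx; rewrite leqW.
- by move=> i ni; apply: val; rewrite leqW.
- by move=> i ni; apply: slo; rewrite leqW.
set b := t n.+1 in Sv Sc Sg Se *; set c := t n.+2; set a := t 0%N in Sv Sc Sg Se *.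
have bc : b < c by apply: tm.
have tb i : (i <= n)%N -> t i.+1 <= b by move=> ni; apply: (increasing_le tm).
have ab : a < b by apply: lt_le_trans (tm 0%N isT) (tb 0%N isT).
have bb : b <= b <= c by rewrite lexx ltW.
have [q qE] : exists q, q = pp n.+1 by exists (pp n.+1).
have tg := poly_tangent (cvx n.+1 (leqnn _)); rewrite -qE in tg.
have qmono := mono_of_tangent tg.
have Sb : S b = q.[b].
  by rewrite qE (Sv n (leqnn _)) ?val // lexx andbT ltW // tm.
have pq : (pp n)^`().[b] <= q^`().[b] by rewrite qE; apply: slo.
have pb : (pp n).[b] = S b by rewrite Sb qE val.
pose S' x := if x <= b then S x else q.[x].
have S'l y : y <= b -> S' y = S y by rewrite /S' => ->.
have S'r y : b <= y -> S' y = q.[y].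
  move=> by_; rewrite /S'; case: (leP y b) => // yb; have -> : y = b by apply/eqP; rewrite eq_le yb.
  exact: Sb.
exists S'; rewrite -?qE; split.
- move=> i; rewrite leq_eqVlt => /predU1P[->|]; first by move=> y /andP[by_ _]; rewrite S'r // qE.
  rewrite ltnS => ni y ty; rewrite S'l; first exact: Sv.
  by case/andP: ty => _ h; apply: le_trans h (tb i ni).
- apply: (@cont_on_union _ b); rewrite ?ltW //.
    by apply: cont_on_ext Sc => x /andP[_ xb]; rewrite S'l.
  apply: (@cont_on_ext _ _ _ (horner q)) => [x /andP[bx _]|]; first by rewrite S'r.
  exact: der_on_cont (@der_on_poly R _ _ _).
- move=> x /andP[ax xc]; have [bx|xb] := leP b x.
    have xbc : b <= x <= c by rewrite bx.
    exists q^`().[x] => y /andP[ay yc]; rewrite (S'r x) //; have [by_|yb] := leP b y.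
      by rewrite S'r // tg // by_.
    rewrite S'l ?(ltW yb) //; have := Se y; rewrite ay (ltW yb) => /(_ isT).
    have := tg x b xbc bb; rewrite pb Sb.
    have k1 : (pp n)^`().[b] <= q^`().[x] by apply: le_trans pq _; apply: qmono; rewrite // ltW.
    have : (pp n)^`().[b] * (b - y) <= q^`().[x] * (b - y) by rewrite ler_wpM2r // subr_ge0 ltW.
    lra.
  have xab : a <= x <= b by rewrite ax ltW.
  have [s hs] := Sg x xab; exists s => y /andP[ay yc]; rewrite S'l ?(ltW xb) //.
  have [yb|by_] := leP y b; first by rewrite S'l // hs // ay.
  rewrite S'r ?(ltW by_) //.
  have := tg b y bb; rewrite (ltW by_) yc -Sb => /(_ isT).
  have := hs b; rewrite ltW // lexx => /(_ isT).
  have := Se x xab; rewrite pb => h1 h2 h3.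
  have k : s * (b - x) <= (pp n)^`().[b] * (b - x) by lra.
  rewrite ler_pM2r ?subr_gt0 // in k.
  have : s * (y - b) <= q^`().[b] * (y - b) by rewrite ler_wpM2r ?subr_ge0 ?(ltW by_) // (le_trans k).
  lra.
- move=> y /andP[ay yc]; have [by_|yb] := leP b y.
    by rewrite S'r // tg ?by_ // lexx ltW.
  rewrite S'l ?(ltW yb) //; have := Se y; rewrite ay (ltW yb) => /(_ isT).
  have cc : b <= c <= c by rewrite lexx ltW.
  have := tg c b cc bb; rewrite pb Sb.
  have k1 : (pp n)^`().[b] <= q^`().[c] by apply: le_trans pq _; apply: qmono; rewrite // ltW.
  have : (pp n)^`().[b] * (b - y) <= q^`().[c] * (b - y) by rewrite ler_wpM2r // subr_ge0 ltW.
  lra.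
Qed.

Lemma pigeonhole_increment (G : nat -> R) n : (0 < n)%N ->
  exists2 i, (i < n)%N & (G n - G 0%N) / n%:R <= G i.+1 - G i.
Proof.
move=> n0; have nR : 0 < n%:R :> R by rewrite ltr0n.
have [[i [ni hi]]|nex] := pselect (exists i, (i < n)%N /\ (G n - G 0%N) / n%:R <= G i.+1 - G i).
  by exists i.
set d := _ / _ in nex *.
have key m : (m < n)%N -> G m.+1 - G 0%N < m.+1%:R * d.
  elim: m => [|m IHm] mn.
    by rewrite mul1r ltNge; apply/negP => h; apply: nex; exists 0%N.
  have h1 : G m.+2 - G m.+1 < d by rewrite ltNge; apply/negP => h; apply: nex; exists m.+1.
  have := IHm (ltnW mn); rewrite -[m.+2%:R]natr1 mulrDl mul1r; lra.
have := key n.-1; rewrite prednK // leqnn => /(_ isT).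
by rewrite /d mulrC divfK ?gt_eqF // ltxx.
Qed.

Lemma locate t n x : t 0%N <= x <= t n.+1 -> exists2 i, (i <= n)%N & t i <= x <= t i.+1.
Proof.
elim: n => [|n IH] /andP[x0 xn]; first by exists 0%N => //; rewrite x0.
have [h|h] := leP x (t n.+1).
  by have [|i ni ti] := IH; [rewrite x0|exists i => //; rewrite leqW].
by exists n.+1 => //; rewrite (ltW h).
Qed.

End Glue.

(** * Geometry of the Chebyshev knots *)

Section Chebyshev.
Variable R : realType.
Implicit Types (x y a b : R).
Notation knot := (@chebyshev_knot R).

Lemma sin_le x : 0 <= x -> sin x <= x.
Proof.
rewrite le_eqVlt => /predU1P[<-|x0]; first by rewrite sin0.
have [|c _ E] := @MVT R sin cos 0 x x0.
  exact/continuous_subspaceT/continuous_sin.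
by move: E; rewrite sin0 !subr0 => ->; rewrite ler_piMl ?cos_le1 // ltW.
Qed.

Lemma sin_lip a b : a <= b -> `|sin b - sin a| <= b - a.
Proof.
rewrite le_eqVlt => /predU1P[<-|ab]; first by rewrite !subrr normr0.
have [|c _ E] := @MVT R sin cos a b ab.
  exact/continuous_subspaceT/continuous_sin.
by rewrite E normrM (gtr0_norm (_ : 0 < b - a)) ?subr_gt0 // ler_piMl ?cos_max // subr_ge0 ltW.
Qed.

Lemma one_sub_cos x : 1 - cos x = 2 * sin (x / 2) ^+ 2.
Proof.
have := cos_mulr2n (x / 2); rewrite (_ : x / 2 *+ 2 = x); last by rewrite -[LHS]mulr_natr divfK.
by move=> ->; rewrite cos2sin2; ring.
Qed.

Lemma sin_ge x : 0 <= x -> x <= 1 / 8 -> 7 / 8 * x <= sin x.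
Proof.
rewrite le_eqVlt => /predU1P[<-|x0] x8; first by rewrite sin0 mulr0.
have [|c cx E] := @MVT R sin cos 0 x x0.
  exact/continuous_subspaceT/continuous_sin.
move: E; rewrite sin0 !subr0 => ->; rewrite ler_wpM2r ?(ltW x0) //.
move: cx; rewrite in_itv /= => /andP[c0 cx].
have := one_sub_cos c.
have s0 : sin (c / 2) <= c / 2 by apply: sin_le; rewrite divr_ge0 // ltW.
have s1 : 0 <= sin (c / 2).
  apply: sin_ge0_pi; have := pi_ge2 R; move=> ?; apply/andP; split; [by rewrite divr_ge0 // ltW|lra].
have : sin (c / 2) ^+ 2 <= (c / 2) ^+ 2 by rewrite lerXn2r // nnegrE // divr_ge0 // ltW.
have : (c / 2) ^+ 2 <= 1 / 16.
  by apply: (@le_trans _ _ ((1 / 4) ^+ 2)); [rewrite lerXn2r ?nnegrE ?divr_ge0 ?(ltW c0) //; lra|lra].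
lra.
Qed.

Lemma cos_diff a b : cos a - cos b = 2 * sin ((a + b) / 2) * sin ((b - a) / 2).
Proof.
have ea : a = (a + b) / 2 - (b - a) / 2 by field.
have eb : b = (a + b) / 2 + (b - a) / 2 by field.
have -> : cos a = cos ((a + b) / 2 - (b - a) / 2) by rewrite -ea.
have -> : cos b = cos ((a + b) / 2 + (b - a) / 2) by rewrite -eb.
by rewrite cosB cosD; ring.
Qed.

Variable n : nat.
Hypothesis n16 : (16 <= n)%N.
Let z : R := n%:R^-1.
Let d : R := pi * z.

Lemma knot_scale : 0 < z <= 1 / 16.
Proof.
have n0 : 0 < n%:R :> R by rewrite ltr0n; apply: leq_trans n16.
have n1 : 16 <= n%:R :> R by rewrite ler_nat.
by rewrite /z invr_gt0 n0 /= -[_^-1]mul1r ler_pdivrMr //; lra.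
Qed.

Lemma knot_angle_bounds : 2 * z <= d <= 4 * z.
Proof.
have /andP[z0 _] := knot_scale.
by rewrite /d !ler_pM2r // pi_ge2 /=; have := pihalf_lt2 R; lra.
Qed.

Lemma knot_angleE j : j%:R * pi / n%:R = j%:R * d :> R. Proof. by rewrite mulrA. Qed.

Lemma knot_angle_pi j : (j <= n)%N -> 0 <= j%:R * d <= pi.
Proof.
have /andP[z0 _] := knot_scale; have p0 := pi_gt0 R; move=> jn.
rewrite mulr_ge0 ?mulr_ge0 ?(ltW z0) ?(ltW p0) //= /d mulrCA ler_piMr ?(ltW p0) //.
by rewrite /z ler_pdivrMr ?mul1r ?ler_nat // -invr_gt0.
Qed.

Lemma knot0 : knot n 0 = -1.
Proof. by rewrite /chebyshev_knot !mul0r cos0. Qed.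

Lemma knotn : knot n n = 1.
Proof. by rewrite /chebyshev_knot mulrAC divff ?mul1r ?cospi ?opprK // pnatr_eq0 -lt0n (leq_trans _ n16). Qed.

Lemma knot_sym j : (j <= n)%N -> knot n (n - j) = - knot n j.
Proof.
move=> jn; rewrite /chebyshev_knot natrB //.
have -> : (n%:R - j%:R) * pi / n%:R = - (j%:R * pi / n%:R) + pi :> R.
  by field; rewrite pnatr_eq0 -lt0n (leq_trans _ n16).
by rewrite cosDpi cosN.
Qed.

Lemma knot_lt i j : (i < j <= n)%N -> knot n i < knot n j.
Proof.
move=> /andP[ij jn]; rewrite /chebyshev_knot ltrN2 !knot_angleE ltr_cos ?in_itv /= ?knot_angle_pi //.
  have /andP[z0 _] := knot_scale; have p0 := pi_gt0 R.
  by rewrite ltr_pM2r ?ltr_nat // mulr_gt0.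
exact: leq_trans (ltnW ij) jn.
Qed.

Lemma knot_le i j : (i <= j <= n)%N -> knot n i <= knot n j.
Proof.
by move=> /andP[]; rewrite leq_eqVlt => /predU1P[->//|ij jn]; apply/ltW/knot_lt; rewrite ij.
Qed.

Lemma knot1_bounds : n%:R ^- 2 <= 1 + knot n 1 <= 8 * n%:R ^- 2.
Proof.
have /andP[z0 z16] := knot_scale; have /andP[dz dz4] := knot_angle_bounds.
have E : 1 + knot n 1 = 2 * sin (d / 2) ^+ 2.
  by rewrite -one_sub_cos /chebyshev_knot knot_angleE mul1r.
have d2 : 0 <= d / 2 by lra.
have s1 := sin_ge d2 (_ : d / 2 <= 1 / 8); have s2 := sin_le d2.
have {}s1 : 7 / 8 * z <= sin (d / 2) by apply: le_trans (s1 _); lra.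
have {}s2 : sin (d / 2) <= 2 * z by lra.
rewrite E -exprVn -/z.
by apply/andP; split; nra.
Qed.

Lemma sin_half_step : 0 <= sin (d / 2) <= 2 * z.
Proof.
have /andP[z0 z16] := knot_scale; have /andP[dz dz4] := knot_angle_bounds.
have d2 : 0 <= d / 2 by lra.
apply/andP; split; last by have := sin_le d2; lra.
by apply: sin_ge0_pi; rewrite d2 /=; have := pi_ge2 R; lra.
Qed.

Lemma knot_diff j : (j < n)%N ->
  knot n j.+1 - knot n j = 2 * sin (j%:R * d + d / 2) * sin (d / 2).
Proof.
move=> jn; rewrite /chebyshev_knot opprK addrC !knot_angleE cos_diff.
have -> : (j.+1%:R * d - j%:R * d) / 2 = d / 2 by rewrite -natr1; field.
by have -> : (j%:R * d + j.+1%:R * d) / 2 = j%:R * d + d / 2 by rewrite -natr1; field.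
Qed.

Lemma sin_mid_ge0 j : (j < n)%N -> 0 <= sin (j%:R * d + d / 2).
Proof.
have /andP[z0 z16] := knot_scale; have /andP[dz dz4] := knot_angle_bounds.
move=> jn; have /andP[a1 a2] := knot_angle_pi (ltnW jn); have /andP[a3 a4] := knot_angle_pi jn.
by rewrite -natr1 mulrDl mul1r in a4; apply: sin_ge0_pi; apply/andP; split; lra.
Qed.

Lemma knot_gap j : (j < n)%N -> knot n j.+1 - knot n j <= 4 / n%:R.
Proof.
move=> jn; rewrite knot_diff // -/z.
have := sin_mid_ge0 jn; have := sin_le1 (j%:R * d + d / 2); have /andP[] := sin_half_step.
set p := sin _; set q := sin _ => *; nra.
Qed.

Lemma phi_ge x : knot n 1 <= x <= knot n n.-1 -> 1 / n%:R <= phi x.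
Proof.
have -> : knot n n.-1 = - knot n 1 by rewrite -subn1 knot_sym //; apply: leq_trans n16.
have /andP[z0 z16] := knot_scale.
have /andP[k1 k2] := knot1_bounds => /andP[x1 x2].
rewrite -exprVn -/z in k1 k2.
rewrite div1r -/z -[z]ger0_norm ?(ltW z0) // -sqrtr_sqr /phi ler_wsqrtr //.
nra.
Qed.

(** The length of the [j]-th interval is [2 * sin (d / 2)] times the sine of the
    middle angle.  At the knot on the side of [x] away from [0], [phi] is the sine of
    the angle and is at most [phi x]; the middle angle differs from this one by
    [d / 2], which is [O(1 / n)] and hence [O(phi x)]. *)
Lemma phi_gap j x : (0 < j)%N -> (j.+1 < n)%N -> knot n j <= x <= knot n j.+1 ->
  knot n j.+1 - knot n j <= 12 * (phi x / n%:R).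
Proof.
move=> j0 jn xj.
have /andP[z0 z16] := knot_scale; have /andP[dz dz4] := knot_angle_bounds.
have x1 : 1 / n%:R <= phi x.
  apply: phi_ge; case/andP: xj => xj1 xj2; apply/andP; split.
    by apply: le_trans xj1; apply: knot_le; rewrite j0 ltnW // ltnW.
  apply: le_trans xj2 _; apply: knot_le; rewrite leq_pred andbT -ltnS prednK //.
  exact: leq_trans n16.
rewrite div1r -/z in x1.
have jn' : (j < n)%N by apply: ltnW.
have /andP[a1 a2] := knot_angle_pi (ltnW jn'); have /andP[a3 a4] := knot_angle_pi jn'.
have sphi a : sin a ^+ 2 = 1 - (- cos a) ^+ 2 by rewrite sin2cos2 sqrrN.
have sa : 0 <= sin (j%:R * d) by apply: sin_ge0_pi; rewrite a1.
have sb : 0 <= sin (j.+1%:R * d) by apply: sin_ge0_pi; rewrite a3.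
have mind : sin (j%:R * d) <= phi x \/ sin (j.+1%:R * d) <= phi x.
  have ss (s : R) : 0 <= s -> s ^+ 2 <= 1 - x ^+ 2 -> s <= phi x.
    by move=> s0 sx; rewrite -[s]ger0_norm // -sqrtr_sqr ler_wsqrtr.
  case/andP: xj; rewrite /chebyshev_knot !knot_angleE => xj1 xj2.
  have [xn|xp] := leP x 0.
    left; apply: ss => //; rewrite sphi; nra.
  right; apply: ss => //; rewrite sphi; nra.
have E2 : j.+1%:R * d = j%:R * d + d by rewrite -natr1; ring.
have mid : sin (j%:R * d + d / 2) <= 3 * phi x.
  have l1 : `|sin (j%:R * d + d / 2) - sin (j%:R * d)| <= d / 2.
    by apply: le_trans (sin_lip _) _; lra.
  have l2 : `|sin (j.+1%:R * d) - sin (j%:R * d + d / 2)| <= d / 2.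
    by apply: le_trans (sin_lip _) _; rewrite E2; lra.
  by move: l1 l2; rewrite !ler_norml => /andP[? ?] /andP[? ?]; case: mind => ?; lra.
rewrite knot_diff //; have /andP[s0 s1] := sin_half_step.
have -> : 12 * (phi x / n%:R) = 2 * (3 * phi x) * (2 * z) by rewrite /z; ring.
by apply: ler_pM => //; rewrite ?mulr_ge0 ?ler_wpM2l ?sin_mid_ge0.
Qed.

End Chebyshev.

(** * Estimates in local coordinates and assembly of the pieces *)

Section Assembly.
Variable R : realType.
Implicit Types (a b c d e h s t x y u v M mu : R) (p q P : {poly R}) (H F : nat -> R -> R).

Lemma chain_of_Cr r (f : R -> R) : Cr_in `[-1, 1] r f ->
  chain (-1) 1 r (fun i => deriven_in `[-1, 1] i f).
Proof.
move=> [h1 h2]; split=> [i ir x x1 e e0|]; last exact/cont_onP.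
have xD : `[-1, 1]%classic x by rewrite /= in_itv.
have := h1 i ir x xD; set g := deriven_in _ i f => cv.
have {}cv : diff_quot g x y @[y --> within `[-1, 1] x^'] --> deriven_in `[-1, 1] i.+1 f x by exact: cv.
move/cvgrPdist_le: cv => /(_ e e0); rewrite near_withinE /= /dnbhs near_withinE.
move=> /nbhs_ballP[d d0 hd]; exists d => // y y1 yx.
have [->|ne] := eqVneq y x; first by rewrite !subrr mulr0 subr0 normr0 mulr0.
have := hd y; rewrite /ball /= distrC => /(_ yx ne).
rewrite in_itv => /(_ y1); rewrite /diff_quot => k.
have n0 : y - x != 0 by rewrite subr_eq0.
set L := derive_in _ _ x in k *.
have -> : g y - g x - L * (y - x) = - ((L - (g y - g x) / (y - x)) * (y - x)) by field.
by rewrite normrN normrM ler_wpM2r.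
Qed.

Lemma convex_ineq (f : R -> R) : convex_function (`[-1, 1]%classic : set R) f ->
  forall x y s, -1 <= x <= 1 -> -1 <= y <= 1 -> 0 <= s <= 1 ->
     f (x + s * (y - x)) <= f x + s * (f y - f x).
Proof.
move=> cf x y s x1 y1 s1.
have := cf (Itv01 (proj1 (andP s1)) (proj2 (andP s1))) y x.
rewrite !inE /= !in_itv /= => /(_ y1 x1).
have -> : f x + s * (f y - f x) = s * f y + (1 - s) * f x by ring.
have -> : x + s * (y - x) = s * y + (1 - s) * x by ring.
by [].
Qed.

Section LocalEstimates.
Variables (r : nat) (H : nat -> R -> R) (h : R) (W V : R -> R).
Hypothesis r0 : (0 < r)%N.
Hypothesis h0 : 0 < h.
Hypothesis cH : chain 0 h r H.
Hypothesis W2 : forall s, 0 < s -> W (2 * s) <= 4 * W s.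
Hypothesis Wmono : forall s t, 0 < s -> s <= t -> W s <= W t.
Hypothesis W0 : forall s, 0 < s -> 0 <= W s.
Hypothesis WH : forall x u, 0 < u -> 0 <= x - u -> x + u <= h ->
  `|H r (x + u) - 2 * H r x + H r (x - u)| <= W u.
Hypothesis V2 : forall s, 0 < s -> V (2 * s) <= 2 * V s.
Hypothesis Vmono : forall s t, 0 < s -> s <= t -> V s <= V t.
Hypothesis V0 : forall s, 0 < s -> 0 <= V s.
Hypothesis VH : forall x u, 0 < u -> 0 <= x -> x + u <= h -> `|H r (x + u) - H r x| <= V u.

Let cHr : cont_on 0 h (H r). Proof. by case: cH. Qed.

Lemma chord_whitney x : 0 <= x <= h -> `|H r x - chord (H r) h x| <= W h.
Proof.
apply: whitney => // y u u0 yu yuh; apply: le_trans (WH u0 yu yuh) _.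
by apply: Wmono => //; lra.
Qed.

Lemma chord_at0 : `|H r 0 - chord (H r) h 0| = 0.
Proof. by rewrite /chord mulr0 addr0 subrr normr0. Qed.

Lemma endpoint_estimate2 p t s : endpoint_spec r H h p -> 0 < t -> t <= h -> 0 < s ->
  t * h <= s ^+ 2 -> `|H 0%N t - p.[t]| <= 12 * (t ^+ r * W s).
Proof.
move=> [_ _ _ _ est] t0 th s0 ths; have t0h : 0 <= t <= h by rewrite ltW.
have B x : 0 <= x <= t -> `|H r x - chord (H r) h x| <= 8 * W s.
  case/andP; rewrite le_eqVlt => /predU1P[<- _|x0 xt].
    by rewrite chord_at0 mulr_ge0 ?W0.
  apply: (chord_pointwise2 h0 cHr W2 Wmono W0 WH) => //; first exact: le_trans th.
  by apply: le_trans ths; rewrite ler_wpM2r // ltW.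
apply: le_trans (est t _ _ t0h chord_whitney B) _.
rewrite mulrCA ler_wpM2l ?exprn_ge0 ?(ltW t0) //.
have := growth2_scaled h0 W2 Wmono W0 t0 th s0 ths; lra.
Qed.

Lemma endpoint_estimate1 p t : endpoint_spec r H h p -> 0 < t -> t <= h ->
  `|H 0%N t - p.[t]| <= 9 * (t ^+ r * V t).
Proof.
move=> [_ _ _ _ est] t0 th; have t0h : 0 <= t <= h by rewrite ltW.
have bd s : 0 < s -> s <= h -> forall x, 0 <= x <= s -> `|H r x - chord (H r) h x| <= 3 * V s.
  move=> s0 sh x /andP[]; rewrite le_eqVlt => /predU1P[<- _|x0 xs].
    by rewrite chord_at0 mulr_ge0 ?V0.
  apply: le_trans (chord_pointwise1 h0 V2 Vmono V0 VH x0 (le_trans xs sh)) _.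
  by rewrite ler_wpM2l // Vmono.
apply: le_trans (est t _ _ t0h (bd h h0 (lexx h)) (bd t t0 th)) _.
rewrite [leRHS]mulrCA ler_wpM2l ?exprn_ge0 ?(ltW t0) //.
have th2 : 0 <= t / h by rewrite divr_ge0 // ltW.
have := ler_wpM2l th2 (growth1 V2 Vmono V0 t0 th).
have -> : t / h * (2 * (h / t) * V t) = 2 * V t by field; rewrite !gt_eqF.
lra.
Qed.

Lemma endpoint_estimate_inner p : endpoint_spec r H h p -> `|H 0%N h - p.[h]| <= 2 * (h ^+ r * W h).
Proof.
move=> [_ _ _ _ est]; have t0h : 0 <= h <= h by rewrite ltW /=.
apply: le_trans (est h _ _ t0h chord_whitney chord_whitney) _.
by rewrite divff ?gt_eqF // mul1r; lra.
Qed.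

Lemma endpoint_estimate0 p : endpoint_spec r H h p -> p.[0] = H 0%N 0.
Proof.
move=> [_ _ _ _ est]; have t0h : (0 : R) <= 0 <= h by apply/andP; split; [exact: lexx|exact: ltW].
have := est 0 (W h) (W h) t0h chord_whitney.
rewrite expr0n (gtn_eqF r0) mul0r normr_le0 => k.
apply/esym/eqP; rewrite -subr_eq0; apply: k => x /andP[x0 x0'].
by apply: chord_whitney; rewrite x0 (le_trans x0') // ltW.
Qed.

End LocalEstimates.

(** The affine change of variable has slope [1] or [-1], so it maps differences to
    differences with the same step, up to the sign [s ^+ r]. *)
Lemma local_differences (g : R -> R) r x0 s h : cont_on (-1) 1 g -> s = 1 \/ s = -1 ->
  (forall t, 0 <= t <= h -> -1 <= x0 + s * t <= 1) ->
  (forall x u, 0 < u -> 0 <= x - u -> x + u <= h ->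
    `|s ^+ r * g (x0 + s * (x + u)) - 2 * (s ^+ r * g (x0 + s * x)) + s ^+ r * g (x0 + s * (x - u))|
      <= modulus 2 g u) /\
  (forall x u, 0 < u -> 0 <= x -> x + u <= h ->
    `|s ^+ r * g (x0 + s * (x + u)) - s ^+ r * g (x0 + s * x)| <= modulus 1 g u).
Proof.
move=> cg sE sub.
have sr : `|s ^+ r| = 1 by rewrite normrX; case: sE => ->; rewrite ?normrN1 ?normr1 expr1n.
split=> x u u0 xu xuh.
  have x1 : -1 <= x0 + s * x <= 1 by apply: sub; apply/andP; split; lra.
  have y1 : -1 <= x0 + s * (x + u) <= 1 by apply: sub; apply/andP; split; lra.
  have z1 : -1 <= x0 + s * (x - u) <= 1 by apply: sub; apply/andP; split; lra.
  have := @modulus_ge R g cg 2 u u (x0 + s * x) u0 (lexx u) x1.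
  case/andP: x1 => ? ?; case/andP: y1 => ? ?; case/andP: z1 => ? ?.
  rewrite findiff2E //; last 2 first.
  - by case: sE => ?; subst s; lra.
  - by case: sE => ?; subst s; lra.
  have -> : s ^+ r * g (x0 + s * (x + u)) - 2 * (s ^+ r * g (x0 + s * x)) + s ^+ r * g (x0 + s * (x - u)) =
    s ^+ r * (g (x0 + s * (x + u)) - 2 * g (x0 + s * x) + g (x0 + s * (x - u))) by ring.
  rewrite normrM sr mul1r; congr (`|_| <= _); case: sE => ->.
    by congr (g _ - _ + g _); ring.
  by rewrite addrAC [RHS]addrAC; congr (_ - _); rewrite addrC; congr (g _ + g _); ring.
have x1 : -1 <= x0 + s * (x + u / 2) <= 1 by apply: sub; apply/andP; split; lra.
have y1 : -1 <= x0 + s * (x + u) <= 1 by apply: sub; apply/andP; split; lra.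
have z1 : -1 <= x0 + s * x <= 1 by apply: sub; apply/andP; split; lra.
have := @modulus_ge R g cg 1 u u (x0 + s * (x + u / 2)) u0 (lexx u) x1.
case/andP: x1 => ? ?; case/andP: y1 => ? ?; case/andP: z1 => ? ?.
rewrite findiff1E //; last 2 first.
- by case: sE => ?; subst s; lra.
- by case: sE => ?; subst s; lra.
rewrite -mulrBr normrM sr mul1r; case: sE => ->.
  by congr (`|_| <= _); congr (g _ - g _); field.
by rewrite distrC; congr (`|_| <= _); congr (g _ - g _); field.
Qed.

Lemma affine_comp p s c : s != 0 -> let q := p \Po (s *: 'X + c%:P) in
  [/\ forall x, q.[x] = p.[s * x + c], forall x, q^`().[x] = s * p^`().[s * x + c],
      forall x, q^`(2).[x] = s ^+ 2 * p^`(2).[s * x + c] & (size q <= size p)%N].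
Proof.
move=> s0 q; pose l := s *: 'X + c%:P.
have dl : l^`() = s%:P by rewrite derivD derivC derivZ derivX addr0 alg_polyC.
have lE x : l.[x] = s * x + c by rewrite /l !hornerE.
have dq : q^`() = (p^`() \Po l) * s%:P by rewrite deriv_comp dl.
have ddq : q^`(2) = (p^`(2) \Po l) * s%:P * s%:P.
  by rewrite !derivnS !derivn0 dq derivM derivC mulr0 addr0 deriv_comp dl.
split=> [x|x|x|].
- by rewrite horner_comp lE.
- by rewrite dq hornerM hornerC horner_comp lE mulrC.
- by rewrite ddq !hornerM hornerC horner_comp lE; ring.
by rewrite /q size_comp_poly2 // size_addl ?size_scale ?size_polyX // ltnS size_polyC_leq1.
Qed.

(** The end pieces lie below the function at their inner ends.  The inner pieces are
    lowered accordingly by a function which is linear on both sides of the knot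
    [t kk], where it vanishes with a concave kink of size [kL + kR].  Elsewhere it
    changes slopes equally on both sides of a knot, or in the favourable direction
    next to the end pieces, so only the kink has to be absorbed. *)
Section Assemble.
Variables (m kk : nat) (t : nat -> R) (F0 F1 : R -> R) (PL PR : {poly R}) (PM : nat -> {poly R}).
Variables (kL kR : R).
Hypothesis kk2 : (1 < kk < m)%N.
Let w := t kk.

Definition assembled (j : nat) : {poly R} :=
  if j == 0%N then PL else if j == m then PR else
  if (j < kk)%N then PM j + kL *: ('X - (t kk)%:P) else PM j - kR *: ('X - (t kk)%:P).

Lemma assemble :
  (forall i, (i <= m)%N -> t i < t i.+1) ->
  0 <= kL -> 0 <= kR ->
  [/\ forall x, t 0%N <= x <= t 1%N -> 0 <= PL^`(2).[x],
      PL.[t 1%N] = F0 (t 1%N) + kL * (t 1%N - w) & PL^`().[t 1%N] <= F1 (t 1%N)] ->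
  [/\ forall x, t m <= x <= t m.+1 -> 0 <= PR^`(2).[x],
      PR.[t m] = F0 (t m) - kR * (t m - w) & F1 (t m) <= PR^`().[t m]] ->
  (forall j, (0 < j < m)%N -> [/\ forall x, t j <= x <= t j.+1 -> 0 <= (PM j)^`(2).[x],
     (PM j).[t j] = F0 (t j), (PM j).[t j.+1] = F0 (t j.+1),
     F1 (t j) <= (PM j)^`().[t j] & (PM j)^`().[t j.+1] <= F1 (t j.+1)]) ->
  (PM kk.-1)^`().[w] + kL + kR <= (PM kk)^`().[w] ->
  exists S : R -> R, [/\ forall i, (i <= m)%N -> forall y, t i <= y <= t i.+1 -> S y = (assembled i).[y],
    cont_on (t 0%N) (t m.+1) S & has_subgradients (t 0%N) (t m.+1) S].
Proof.
move=> tm kL0 kR0 [cL vL sL] [cR vR sR] hM hK.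
have [k1 km] := andP kk2.
have m0 : (m == 0%N) = false by apply: gtn_eqF; apply: leq_trans km.
have dX (k : R) : (k *: ('X - (t kk)%:P))^`() = k%:P.
  by rewrite derivZ derivB derivX derivC subr0 alg_polyC.
have ddX (k : R) : (k *: ('X - (t kk)%:P))^`(2) = 0 by rewrite derivnS derivn1 dX derivC.
have hX (k : R) y : (k *: ('X - (t kk)%:P)).[y] = k * (y - t kk) by rewrite !hornerE.
have a0 : assembled 0 = PL by [].
have am : assembled m = PR by rewrite /assembled m0 eqxx.
have al j : (0 < j < kk)%N -> assembled j = PM j + kL *: ('X - (t kk)%:P).
  by case/andP=> j0 jk; rewrite /assembled (gtn_eqF j0) (ltn_eqF (ltn_trans jk km)) jk.
have ar j : (kk <= j < m)%N -> assembled j = PM j - kR *: ('X - (t kk)%:P).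
  case/andP=> kj jm; rewrite /assembled (gtn_eqF (leq_trans (ltnW k1) kj)) (ltn_eqF jm).
  by rewrite ltnNge kj.
suff [S [h1 h2 h3 _]] : exists S : R -> R, [/\ forall i, (i <= m)%N -> forall y, t i <= y <= t i.+1 -> S y = (assembled i).[y],
    cont_on (t 0%N) (t m.+1) S, has_subgradients (t 0%N) (t m.+1) S &
    forall y, t 0%N <= y <= t m.+1 -> (assembled m).[t m.+1] + (assembled m)^`().[t m.+1] * (y - t m.+1) <= S y].
  by exists S.
apply: glue_pieces => //.
- move=> i im y yi; case: (posnP i) => [i0|ip].
    by subst i; rewrite a0; apply: cL.
  move: im; rewrite leq_eqVlt => /predU1P[ie|im].
    by subst i; rewrite am; apply: cR.
  have [cv _ _ _ _] := hM i (introT andP (conj ip im)).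
  have [ik|ki] := ltnP i kk.
    by rewrite al ?ip // derivnD ddX addr0 cv.
  by rewrite ar ?ki // derivnB ddX subr0 cv.
- move=> i im; case: (posnP i) => [i0|ip].
    subst i; rewrite a0 al ?k1 // hornerD hX vL.
    by have [_ -> _ _ _] := hM 1%N (ltn_trans k1 km).
  have [_ _ v1 _ _] := hM i (introT andP (conj ip im)).
  have [iem|nim] := eqVneq i.+1 m.
    rewrite iem am ar ?im; last by rewrite -ltnS iem km.
    by rewrite -iem hornerD hornerN hX v1 iem vR.
  have i1m : (i.+1 < m)%N by rewrite ltn_neqAle nim.
  have [_ v2 _ _ _] := hM i.+1 i1m.
  have [ik|ki] := ltnP i kk; last first.
    by rewrite !ar ?ki ?(leqW ki) // !hornerD !hornerN !hX v1 v2.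
  have [i1k|ki1] := ltnP i.+1 kk; first by rewrite !al ?ip // !hornerD !hX v1 v2.
  have ek : i.+1 = kk by apply/eqP; rewrite eqn_leq ik ki1.
  rewrite al ?ip // ar ?ki1 // !hornerD hornerN !hX v1 v2 ek subrr !mulr0 subr0 addr0 //.
- move=> i im; case: (posnP i) => [i0|ip].
    subst i; rewrite a0 al ?k1 // derivD dX hornerD hornerC.
    have [_ _ _ s1 _] := hM 1%N (ltn_trans k1 km); lra.
  have [_ _ _ _ s1] := hM i (introT andP (conj ip im)).
  have [iem|nim] := eqVneq i.+1 m.
    rewrite iem am ar ?im; last by rewrite -ltnS iem km.
    rewrite -iem derivB dX hornerD hornerN hornerC; rewrite -iem in sR; lra.
  have i1m : (i.+1 < m)%N by rewrite ltn_neqAle nim.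
  have [_ _ _ s2 _] := hM i.+1 i1m.
  have [ik|ki] := ltnP i kk; last first.
    rewrite !ar ?ki ?(leqW ki) // !derivB dX !hornerD !hornerN !hornerC; lra.
  have [i1k|ki1] := ltnP i.+1 kk.
    by rewrite !al ?ip // !derivD dX !hornerD hornerC; lra.
  have ek : i.+1 = kk by apply/eqP; rewrite eqn_leq ik ki1.
  move: hK; rewrite /w -ek /= => hK.
  rewrite al ?ip // ar ?ki1 // derivD derivB !dX !hornerD hornerN !hornerC; lra.
Qed.

End Assemble.
End Assembly.

(** * The pieces on subintervals of [-1, 1] *)

Section GlobalPieces.
Variable R : realType.
Variables (r : nat) (F : nat -> R -> R).
Hypothesis r0 : (0 < r)%N.
Hypothesis cF : chain (-1) 1 r F.
Hypothesis mono : forall x y, -1 <= x -> x <= y -> y <= 1 -> F 1%N x <= F 1%N y.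
Implicit Types (s x y h t mu : R).

Local Notation W := (modulus 2 (F r)).
Local Notation V := (modulus 1 (F r)).

Let cg : cont_on (-1) 1 (F r). Proof. by case: cF. Qed.

Lemma middle_piece_global a h mu : 0 < h -> -1 <= a -> a + h <= 1 -> 0 <= mu ->
  exists P : {poly R}, [/\ (size P <= r.+2)%N,
    forall x, a <= x <= a + h -> 0 <= P^`(2).[x],
    P.[a] = F 0%N a /\ P.[a + h] = F 0%N (a + h),
    [/\ F 1%N a <= P^`().[a], P^`().[a + h] <= F 1%N (a + h) &
      2 * mu <= F 1%N (a + h) - F 1%N a ->
        F 1%N a + mu <= P^`().[a] \/ P^`().[a + h] <= F 1%N (a + h) - mu] &
    forall x, a <= x <= a + h ->
      `|F 0%N x - P.[x]| <= (3 + 32 * mass_const R r) * (h * (W h * h ^+ (r - 1) + mu))].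
Proof.
move=> h0 a1 ah1 mu0.
pose H i t := 1 ^+ i * F i (a + 1 * t).
have sub t : 0 <= t <= h -> -1 <= a + 1 * t <= 1.
  by move=> /andP[? ?]; apply/andP; split; lra.
have cH : chain 0 h r H by apply: (chain_affine sub cF).
have HE i t : H i t = F i (a + t) by rewrite /H expr1n !mul1r.
have [d2 _] := @local_differences R (F r) r a 1 h cg (or_introl erefl) sub.
have hM : forall x, 0 <= x <= h -> `|H r x - chord (H r) h x| <= W h.
  by apply: (chord_whitney h0 cH (modulus_mono cg 2) d2).
have monoH x y : 0 <= x -> x <= y -> y <= h -> H 1%N x <= H 1%N y.
  by move=> x0 xy yh; rewrite !HE; apply: mono; lra.
have [p [sp cp [p0 ph] [s0 s1 sm] est]] := middle_piece r0 h0 cH monoH mu0 hM.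
rewrite !HE addr0 in p0 ph s0 s1 sm.
have [vE dE ddE sz] := @affine_comp R p 1 (- a) (oner_neq0 _).
set P := p \Po _ in vE dE ddE sz.
have ahE : 1 * (a + h) - a = h by ring.
have aE : 1 * a - a = 0 by ring.
exists P; split.
- exact: leq_trans sz sp.
- move=> x /andP[x0 x1]; rewrite ddE expr1n mul1r; apply: cp; apply/andP; split; lra.
- by rewrite !vE ahE aE.
- by rewrite !dE ahE aE !mul1r.
- move=> x /andP[x0 x1]; rewrite vE.
  have := est (1 * x - a); rewrite HE (_ : a + (1 * x - a) = x); last by ring.
  by apply; apply/andP; split; lra.
Qed.

(** In terms of [x], the local coordinate at the end point [- s] is
    [s * x + 1], and the inner end of the piece is [- s + s * h]. *)
Definition end_piece_spec s h (P : {poly R}) :=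
  [/\ (size P <= r.+2)%N,
    forall x, 0 <= s * x + 1 <= h -> 0 <= P^`(2).[x],
    P.[- s + s * h] <= F 0%N (- s + s * h) <= P.[- s + s * h] + 2 * (h ^+ r * W h),
    s * P^`().[- s + s * h] <= s * F 1%N (- s + s * h) &
    [/\ P.[- s] = F 0%N (- s),
     forall x y, 0 < s * x + 1 -> s * x + 1 <= h -> 0 < y -> (s * x + 1) * h <= y ^+ 2 ->
      `|F 0%N x - P.[x]| <= 12 * ((s * x + 1) ^+ r * W y) &
     forall x, 0 < s * x + 1 -> s * x + 1 <= h ->
      `|F 0%N x - P.[x]| <= 9 * ((s * x + 1) ^+ r * V (s * x + 1))]].

Lemma end_piece_global s : s = 1 \/ s = -1 ->
  exists2 h0 : R, 0 < h0 <= 1 & forall h, 0 < h <= h0 -> exists P, end_piece_spec s h P.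
Proof.
move=> sE; have ss : s * s = 1 by case: sE => ->; ring.
pose H i t := s ^+ i * F i (- s + s * t).
have HE0 t : H 0%N t = F 0%N (- s + s * t) by rewrite /H expr0 mul1r.
have sub t : 0 <= t <= 1 -> -1 <= - s + s * t <= 1.
  by move=> /andP[? ?]; case: sE => ->; apply/andP; split; lra.
have cH : chain 0 1 r H by apply: (chain_affine sub cF).
have monoH x y : 0 <= x -> x <= y -> y <= 1 -> H 1%N x <= H 1%N y.
  move=> x0 xy yh; rewrite /H expr1; case: sE => sE; rewrite sE.
    by rewrite !mul1r; apply: mono; lra.
  by rewrite !mulN1r lerN2; apply: mono; lra.
have [h0 h01 pieces] := endpoint_piece r0 cH monoH.
exists h0 => // h hh0; have [p sp] := pieces h hh0.
have {hh0} [hp hh0] := andP hh0.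
have h1 : h <= 1 by case/andP: h01 => _; apply: le_trans.
have cHh : chain 0 h r H by apply: chain_sub cH.
have subh t : 0 <= t <= h -> -1 <= - s + s * t <= 1.
  by move=> /andP[t0 th]; apply: sub; rewrite t0 (le_trans th).
have [d2 d1] := @local_differences R (F r) r (- s) s h cg sE subh.
have W2 := @modulus2_double R (F r) cg; have V2 := @modulus1_double R (F r) cg.
have Wm := modulus_mono cg 2; have Vm := modulus_mono cg 1.
have W0 t : 0 < t -> 0 <= W t by move=> t0; apply: modulus_ge0 => //; apply: ltW.
have V0 t : 0 < t -> 0 <= V t by move=> t0; apply: modulus_ge0 => //; apply: ltW.
have s0 : s != 0 by case: sE => ->; rewrite ?oppr_eq0 oner_neq0.
have [vE dE ddE sz] := @affine_comp R p s 1 s0.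
set P := p \Po _ in vE dE ddE sz.
have innE : s * (- s + s * h) + 1 = h by rewrite mulrDr mulrA ss mulrN ss; ring.
have backE x : - s + s * (s * x + 1) = x by rewrite mulrDr mulrA ss; ring.
have bE : s * - s + 1 = 0 by rewrite mulrN ss addNr.
have [szp cp ph p1h _] := sp.
exists P; split.
- exact: leq_trans sz szp.
- by move=> x xh; rewrite ddE expr2 ss mul1r; apply: cp.
- rewrite vE innE -HE0; apply/andP; split => //.
  have := endpoint_estimate_inner hp cHh Wm d2 sp.
  by rewrite ler_norml; lra.
- by rewrite dE innE mulrA ss mul1r; move: p1h; rewrite /H expr1.
split.
- by rewrite vE bE (endpoint_estimate0 r0 hp cHh Wm d2 sp) HE0 mulr0 addr0.
- move=> x y x0 xh y0 xy; rewrite vE.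
  by have := endpoint_estimate2 hp cHh W2 Wm W0 d2 sp x0 xh y0 xy; rewrite HE0 backE.
- move=> x x0 xh; rewrite vE.
  by have := endpoint_estimate1 hp V2 Vm V0 d1 sp x0 xh; rewrite HE0 backE.
Qed.

Lemma modulus2_scale y : 0 < y -> W (16 * y) <= 256 * W y.
Proof.
move=> y0; have d := @modulus2_double R (F r) cg.
have pos k : 0 < k -> 0 < k * y by move=> k0; apply: mulr_gt0.
have := d y y0; have := d (2 * y) (pos 2 (ltr0Sn _ _)).
have := d (4 * y) (pos 4 (ltr0Sn _ _)); have := d (8 * y) (pos 8 (ltr0Sn _ _)).
have -> : 2 * (8 * y) = 16 * y by ring.
have -> : 2 * (4 * y) = 8 * y by ring.
have -> : 2 * (2 * y) = 4 * y by ring.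
lra.
Qed.

Lemma power_modulus_le a y : 0 < a -> 0 < y -> a <= 16 * y ->
  a ^+ r * W a <= 256 * 16 ^+ r * (y ^+ r * W y).
Proof.
move=> a0 y0 ay.
have Wy : 0 <= W y by apply: modulus_ge0 => //; apply: ltW.
have Wa : 0 <= W a by apply: modulus_ge0 => //; apply: ltW.
have h1 : a ^+ r <= 16 ^+ r * y ^+ r by rewrite -exprMn lerXn2r // nnegrE ?mulr_ge0 // ltW.
have h2 : W a <= 256 * W y by apply: le_trans (modulus2_scale y0); apply: modulus_mono.
apply: le_trans (ler_pM _ Wa h1 h2) _; first by rewrite exprn_ge0 // ltW.
by rewrite le_eqVlt; apply/orP; left; apply/eqP; ring.
Qed.

Lemma phi_sqr x : -1 <= x <= 1 -> phi x ^+ 2 = 1 - x ^+ 2.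
Proof. by move=> /andP[? ?]; rewrite /phi sqr_sqrtr // subr_ge0; nra. Qed.

(** With [t] the distance to the end point, [phi x ^+ 2 = t * (2 - t)] is comparable
    to [t], and [h <= 8 * z ^+ 2]; so the local estimate applies with [y] equal to
    [4 * (phi x * z)], and [t] is bounded both by [phi x ^+ 2] and by a multiple of
    [phi x * z]. *)
Lemma end_estimate_phi s h x (e z : R) : s = 1 \/ s = -1 -> 0 < z -> h <= 8 * z ^+ 2 -> h <= 1 ->
  0 <= s * x + 1 <= h -> 0 <= e ->
  (s * x + 1 = 0 -> e = 0) ->
  (forall y, 0 < s * x + 1 -> 0 < y -> (s * x + 1) * h <= y ^+ 2 -> e <= 12 * ((s * x + 1) ^+ r * W y)) ->
  (0 < s * x + 1 -> e <= 9 * ((s * x + 1) ^+ r * V (s * x + 1))) ->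
  [/\ e <= 12 * 256 * 16 ^+ r * ((phi x * z) ^+ r * W (phi x * z)),
      e <= 12 * 256 * 16 ^+ r * (phi x ^+ (2 * r) * W (phi x * z)) &
      e <= 12 * 256 * 16 ^+ r * (phi x ^+ (2 * r) * V (phi x ^+ 2))].
Proof.
move=> sE z0 hz h1 /andP[t0 th] e0 eq0 est2 est1.
have x1 : -1 <= x <= 1 by move: t0 th; case: sE => -> ? ?; apply/andP; split; lra.
have p2 := phi_sqr x1.
have ph0 : 0 <= phi x by apply: sqrtr_ge0.
have K1 : 1 <= 16 ^+ r :> R by rewrite exprn_ege1 // ler1n.
set t := s * x + 1 in t0 th eq0 est2 est1.
have tE : phi x ^+ 2 = t * (2 - t).
  by rewrite p2 /t; case: sE => ->; ring.
have Wy0 y : 0 <= y -> 0 <= W y by move=> ?; apply: modulus_ge0.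
have Vy0 y : 0 <= y -> 0 <= V y by move=> ?; apply: modulus_ge0.
have pz0 : 0 <= phi x * z by rewrite mulr_ge0 // ltW.
move: (t0); rewrite le_eqVlt => /predU1P[tz|tp].
  have K0 : 0 <= 12 * 256 * 16 ^+ r :> R.
    by apply: mulr_ge0; [apply: mulr_ge0; exact: ler0n|exact: le_trans ler01 K1].
  have q0 : 0 <= phi x ^+ (2 * r) by exact: exprn_ge0.
  rewrite (eq0 (esym tz)); split; apply: (mulr_ge0 K0); apply: mulr_ge0.
  - exact: exprn_ge0.
  - exact: Wy0.
  - exact: q0.
  - exact: Wy0.
  - exact: q0.
  - by apply: Vy0; apply: exprn_ge0.
have tphi : t <= phi x ^+ 2 by rewrite tE ler_peMr // lerBrDr; lra.
have php : 0 < phi x by rewrite lt_neqAle ph0 andbT eq_sym; apply/eqP => p0; move: tphi; rewrite p0 expr0n /=; lra.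
have yp : 0 < phi x * z by rewrite mulr_gt0.
pose y := 4 * (phi x * z); have y0 : 0 < y by rewrite mulr_gt0.
have thy : t * h <= y ^+ 2.
  have -> : y ^+ 2 = phi x ^+ 2 * (16 * z ^+ 2) by rewrite /y; ring.
  apply: ler_pM => //; first by apply: le_trans th.
  by have := sqr_ge0 z; lra.
have e2 := est2 y tp y0 thy.
have Wyz : W y <= 256 * W (phi x * z).
  apply: le_trans (modulus2_scale yp); apply: modulus_mono => //.
  by rewrite /y; lra.
have tr0 : 0 <= t ^+ r by rewrite exprn_ge0.
have k1 : t ^+ r * W y <= t ^+ r * (256 * W (phi x * z)) by rewrite ler_wpM2l.
have tr2 : t ^+ r <= phi x ^+ (2 * r) by rewrite exprM lerXn2r ?nnegrE ?exprn_ge0.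
have y160 : 0 <= 16 * (phi x * z) by rewrite mulr_ge0.
have ty : t <= 16 * (phi x * z).
  rewrite -(@ler_pXn2r _ 2) ?nnegrE //.
  apply: (@le_trans _ _ (t * h)); first by rewrite expr2 ler_wpM2l.
  apply: le_trans thy _; rewrite lerXn2r ?nnegrE ?(ltW y0) // /y.
  by rewrite ler_wpM2r // ler_nat.
have tr1 : t ^+ r <= 16 ^+ r * (phi x * z) ^+ r.
  by rewrite -exprMn lerXn2r ?nnegrE.
have W256 : 0 <= 256 * W (phi x * z) by apply: mulr_ge0; [exact: ler0n|exact: Wy0].
split.
- apply: le_trans e2 _.
  have : t ^+ r * (256 * W (phi x * z)) <= 16 ^+ r * (phi x * z) ^+ r * (256 * W (phi x * z)).
    exact: ler_wpM2r.
  lra.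
- apply: le_trans e2 _.
  have k2 : t ^+ r * (256 * W (phi x * z)) <= phi x ^+ (2 * r) * (256 * W (phi x * z)).
    exact: ler_wpM2r.
  have k3 : 0 <= phi x ^+ (2 * r) * W (phi x * z).
    by apply: mulr_ge0; [exact: exprn_ge0|exact: Wy0].
  have := ler_wpM2r k3 K1; lra.
- apply: le_trans (est1 tp) _.
  have k2 : t ^+ r * V t <= phi x ^+ (2 * r) * V (phi x ^+ 2).
    by apply: ler_pM => //; [exact: Vy0|apply: modulus_mono].
  have k3 : 0 <= phi x ^+ (2 * r) * V (phi x ^+ 2) by rewrite mulr_ge0 ?exprn_ge0 // Vy0 // exprn_ge0.
  have := ler_wpM2r k3 K1; lra.
Qed.

End GlobalPieces.

(** * The spline on an abstract partition *)

(** [E] bounds the defects of the end pieces at their inner knots, and [d] is the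
    distance kept from the end intervals by every interval that meets the open
    interval from [al] to [be], where the derivative is known to increase. *)
Section Spline.
Variable R : realType.
Variables (r : nat) (F : nat -> R -> R).
Hypothesis r0 : (0 < r)%N.
Hypothesis cF : chain (-1) 1 r F.
Hypothesis mono : forall x y : R, -1 <= x -> x <= y -> y <= 1 -> F 1%N x <= F 1%N y.

Local Notation W := (modulus 2 (F r)).
Local Notation V := (modulus 1 (F r)).

Variables (m : nat) (t : nat -> R) (PL PR : {poly R}) (E d al be : R).
Hypothesis tm : forall i, (i <= m)%N -> t i < t i.+1.
Hypothesis t0 : t 0%N = -1.
Hypothesis tn : t m.+1 = 1.
Hypothesis sPL : (size PL <= r.+2)%N.
Hypothesis cPL : forall x, t 0%N <= x <= t 1%N -> 0 <= PL^`(2).[x].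
Hypothesis vPL : PL.[t 1%N] <= F 0%N (t 1%N) <= PL.[t 1%N] + E.
Hypothesis dPL : PL^`().[t 1%N] <= F 1%N (t 1%N).
Hypothesis sPR : (size PR <= r.+2)%N.
Hypothesis cPR : forall x, t m <= x <= t m.+1 -> 0 <= PR^`(2).[x].
Hypothesis vPR : PR.[t m] <= F 0%N (t m) <= PR.[t m] + E.
Hypothesis dPR : F 1%N (t m) <= PR^`().[t m].
Hypothesis d0 : 0 < d.
Hypothesis albe : al < be.
Hypothesis al1 : -1 <= al.
Hypothesis be1 : be <= 1.
Hypothesis Fab : F 1%N al < F 1%N be.
Hypothesis far : forall i, (i <= m)%N -> al < t i.+1 -> t i < be ->
  d <= t i - t 1%N /\ d <= t m - t i.+1.
Hypothesis mass : 2 * (2 * E / d) <= (F 1%N be - F 1%N al) / m.+1%:R.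

Let mu : R := 2 * E / d.

Lemma knots_le i j : (i <= j)%N -> (j <= m.+1)%N -> t i <= t j.
Proof. exact: (increasing_le tm). Qed.

Lemma spline_defect_ge0 : 0 <= E.
Proof. by have := vPL => /andP[]; lra. Qed.

Lemma knots_range j : (j <= m.+1)%N -> -1 <= t j <= 1.
Proof. by move=> jm; rewrite -t0 -tn !knots_le. Qed.

(** The increase of [F 1] from [al] to [be] is distributed over [m.+1] intervals, so
    one of them carries at least the average.  Clamping the knots to [[al, be]]
    makes the other intervals carry nothing, and [far] keeps this one at distance
    [d] from the ends. *)
Lemma heavy_interval : exists2 i, (i <= m)%N & [/\ d <= t i - t 1%N, d <= t m - t i.+1 &
  2 * mu <= F 1%N (t i.+1) - F 1%N (t i)].
Proof.
pose cl x := Num.max al (Num.min be x).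
have [i im hi] := @pigeonhole_increment R (fun j => F 1%N (cl (t j))) m.+1 isT.
have cl1 : cl 1 = be.
  by rewrite /cl; have -> : Num.min be 1 = be; [apply/min_idPl|apply/max_idPr/ltW].
have cln1 : cl (-1) = al.
  rewrite /cl; have -> : Num.min be (-1) = -1 by apply/min_idPr; apply: le_trans al1 (ltW albe).
  exact/max_idPl.
rewrite /= t0 tn cl1 cln1 in hi.
have bpos : 0 < (F 1%N be - F 1%N al) / m.+1%:R by rewrite divr_gt0 ?subr_gt0 ?ltr0n.
have gpos := lt_le_trans bpos hi; rewrite subr_gt0 in gpos.
have ti := tm im.
have r1 : al < t i.+1.
  rewrite ltNge; apply/negP => h.
  have E1 x : x <= al -> cl x = al.
    by move=> xa; apply/max_idPl; rewrite ge_min xa orbT.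
  by move: gpos; rewrite !E1 ?ltxx // (le_trans (ltW ti)).
have r2 : t i < be.
  rewrite ltNge; apply/negP => h.
  have E1 x : be <= x -> cl x = be.
    move=> xa; rewrite /cl; have -> : Num.min be x = be by apply/min_idPl.
    exact/max_idPr/ltW.
  by move: gpos; rewrite !E1 ?ltxx // (le_trans h (ltW ti)).
have [f1 f2] := far im r1 r2.
have /andP[ti1 ti2] := knots_range (leqW im : (i <= m.+1)%N).
have /andP[tj1 tj2] := knots_range (im : (i.+1 <= m.+1)%N).
have c1 : F 1%N (cl (t i.+1)) <= F 1%N (t i.+1).
  apply: mono => //; first by rewrite /cl le_max al1.
  by rewrite /cl ge_max (ltW r1) ge_min lexx orbT.
have c2 : F 1%N (t i) <= F 1%N (cl (t i)).
  apply: mono => //; first by rewrite /cl le_max le_min lexx (ltW r2) orbT.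
  by rewrite /cl ge_max ge_min be1 (le_trans (ltW albe) be1).
exists i => //; split => //; apply: le_trans mass (le_trans hi _); lra.
Qed.

Definition spline_spec (S : R -> R) := [/\
  forall j, (j <= m)%N -> exists2 p : {poly R}, (size p <= r.+2)%N &
      forall y, t j <= y <= t j.+1 -> S y = p.[y],
  cont_on (-1) 1 S /\ has_subgradients (-1) 1 S,
  forall x, t 0%N <= x <= t 1%N -> S x = PL.[x],
  forall x, t m <= x <= t m.+1 -> S x = PR.[x] &
  forall j, (0 < j < m)%N -> forall x, t j <= x <= t j.+1 ->
    `|F 0%N x - S x| <= (3 + 32 * mass_const R r) *
      ((t j.+1 - t j) * (W (t j.+1 - t j) * (t j.+1 - t j) ^+ (r - 1) + mu)) + E].

(** The heavy interval provides the kink of size [mu] at one of its two knots; the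
    slopes of the correction are at most [E / d] on either side. *)
Lemma spline : exists S, spline_spec S.
Proof.
have E0 := spline_defect_ge0.
have mu0 : 0 <= mu by rewrite divr_ge0 ?mulr_ge0 // ltW.
have ex j : exists P : {poly R}, (0 < j < m)%N -> [/\ (size P <= r.+2)%N,
    forall x, t j <= x <= t j.+1 -> 0 <= P^`(2).[x],
    P.[t j] = F 0%N (t j) /\ P.[t j.+1] = F 0%N (t j.+1),
    [/\ F 1%N (t j) <= P^`().[t j], P^`().[t j.+1] <= F 1%N (t j.+1) &
      2 * mu <= F 1%N (t j.+1) - F 1%N (t j) ->
        F 1%N (t j) + mu <= P^`().[t j] \/ P^`().[t j.+1] <= F 1%N (t j.+1) - mu] &
    forall x, t j <= x <= t j.+1 -> `|F 0%N x - P.[x]| <= (3 + 32 * mass_const R r) *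
      ((t j.+1 - t j) * (W (t j.+1 - t j) * (t j.+1 - t j) ^+ (r - 1) + mu))].
  have [/andP[j0 jm]|_] := boolP (0 < j < m)%N; last by exists 0.
  have h0 : 0 < t j.+1 - t j by rewrite subr_gt0 tm // ltnW.
  have /andP[a1 _] : -1 <= t j <= 1 by apply: knots_range; apply: leqW; apply: ltnW.
  have /andP[_ a2] : -1 <= t j.+1 <= 1 by apply: knots_range; apply: ltnW.
  have hE : t j + (t j.+1 - t j) = t j.+1 by rewrite addrC subrK.
  have := @middle_piece_global R r F r0 cF mono (t j) (t j.+1 - t j) mu h0 a1.
  by rewrite hE => /(_ a2 mu0) [P hP]; exists P.
have [PM hPM] := choice ex.
have fin kk : (1 < kk < m)%N -> d <= t kk - t 1%N -> d <= t m - t kk ->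
    (PM kk.-1)^`().[t kk] + mu <= (PM kk)^`().[t kk] -> exists S, spline_spec S.
  move=> kkm dl dr hK.
  have w1 : 0 < t kk - t 1%N by apply: lt_le_trans dl.
  have w2 : 0 < t m - t kk by apply: lt_le_trans dr.
  pose eL := F 0%N (t 1%N) - PL.[t 1%N]; pose eR := F 0%N (t m) - PR.[t m].
  have eL0 : 0 <= eL <= E by case/andP: vPL => ? ?; rewrite /eL; apply/andP; split; lra.
  have eR0 : 0 <= eR <= E by case/andP: vPR => ? ?; rewrite /eR; apply/andP; split; lra.
  case/andP: eL0 => eL0 eLE; case/andP: eR0 => eR0 eRE.
  pose kL := eL / (t kk - t 1%N); pose kR := eR / (t m - t kk).
  have kL0 : 0 <= kL by rewrite divr_ge0 // ltW.
  have kR0 : 0 <= kR by rewrite divr_ge0 // ltW.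
  have kLw : kL * (t kk - t 1%N) = eL by rewrite divfK // gt_eqF.
  have kRw : kR * (t m - t kk) = eR by rewrite divfK // gt_eqF.
  have kLd : kL <= E / d by apply: ler_pM => //; [rewrite invr_ge0 ltW|rewrite lef_pV2].
  have kRd : kR <= E / d by apply: ler_pM => //; [rewrite invr_ge0 ltW|rewrite lef_pV2].
  have [||||S [Sv Sc Sg]] := @assemble R m kk t (F 0%N) (F 1%N) PL PR PM kL kR kkm tm kL0 kR0.
  - by split=> //; move: kLw; rewrite /eL; lra.
  - by split=> //; move: kRw; rewrite /eR; lra.
  - by move=> j jm; have [_ c1 [v1 v2] [s1 s2 _] _] := hPM j jm.
  - apply: le_trans hK; have -> : mu = E / d + E / d by rewrite /mu; ring.
    by rewrite -addrA lerD2l lerD.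
  have [k1 km] := andP kkm.
  have m0 : (0 < m)%N by apply: leq_trans km.
  rewrite t0 tn in Sc Sg.
  exists S; split=> //.
  - move=> j jm; exists (assembled m kk t PL PR PM kL kR j); last exact: Sv.
    rewrite /assembled; case: (posnP j) => [_ //|jp].
    case: eqP => [//|/eqP jnm]; have jm' : (0 < j < m)%N by rewrite jp ltn_neqAle jnm.
    have [sz _ _ _ _] := hPM j jm'.
    have sX (k : R) : (size (k *: ('X - (t kk)%:P)) <= r.+2)%N.
      by apply: leq_trans (size_scale_leq _ _) _; rewrite size_XsubC.
    case: ifP => _; apply: leq_trans (size_polyD _ _) _; rewrite geq_max sz ?size_polyN; exact: sX.
  - by move=> x x1; rewrite (Sv 0%N).
  - by move=> x x1; rewrite (Sv m) // /assembled (gtn_eqF m0) eqxx.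
  - move=> j jm x xj; case/andP: (jm) => j0 jm'; rewrite (Sv j (ltnW jm')) //.
    have [_ _ _ _ est] := hPM j jm.
    rewrite /assembled (gtn_eqF j0) (ltn_eqF jm').
    have [xj1 xj2] := andP xj.
    have bnd e : `|e| <= E -> forall p : {poly R}, `|F 0%N x - (p.[x] + e)| <= `|F 0%N x - p.[x]| + E.
      move=> eE p; rewrite opprD addrA; apply: le_trans (ler_normB _ _) _.
      by rewrite lerD2l.
    case: ifP => jk.
      have tx : t j.+1 <= t kk by apply: knots_le => //; apply: ltnW; apply: leqW.
      have t1x : t 1%N <= t j by apply: knots_le => //; apply: leqW; apply: ltnW.
      have -> : (PM j + kL *: ('X - (t kk)%:P)).[x] = (PM j).[x] + kL * (x - t kk) by rewrite !hornerE.
      apply: le_trans (bnd _ _ _) _; last by rewrite lerD2r est.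
      rewrite normrM (ger0_norm kL0) ler0_norm ?opprB; last by lra.
      apply: le_trans eLE; rewrite -kLw ler_wpM2l //; lra.
    have tx : t kk <= t j.
      by apply: knots_le; [rewrite leqNgt jk|apply: leqW; apply: ltnW].
    have t1x : t j.+1 <= t m by apply: knots_le => //.
    have -> : (PM j - kR *: ('X - (t kk)%:P)).[x] = (PM j).[x] + - (kR * (x - t kk)) by rewrite !hornerE.
    apply: le_trans (bnd _ _ _) _; last by rewrite lerD2r est.
    rewrite normrN normrM (ger0_norm kR0) ger0_norm; last by lra.
    apply: le_trans eRE; rewrite -kRw ler_wpM2l //; lra.
have [i im [f1 f2 f3]] := heavy_interval.
have i1 : (1 < i)%N.
  rewrite ltnNge; apply/negP => i1.
  have := @knots_le i 1 i1 isT; move: d0 f1; lra.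
have i1m : (i.+1 < m)%N.
  rewrite ltnNge; apply/negP => mi.
  have := @knots_le m i.+1 mi im; move: d0 f2; lra.
have im' : (i < m)%N by apply: ltnW.
have ti := tm im.
have [_ _ _ [s1 s2 sm] _] := hPM i (introT andP (conj (ltnW i1) im')).
have [h|h] := sm f3.
  apply: (fin i); rewrite ?i1 //; first by lra.
  have [_ _ _ [_ s3 _] _] := hPM i.-1 (ltac:(by case: (i) i1 im' => [//|[//|k]] /= _ /ltnW)).
  by rewrite prednK ?(ltnW i1) // in s3; lra.
have [_ _ _ [s3 _ _] _] := hPM i.+1 i1m.
apply: (fin i.+1); [by rewrite (leqW i1)|lra|by []|].
by move: h s3 => /=; lra.
Qed.

End Spline.

(** * Choice of the constants *)

Section Main.
Variable R : realType.
Implicit Types (x y z s h t : R).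

(** The factor [256 * 16 ^+ r] comes from replacing lengths up to [16 * y] by [y] in
    [power_modulus_le].  In the other factor, [3 + 32 * mass_const r] is the constant
    of [middle_piece], applied to at most [5] such terms, and [2] accounts for the
    correction. *)
Definition jackson_const r : R := (5 * (3 + 32 * mass_const R r) + 2) * (256 * 16 ^+ r).

Lemma jackson_const_ge r : 12 * 256 * 16 ^+ r <= jackson_const r.
Proof.
rewrite /jackson_const -(mulrA 12); apply: ler_wpM2r.
  by apply: mulr_ge0; [exact: ler0n|apply: exprn_ge0; exact: ler0n].
by have := mass_const_ge1 R r; lra.
Qed.

Lemma jackson_const_gt0 r : 0 < jackson_const r.
Proof.
apply: lt_le_trans (jackson_const_ge r).
by apply: mulr_gt0; [apply: mulr_gt0; exact: ltr0Sn|apply: exprn_gt0; exact: ltr0Sn].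
Qed.

(** All that is used of the [m.+2] Chebyshev knots, with [z] the inverse of their
    number of intervals and [h] the length of the two outer ones. *)
Record fine_knots (m : nat) (t : nat -> R) z h : Prop := FineKnots {
  knots_increasing : forall i, (i <= m)%N -> t i < t i.+1;
  knots_first : t 0%N = -1;
  knots_last : t m.+1 = 1;
  knots_second : t 1%N = -1 + h;
  knots_penultimate : t m = 1 - h;
  knots_scale : 0 < z <= 1 / 16;
  knots_end_gap : z ^+ 2 <= h <= 8 * z ^+ 2;
  knots_gap : forall j, (j <= m)%N -> t j.+1 - t j <= 4 * z;
  knots_phi : forall j x, (0 < j < m)%N -> t j <= x <= t j.+1 ->
    z <= phi x /\ t j.+1 - t j <= 12 * (phi x * z) }.

Lemma chebyshev_fine_knots m : (16 <= m.+1)%N ->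
  fine_knots m (@chebyshev_knot R m.+1) m.+1%:R^-1 (1 + @chebyshev_knot R m.+1 1).
Proof.
move=> n16; split.
- by move=> i im; apply: knot_lt => //; rewrite ltnSn.
- exact: knot0.
- exact: knotn.
- by rewrite addrA addNr add0r.
- by have := knot_sym R n16 (isT : (1 <= m.+1)%N); rewrite subn1 /= => ->; rewrite opprD addrA subrr sub0r.
- exact: knot_scale.
- by rewrite exprVn; exact: knot1_bounds.
- by move=> j jm; apply: knot_gap.
move=> j x /andP[j0 jm] xj; split; last by have := phi_gap n16 j0 (jm : (j.+1 < m.+1)%N) xj.
rewrite -div1r; apply: (phi_ge n16) => /=; case/andP: xj => xj1 xj2; apply/andP; split.
  by apply: le_trans xj1; apply: knot_le; rewrite // j0 leqW // ltnW.
by apply: le_trans xj2 _; apply: knot_le; rewrite // jm leqnSn.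
Qed.

Lemma left_coordinate x h : (0 <= 1 * x + 1 <= h) = (-1 <= x <= -1 + h).
Proof. by rewrite mul1r -lerBlDr sub0r -lerBrDr [h - 1]addrC. Qed.

Lemma right_coordinate x h : (0 <= -1 * x + 1 <= h) = (1 - h <= x <= 1).
Proof. by rewrite mulN1r addrC subr_ge0 lerBlDr -lerBlDl andbC. Qed.

Section NonLinear.
Variables (r : nat) (F : nat -> R -> R).
Hypothesis r0 : (0 < r)%N.
Hypothesis cF : chain (-1) 1 r F.
Hypothesis mono : forall x y, -1 <= x -> x <= y -> y <= 1 -> F 1%N x <= F 1%N y.

Local Notation W := (modulus 2 (F r)).
Local Notation V := (modulus 1 (F r)).
Local Notation knot := (@chebyshev_knot R).

(** Close to an end point all three required estimates hold at once. *)
Definition end_bounds z x (e : R) :=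
  [/\ e <= jackson_const r * ((phi x * z) ^+ r * W (phi x * z)),
      e <= jackson_const r * (phi x ^+ (2 * r) * W (phi x * z)) &
      e <= jackson_const r * (phi x ^+ (2 * r) * V (phi x ^+ 2))].

(** On an inner interval both its length [hj] and the length [h] of the outer ones
    are at most [16 * y] with [y = phi x / n], so every term is a multiple of
    [y ^+ r * W y]. *)
Lemma middle_error hj h mu y E (e : R) : 0 < hj -> 0 < h -> 0 < y -> hj <= 16 * y -> h <= 16 * y ->
  E = 2 * (h ^+ r * W h) -> hj * mu <= 2 * E ->
  e <= (3 + 32 * mass_const R r) * (hj * (W hj * hj ^+ (r - 1) + mu)) + E ->
  e <= jackson_const r * (y ^+ r * W y).
Proof.
move=> hj0 h0 y0 hjy hy EE hmu le_e.
have A1 := power_modulus_le cF hj0 y0 hjy; have A2 := power_modulus_le cF h0 y0 hy.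
rewrite /jackson_const -[X in _ <= X]mulrA; set A := 256 * _ * _ in A1 A2 *.
set C := 3 + 32 * mass_const R r in le_e *.
have C0 : 0 <= C by have := mass_const_ge1 R r; rewrite /C; lra.
have hE : hj * (W hj * hj ^+ (r - 1) + mu) <= 5 * A.
  have -> : hj * (W hj * hj ^+ (r - 1) + mu) = hj ^+ r * W hj + hj * mu.
    rewrite (_ : hj ^+ r = hj * hj ^+ (r - 1)); first by ring.
    by rewrite -exprS subn1 prednK.
  lra.
have := ler_wpM2l C0 hE; lra.
Qed.

Lemma end_error s h x z P : s = 1 \/ s = -1 -> 0 < z -> h <= 8 * z ^+ 2 -> h <= 1 ->
  0 <= s * x + 1 <= h -> end_piece_spec r F s h P -> end_bounds z x `|F 0%N x - P.[x]|.
Proof.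
move=> sE z0 hz h1 xh [_ _ _ _ [e0 e2 e1]]; case/andP: (xh) => x0 x1.
have cg : cont_on (-1) 1 (F r) by case: cF.
have [||y x0' y0 xy|x0'|k1 k2 k3] := @end_estimate_phi R r F cF s h x `|F 0%N x - P.[x]| z sE z0 hz h1 xh.
- exact: normr_ge0.
- move=> sx; have -> : x = - s by move: sx; case: sE => ->; lra.
  by rewrite e0 subrr normr0.
- exact: e2.
- exact: e1.
have ph0 : 0 <= phi x by apply: sqrtr_ge0.
have pz0 : 0 <= phi x * z by apply: mulr_ge0 => //; apply: ltW.
have lift (a b : R) : 0 <= b -> a <= 12 * 256 * 16 ^+ r * b -> a <= jackson_const r * b.
  by move=> b0 ab; apply: le_trans ab _; apply: ler_wpM2r => //; exact: jackson_const_ge.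
split; apply: lift => //; apply: mulr_ge0.
- exact: exprn_ge0.
- exact: modulus_ge0.
- exact: exprn_ge0.
- exact: modulus_ge0.
- exact: exprn_ge0.
- by apply: modulus_ge0 => //; apply: exprn_ge0.
Qed.

Section Partition.
Variables (al be d z h : R) (m : nat) (t : nat -> R) (PL PR : {poly R}).
Hypothesis albe : al < be.
Hypothesis dal : 2 * d <= 1 + al.
Hypothesis dbe : 2 * d <= 1 - be.
Hypothesis Fab : F 1%N al < F 1%N be.
Hypothesis zE : z = m.+1%:R^-1.
Hypothesis zd : 12 * z <= d.
Hypothesis zb : 64 * W 1 * z <= d * (F 1%N be - F 1%N al).
Hypothesis tk : fine_knots m t z h.
Hypothesis specL : end_piece_spec r F 1 h PL.
Hypothesis specR : end_piece_spec r F (-1) h PR.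

Let cg : cont_on (-1) 1 (F r). Proof. by case: cF. Qed.

Local Notation E := (2 * (h ^+ r * W h)).

Lemma end_gap_bounds : [/\ 0 < z, 0 < h, h <= 8 * z ^+ 2, h <= z & 0 < d].
Proof.
have [_ _ _ _ _ /andP[z0 z1] /andP[h1 h2] _ _] := tk.
have zz0 : 0 < z ^+ 2 by rewrite exprn_gt0.
have zz : z ^+ 2 <= z * (1 / 16) by rewrite expr2 ler_wpM2l // ltW.
move: zd; split=> //; [exact: lt_le_trans h1| |]; move: z0 h1 h2 zz zd; lra.
Qed.

Lemma end_defect_le : E <= 16 * z ^+ 2 * W 1.
Proof.
have [z0 h0 hz hz1 _] := end_gap_bounds.
have [_ _ _ _ _ /andP[_ z1] _ _ _] := tk.
have h1 : h <= 1 by move: hz1 z1; lra.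
have w10 : 0 <= W 1 by apply: modulus_ge0.
have hr' : h ^+ r <= h by rewrite -[X in _ <= X]expr1 ler_wiXn2l // ?(ltW h0).
have Wh : W h <= W 1 by apply: modulus_mono.
have k1 := ler_pM (exprn_ge0 r (ltW h0)) (modulus_ge0 cg 2 (ltW h0)) hr' Wh.
have k2 := ler_wpM2r w10 hz.
move: (W h) (W 1) k1 k2 => a b; lra.
Qed.

Lemma defect_ge0 : 0 <= E.
Proof.
have [_ h0 _ _ _] := end_gap_bounds.
by rewrite mulr_ge0 // mulr_ge0 ?exprn_ge0 ?(ltW h0) // modulus_ge0 // ltW.
Qed.

Lemma partition_far i : (i <= m)%N -> al < t i.+1 -> t i < be ->
  d <= t i - t 1%N /\ d <= t m - t i.+1.
Proof.
move=> im; have [z0 h0 _ hz d0] := end_gap_bounds; have [_ _ _ t1 tm _ _ gap _] := tk.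
move: (gap i im) z0 hz zd dal dbe; rewrite t1 tm; move=> *; split; lra.
Qed.

(** The required mass is of order [E], hence of order [z ^+ 2], whereas the average
    increase of [F 1] is of order [z].  This comparison fixes how small [z] must be
    in terms of the function. *)
Lemma partition_mass : 2 * (2 * E / d) <= (F 1%N be - F 1%N al) / m.+1%:R.
Proof.
have [z0 h0 _ hz d0] := end_gap_bounds.
have -> : 2 * (2 * E / d) = 4 * E / d by ring.
rewrite -zE ler_pdivrMr //.
have k1 := ler_wpM2r (ltW z0) zb; have k2 := end_defect_le.
move: k1 k2; set e := E; set b := F 1%N be - _; rewrite expr2; lra.
Qed.

Lemma partition_spline : exists S : R -> R,
  [/\ forall j, (j <= m)%N -> exists2 p : {poly R}, (size p <= r.+2)%N &
        forall y, t j <= y <= t j.+1 -> S y = p.[y],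
      cont_on (-1) 1 S /\ has_subgradients (-1) 1 S,
      forall x, -1 <= x <= 1 ->
        `|F 0%N x - S x| <= jackson_const r * ((phi x * z) ^+ r * W (phi x * z)) &
      forall x, (-1 <= x <= -1 + h) || (1 - h <= x <= 1) ->
        `|F 0%N x - S x| <= jackson_const r * (phi x ^+ (2 * r) * W (phi x * z)) /\
        `|F 0%N x - S x| <= jackson_const r * (phi x ^+ (2 * r) * V (phi x ^+ 2))].
Proof.
have [z0 h0 hz hz1 d0] := end_gap_bounds.
have [inc t0 tn t1 tm /andP[_ z1] _ gap tphi] := tk.
have h1 : h <= 1 by move: hz1 z1; lra.
have [sPL cPL vPL dPL _] := specL; have [sPR cPR vPR dPR _] := specR.
rewrite mul1r -t1 !mul1r in vPL dPL.
rewrite opprK mulN1r -tm !mulN1r lerN2 in vPR dPR.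
have cPL' x : t 0%N <= x <= t 1%N -> 0 <= PL^`(2).[x].
  by rewrite t0 t1 -left_coordinate; apply: cPL.
have cPR' x : t m <= x <= t m.+1 -> 0 <= PR^`(2).[x].
  by rewrite tn tm -right_coordinate; apply: cPR.
have al1 : -1 <= al by move: d0 dal; lra.
have be1 : be <= 1 by move: d0 dbe; lra.
have [S [Sp Scs SL SR SM]] := spline r0 cF mono inc t0 tn sPL cPL' vPL dPL sPR cPR' vPR dPR
  d0 albe al1 be1 Fab partition_far partition_mass.
have errL x : -1 <= x <= -1 + h -> end_bounds z x `|F 0%N x - S x|.
  move=> xk; rewrite SL ?t0 ?t1 //; apply: (end_error (or_introl erefl) z0 hz h1 _ specL).
  by rewrite left_coordinate.
have errR x : 1 - h <= x <= 1 -> end_bounds z x `|F 0%N x - S x|.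
  move=> xk; rewrite SR ?tn ?tm //; apply: (end_error (or_intror erefl) z0 hz h1 _ specR).
  by rewrite right_coordinate.
exists S; split=> //; last by move=> x /orP[/errL|/errR] [].
move=> x x1; have [j jm xj] : exists2 i, (i <= m)%N & t i <= x <= t i.+1.
  by apply: locate; rewrite t0 tn.
have [j0|jp] := posnP j; first by subst j; rewrite t0 t1 in xj; have [] := errL x xj.
have [jm'|jm'] := eqVneq j m; first by subst j; rewrite tn tm in xj; have [] := errR x xj.
have jj : (0 < j < m)%N by rewrite jp ltn_neqAle jm'.
have [p1 g1] := tphi j x jj xj.
have pz : z ^+ 2 <= phi x * z by rewrite expr2 ler_wpM2r // ltW.
have y0 : 0 < phi x * z by apply: lt_le_trans pz; rewrite exprn_gt0.
have hj0 : 0 < t j.+1 - t j by rewrite subr_gt0 inc.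
apply: (middle_error hj0 h0 y0 _ _ erefl _ (SM j jj x xj)).
- by apply: le_trans g1 _; rewrite ler_wpM2r ?(ltW y0) // ler_nat.
- by apply: le_trans hz _; move: pz y0; lra.
have gd : t j.+1 - t j <= d by apply: le_trans (gap j jm) _; move: z0 zd; lra.
rewrite [leLHS]mulrA ler_pdivrMr // [leLHS]mulrC; apply: ler_wpM2l gd.
by apply: mulr_ge0 => //; exact: defect_ge0.
Qed.

End Partition.

(** All requirements on [n] have the form [a / n <= c], where [c] is positive because
    [al] and [be] are interior and the derivative increases between them. *)
Lemma nonlinear_spline al be : -1 < al -> al < be -> be < 1 -> F 1%N al < F 1%N be ->
  exists N : nat, forall n : nat, (0 < n)%N -> (N <= n)%N -> exists S : R -> R,
  [/\ forall j, (j < n)%N -> exists2 p : {poly R}, (size p <= r.+2)%N &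
        forall y, knot n j <= y <= knot n j.+1 -> S y = p.[y],
      cont_on (-1) 1 S /\ has_subgradients (-1) 1 S,
      forall x, -1 <= x <= 1 ->
        `|F 0%N x - S x| <= jackson_const r * ((phi x / n%:R) ^+ r * W (phi x / n%:R)) &
      forall x, (-1 <= x <= -1 + n%:R ^- 2) || (1 - n%:R ^- 2 <= x <= 1) ->
        `|F 0%N x - S x| <= jackson_const r * (phi x ^+ (2 * r) * W (phi x / n%:R)) /\
        `|F 0%N x - S x| <= jackson_const r * (phi x ^+ (2 * r) * V (phi x ^+ 2))].
Proof.
move=> al1 albe be1 Fab.
have cg : cont_on (-1) 1 (F r) by case: cF.
have [hl /andP[hl0 hl1] left] := end_piece_global r0 cF mono (or_introl erefl : 1 = 1 \/ 1 = -1).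
have [hr /andP[hr0 hr1] right] := end_piece_global r0 cF mono (or_intror erefl : -1 = 1 \/ -1 = -1).
pose d : R := Num.min (1 + al) (1 - be) / 2.
have [d0 dal dbe] : [/\ 0 < d, 2 * d <= 1 + al & 2 * d <= 1 - be].
  have dd : 2 * d = Num.min (1 + al) (1 - be) by rewrite /d; field.
  rewrite dd !ge_min !lexx orbT; split=> //.
  by rewrite divr_gt0 // lt_min; apply/andP; split; lra.
clearbody d.
have b0 : 0 < F 1%N be - F 1%N al by rewrite subr_gt0.
have w10 : 0 <= W 1 by apply: modulus_ge0.
pose X := [:: 8 / hl; 8 / hr; 12 / d; 64 * W 1 / (d * (F 1%N be - F 1%N al))].
pose N := maxn 16 (\max_(x <- X) (Num.truncn x).+1).
exists N; case=> [//|m] _; rewrite geq_max => /andP[n16 Xn].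
have nR : 0 < m.+1%:R :> R by rewrite ltr0n.
have small a c : 0 < c -> a / c \in X -> a * m.+1%:R^-1 <= c.
  move=> c0 aX; rewrite ler_pdivrMr // mulrC -ler_pdivrMr //.
  apply: ltW; apply: lt_le_trans (truncnS_gt _) _; rewrite ler_nat.
  by apply: leq_trans Xn; apply: (@leq_bigmax_seq _ _ _ (fun x => (Num.truncn x).+1) _ aX).
have zl : 8 * m.+1%:R^-1 <= hl by apply: small; rewrite ?inE ?eqxx.
have zr : 8 * m.+1%:R^-1 <= hr by apply: small; rewrite ?inE ?eqxx ?orbT.
have zd : 12 * m.+1%:R^-1 <= d by apply: small; rewrite ?inE ?eqxx ?orbT.
have zb : 64 * W 1 * m.+1%:R^-1 <= d * (F 1%N be - F 1%N al).
  by apply: small; rewrite ?mulr_gt0 // !inE eqxx !orbT.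
have tk := chebyshev_fine_knots n16.
have [z0 h0 hz hz1 _] := end_gap_bounds zd tk.
have h_le c : 8 * m.+1%:R^-1 <= c -> 1 + knot m.+1 1 <= c.
  by apply: le_trans; apply: le_trans hz1 _; rewrite ler_peMl ?(ltW z0) // ler1n.
have [PL sL] := left _ (introT andP (conj h0 (h_le _ zl))).
have [PR sR] := right _ (introT andP (conj h0 (h_le _ zr))).
have [S [Sp Scs e1 e2]] := partition_spline albe dal dbe Fab erefl zd zb tk sL sR.
exists S; split=> // x xk; apply: e2.
have [_ _ _ _ _ _ /andP[zh _] _ _] := tk; rewrite exprVn in zh.
case/orP: xk => /andP[x0 x1]; apply/orP; [left|right].
  by rewrite x0 (le_trans x1) // lerD2l.
by rewrite x1 andbT (le_trans _ x0) // lerD2l lerN2.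
Qed.

End NonLinear.

(** The derivative is known to be constant only inside, which is all that the mean
    value theorem needs. *)
Lemma affine_of_constant_slope (f df : R -> R) : der_on (-1) 1 f df ->
  (forall x y, -1 < x -> x < y -> y < 1 -> df x = df y) ->
  forall x, -1 <= x <= 1 -> f x = f (-1) + df 0 * (x + 1).
Proof.
move=> dff cst x /andP[]; rewrite le_eqVlt => /predU1P[<- _|x0 x1]; first by ring.
have [c /andP[c0 c1] E] := mean_value dff (lexx _) x0 x1.
have dc : df c = df 0.
  have [c00|c00|->//] := ltgtP c 0; first by apply: cst => //; lra.
  by apply/esym/cst; lra.
by rewrite -dc -[f x](subrK (f (-1))) E; ring.
Qed.

End Main.

(** * The theorem *)

Theorem theorem2p1 (R : realType) (r : nat) (r_gt0 : (0 < r)%N) :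
  exists2 c : R, 0 < c &
  forall f : R -> R,
    Cr_in `[-1, 1] r f ->
    convex_function (`[-1, 1]%classic : set R) f ->
  exists N : nat, forall n : nat, (0 < n)%N -> (N <= n)%N ->
  exists S : R -> R,
    [/\ piecewise_poly n (@chebyshev_knot R n) (r + 2) S,
        convex_function (`[-1, 1]%classic : set R) S,
        forall x : R, x \in `[-1, 1] ->
          `|f x - S x| <= c * (phi x / n%:R) ^+ r
                          * modulus 2 (deriven_in `[-1, 1] r f) (phi x / n%:R)
      & forall x : R,
          (x \in `[-1, -1 + n%:R ^- 2]) || (x \in `[1 - n%:R ^- 2, 1]) ->
          `|f x - S x| <= c * phi x ^+ (2 * r)
                          * modulus 2 (deriven_in `[-1, 1] r f) (phi x / n%:R)
          /\
          `|f x - S x| <= c * phi x ^+ (2 * r)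
                          * modulus 1 (deriven_in `[-1, 1] r f) (phi x ^+ 2)].
Proof.
exists (jackson_const R r); first exact: jackson_const_gt0.
move=> f Cf cvxf; pose F i := deriven_in `[-1, 1] i f.
have cF : chain (-1) 1 r F := chain_of_Cr Cf.
have cg : cont_on (-1) 1 (F r) by case: cF.
have der1 : der_on (-1) 1 f (F 1%N) := cF.1 0%N r_gt0.
have mono : forall x y : R, -1 <= x -> x <= y -> y <= 1 -> F 1%N x <= F 1%N y.
  exact: mono_of_tangent (tangent_of_convex der1 (convex_ineq cvxf)).
have [[al [be [al1 albe be1 Fab]]]|nex] :=
  pselect (exists al be : R, [/\ -1 < al, al < be, be < 1 & F 1%N al < F 1%N be]).
  have [N HN] := nonlinear_spline r_gt0 cF mono al1 albe be1 Fab.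
  exists N => n n0 Nn; have [S [Sp [Sc Ss] e1 e2]] := HN n n0 Nn.
  exists S; split.
  - split; first exact/cont_onP.
    move=> j jn; have [p sp Sv] := Sp j jn; exists p; first by rewrite addn2.
    by move=> y; rewrite in_itv; apply: Sv.
  - exact: convex_of_subgradients.
  - by move=> x; rewrite in_itv -mulrA; apply: e1.
  - move=> x; rewrite !in_itv /= => /e2[e3 e4].
    by rewrite -[_ * _ ^+ _ * _]mulrA -[X in _ /\ _ <= X]mulrA; split; [exact: e3|exact: e4].
have lin := affine_of_constant_slope der1.
have {}lin : forall x, -1 <= x <= 1 -> f x = f (-1) + F 1%N 0 * (x + 1).
  apply: lin => x y x0 xy y1; apply/eqP; rewrite eq_le mono ?(ltW x0) ?(ltW xy) ?(ltW y1) //=.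
  by rewrite leNgt; apply/negP => h; apply: nex; exists x, y.
exists 0%N => n n0 _.
pose p : {poly R} := (f (-1) + F 1%N 0)%:P + F 1%N 0 *: 'X.
have pE x : p.[x] = f (-1) + F 1%N 0 * (x + 1) by rewrite /p !hornerE; ring.
have fp x : -1 <= x <= 1 -> `|f x - p.[x]| = 0 by move=> x1; rewrite lin // pE subrr normr0.
have sp : (size p <= r + 2)%N.
  apply: leq_trans (size_polyD _ _) _; rewrite geq_max (leq_trans (size_polyC_leq1 _)) ?addn2 //.
  by apply: leq_trans (size_scale_leq _ _) _; rewrite size_polyX.
have c0 := ltW (jackson_const_gt0 R r).
have ph0 (x : R) : 0 <= phi x by apply: sqrtr_ge0.
have pn0 (x : R) : 0 <= phi x / n%:R by rewrite divr_ge0.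
exists (horner p); split.
- split=> [|j jn]; last by exists p.
  by apply/cont_onP; apply: der_on_cont (@der_on_poly R _ _ _).
- apply: convex_of_subgradients => x x1; exists (F 1%N 0) => y y1.
  by rewrite !pE le_eqVlt; apply/orP; left; apply/eqP; ring.
- move=> x; rewrite in_itv => /fp ->.
  apply: mulr_ge0; last exact: (modulus_ge0 cg).
  by apply: mulr_ge0 => //; apply: exprn_ge0.
move=> x; rewrite !in_itv => xx.
have n2 : (0 : R) <= n%:R ^- 2 <= (1 : R).
  have n1 : 1 <= n%:R :> R by rewrite ler1n.
  by rewrite invr_ge0 exprn_ge0 //= invf_le1 ?exprn_gt0 ?exprn_ege1 // ltr0n.
have x1 : -1 <= x <= 1.
  by move: n2 xx => /andP[? ?] /= /orP[] /andP[? ?]; apply/andP; split; lra.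
have q0 : 0 <= jackson_const R r * phi x ^+ (2 * r) by apply: mulr_ge0 => //; apply: exprn_ge0.
rewrite fp //; split; apply: mulr_ge0 => //; apply: (modulus_ge0 cg) => //.
exact: exprn_ge0.
Qed.
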